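(* Let $X$ be an isotropic subgaussian random Hermitian $m\times m$ matrix (with subgaussian constant $b_0$) and let the noise variables $\xi_j$ be i.i.d. $N(0,\sigma_\xi^2)$. There exist a constant $c>0$ and, for all sufficiently large $D>0$, a constant $C>0$ (the constants depending only on $b_0$, and $C$ also on $D$) such that, for all $t>0$ with $\tau_n\le cn$ and $t_m\le n$, and for $$\varepsilon:=D\sigma_\xi\sqrt{\frac{m t_m}{n}},$$ with probability at least $1-e^{-t}$, $$\|\hat\rho^{\varepsilon}-\rho\|_{L_2(\Pi)}^2\le\inf_{S\in\mathcal S}\Bigl[2\|S-\rho\|_{L_2(\Pi)}^2+C\max\Bigl\{\frac{\sigma_\xi^2\,\mathrm{rank}(S)\,m\,t_m\log^2(mn)}{n},\ \frac{m(\tau_n\log n\vee t_m)}{n}\Bigr\}\Bigr].$$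
   Context: Notation: $\mathbb M_m(\mathbb C)$ is the set of complex $m\times m$ matrices, $\langle A,B\rangle=\mathrm{tr}(AB^* )$, $\|A\|_2=\langle A,A\rangle^{1/2}$. $\mathcal S=\{S\in\mathbb M_m(\mathbb C):S=S^*,\ S\ge0,\ \mathrm{tr}(S)=1\}$. $a\vee b=\max(a,b)$. Model: $\rho\in\mathcal S$ is unknown; $X,X_1,\dots,X_n$ are i.i.d. random Hermitian $m\times m$ matrices with distribution $\Pi$; $\xi_1,\dots,\xi_n$ are i.i.d. real mean-zero random variables independent of the $X_j$; $Y_j=\mathrm{tr}(\rho X_j)+\xi_j$. For $\varepsilon\ge0$, $$\hat\rho^{\varepsilon}\in\operatorname{argmin}_{S\in\mathcal S}\Bigl[n^{-1}\sum_{j=1}^n(Y_j-\mathrm{tr}(SX_j))^2+\varepsilon\,\mathrm{tr}(S\log S)\Bigr]$$ (with $0\log0=0$). $\|A\|_{L_2(\Pi)}^2=\mathbb E|\langle A,X\rangle|^2$. $t_m=t+\log(2m)$, $\tau_n=t+\log\log_2(2n)$. A random variable $\eta$ is subgaussian with parameter $\sigma$ if $\mathbb Ee^{\lambda\eta}\le e^{\lambda^2\sigma^2/2}$ for all $\lambda\in\mathbb R$. $X$ is isotropic subgaussian (with fixed constant $b_0>0$) if $\langle A,X\rangle$ is subgaussian with parameter $b_0\|A\|_{L_2(\Pi)}$ for all Hermitian $A$, and $\|A\|_{L_2(\Pi)}^2=\|A\|_2^2$ for all $A\in\mathbb M_m(\mathbb C)$. *)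

(* Defs.v *)
From HB Require Import structures.
From mathcomp Require Import all_boot all_order all_algebra.
From mathcomp Require Import spectral.
From mathcomp Require Import complex.
From mathcomp Require Import all_classical all_reals all_analysis.

Set Implicit Arguments.
Unset Strict Implicit.
Unset Printing Implicit Defensive.

Import Order.TTheory GRing.Theory Num.Theory.
Import numFieldNormedType.Exports.

Local Open Scope classical_set_scope.
Local Open Scope ring_scope.
Local Open Scope sesquilinear_scope.

(* MathComp and MathComp-Analysis; the complex field over R : realType is
   R[i] = complex R. *)

Section matrices.
Context {R : realType} {m : nat}.
Implicit Types A B S : 'M[R[i]]_m.

Definition mxinner A B : R[i] := \tr (A *m B^t*).

Definition hsnorm A : R := Num.sqrt (complex.Re (mxinner A A)).

(* In R[i], 0 <= z means that z is real and nonnegative. *)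
Definition psdmx S : Prop := forall v : 'rV[R[i]]_m, 0 <= (v *m S *m v^t*) 0 0.

Definition density : set 'M[R[i]]_m :=
  [set S | [/\ S \is hermsymmx, psdmx S & \tr S = 1]].

(* Logarithm of a positive semidefinite matrix by functional calculus on the
   unitary diagonalization S = P^-1 *m diag_mx d *m P. As ln 0 = 0, null
   eigenvalues are sent to 0, so that neg_entropy below uses 0 log 0 = 0. *)
Definition mxlog S : 'M[R[i]]_m :=
  invmx (spectralmx S)
  *m diag_mx (map_mx (fun z : R[i] => (ln (complex.Re z))%:C%C)
                     (spectral_diag S))
  *m spectralmx S.

Definition neg_entropy S : R := complex.Re (\tr (S *m mxlog S)).

End matrices.

HB.instance Definition _ (R : realType) := isPointed.Build R[i] 0.

Section random_matrices.
Context {R : realType} {m : nat}.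

Definition mx_cylinders : set (set 'M[R[i]]_m) :=
  [set B : set 'M[R[i]]_m | exists (i j : 'I_m) (U : set R), measurable U /\
     (B = [set A : 'M[R[i]]_m | U (complex.Re (A i j))]
      \/ B = [set A : 'M[R[i]]_m | U (complex.Im (A i j))])].

(* Complex matrices with their Borel sigma-algebra, generated by the real and
   imaginary parts of the entries. *)
Definition borelmx := g_sigma_algebraType mx_cylinders.

(* The square of the L_2(Pi) norm. *)
Definition L2sq (Pi : probability borelmx R) (A : 'M[R[i]]_m) : \bar R :=
  'E_Pi[fun x : borelmx => Normc.normc (mxinner A x) ^+ 2].

Definition L2norm (Pi : probability borelmx R) (A : 'M[R[i]]_m) : R :=
  Num.sqrt (fine (L2sq Pi A)).

End random_matrices.
Arguments borelmx : clear implicits.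

Definition subgaussian (R : realType) d (T : measurableType d)
    (mu : probability T R) (eta : T -> R) (s : R) : Prop :=
  forall lambda : R,
    ('E_mu[fun x => expR (lambda * eta x)]
       <= (expR (lambda ^+ 2 * s ^+ 2 / 2))%:E)%E.

(* Stated on the law Pi of the random Hermitian matrix X. For Hermitian A, the
   number <A, X> is almost surely real, and complex.Re only changes its type. *)
Definition isotropic_subgaussian (R : realType) (m : nat) (b0 : R)
    (Pi : probability (borelmx R m) R) : Prop :=
  (forall A : 'M[R[i]]_m, A \is hermsymmx ->
     subgaussian Pi (fun x : borelmx R m => complex.Re (mxinner A x))
                 (b0 * L2norm Pi A))
  /\ (forall A : 'M[R[i]]_m, L2sq Pi A = (hsnorm A ^+ 2)%:E).

(* N(0, s^2). The case s = 0 is singled out because normal_prob 0 0 is the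
   uniform law on [0, 1] rather than the Dirac mass. *)
Definition centered_normal (R : realType) (s : R) (V : set R) : \bar R :=
  if s == 0 then \d_(0 : R) V else normal_prob 0 s V.

(* Equality of laws is only required on measurable sets. *)
Definition has_law (R : realType) d d' (T : measurableType d)
    (T' : measurableType d') (P : probability T R) (Z : {RV P >-> T'})
    (law : set T' -> \bar R) : Prop :=
  forall B : set T', measurable B -> distribution P Z B = law B.

(* Mutual independence of X_1, ..., X_n, xi_1, ..., xi_n. Taking some of the
   sets equal to setT gives the product rule for every subfamily. *)
Definition mutually_independent (R : realType) d (T : measurableType d)
    d1 (T1 : measurableType d1) d2 (T2 : measurableType d2)
    (P : probability T R) (n : nat)
    (X : 'I_n -> {RV P >-> T1}) (xi : 'I_n -> {RV P >-> T2}) : Prop :=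
  forall (B : 'I_n -> set T1) (V : 'I_n -> set T2),
    (forall j, measurable (B j)) -> (forall j, measurable (V j)) ->
    P ((\bigcap_j (X j @^-1` B j)) `&` (\bigcap_j (xi j @^-1` V j)))
    = ((\prod_(j < n) P (X j @^-1` B j)) * \prod_(j < n) P (xi j @^-1` V j))%E.

Section estimator.
Context {R : realType} {m n : nat}.

(* Traces of products of two Hermitian matrices are real. *)
Definition response (rho x : 'M[R[i]]_m) (z : R) : R :=
  complex.Re (\tr (rho *m x)) + z.

Definition penalized_risk (x : 'I_n -> 'M[R[i]]_m) (y : 'I_n -> R) (eps : R)
    (S : 'M[R[i]]_m) : R :=
  n%:R^-1 * \sum_(j < n) (y j - complex.Re (\tr (S *m x j))) ^+ 2
  + eps * neg_entropy S.

Definition argmin_risk (x : 'I_n -> 'M[R[i]]_m) (y : 'I_n -> R) (eps : R) :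
    set 'M[R[i]]_m :=
  [set S | density S /\
    forall S', density S' ->
      penalized_risk x y eps S <= penalized_risk x y eps S'].

End estimator.

Definition t_m (R : realType) (m : nat) (t : R) : R := t + ln (2 * m%:R).

Definition tau_n (R : realType) (n : nat) (t : R) : R :=
  t + ln (ln (2 * n%:R) / ln 2).

(* Main.v *)
From HB Require Import structures.
Require Import Defs.
From mathcomp Require Import all_boot all_order all_algebra.
From mathcomp Require Import spectral.
From mathcomp Require Import complex.
From mathcomp Require Import all_classical all_reals all_analysis.
From mathcomp Require Import measurable_realfun.
From mathcomp Require Import ring lra zify.

Set Implicit Arguments.
Unset Strict Implicit.
Unset Printing Implicit Defensive.

Import Order.TTheory GRing.Theory Num.Theory.
Import numFieldNormedType.Exports.

Local Open Scope classical_set_scope.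
Local Open Scope ring_scope.
Local Open Scope sesquilinear_scope.

(** A density is a convex combination of rank-one projections, and a rank-one
    projection is close to one of n^O(m) grid points. Both random quantities
    of the problem, the empirical norm and the noise, are therefore controlled
    by union bounds over finite families of matrices. Write |A|_n^2 for the empirical mean of
    <A, X_j>^2, |A|_2 for the Hilbert-Schmidt norm, which is the L_2(Pi) norm
    by isotropy, and Xi for the mean of the xi_j X_j.

    Design. For a fixed Hermitian A the square of <A, X> has an exponential
    moment, so |A|_n^2 and |A|_2^2 differ by at most |A|_2^2 / 20 except with
    probability exp(- k n) (sqr_deviation). A density is within O(1 / sqrt N)
    of an average of N rank-one projections, in a norm that dominates both
    |.|_n and |.|_2 (maurey), and these can be taken on the grid. There are
    n^O(m N) differences of two such averages, so the union bound affords
    N of order n / (m ln n), and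
      | |S1 - S2|_n - |S1 - S2|_2 | <= |S1 - S2|_2 / 20 + e
    for all densities S1 and S2, with e^2 of order m ln n / n
    (uniform_near_isometry).

    Noise. Conditionally on the design, <A, Xi> is subgaussian at scale
    sigma |A|_n / sqrt n. On the grid this gives, for all rank-one matrices,
    |<w^* w, Xi>| <= 3 u |w|^2 with u^2 of order sigma^2 (m ln n + t) / n,
    which bounds the operator norm of Xi (noise_quadratic_form_le).

    On the event where both bounds hold, the rest is deterministic
    (deterministic_oracle). The minimality of the estimator rhohat is tested
    against the mixture S' of an oracle S with a proportion 1/n of the
    maximally mixed state, which gives
      |rhohat - rho|_n^2 <= |S' - rho|_n^2 + 2 <rhohat - S', Xi>
                            + eps (tr S' log S' - tr rhohat log rhohat).
    The two last terms are, up to small errors, at most |rhohat - S|_2 times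
    sqrt (rank S) times u and eps log(mn) respectively. For the noise, the
    part of rhohat carried by the kernel of S is nonnegative and its trace
    equals the trace lost on the range of S, at most sqrt (rank S) |rhohat - S|_2
    (ip_noise_le_rank). For the entropy, Klein's inequality linearizes the
    difference at S', and log S' is a scalar matrix plus a matrix of rank at
    most rank S with eigenvalues between 0 and log(mn); the scalar part is
    orthogonal to differences of densities (entropy_increment_le). Young's
    inequality and the near-isometry finish the comparison.

    If n is below a multiple of m ln n + t, the remainder term exceeds the
    squared diameter of the set of densities. Finally, the noise level enters
    the event as sigma + 1/m, so that sigma = 0 is no exception: the extra
    1/m^2, multiplied by a rank at most m, is absorbed by the second term of
    the maximum. *)

(** * Independence and expectations of products *)

Section density.
Local Open Scope ereal_scope.
Context d d' (T : measurableType d) (U : measurableType d') (R : realType).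
Variables (mu : {measure set T -> \bar R}) (nu : {measure set U -> \bar R}).
Variables (Z : T -> U) (W : T -> R).
Hypotheses (mZ : measurable_fun setT Z) (mW : measurable_fun setT W).
Hypothesis W0 : forall x, (0 <= W x)%R.
Hypothesis WZ : forall D, measurable D -> \int[mu]_(x in Z @^-1` D) (W x)%:E = nu D.

Import HBNNSimple.

Let density_nnsfun (f : {nnsfun U >-> R}) :
  \int[mu]_x ((W x)%:E * (f (Z x))%:E) = \int[nu]_y (f y)%:E.
Proof.
under [RHS]eq_integral do rewrite fimfunE -fsumEFin//.
rewrite [RHS]ge0_integral_fsum//; last 2 first.
  - by move=> r; exact/measurable_EFinP/measurableT_comp.
  - by move=> n x _; rewrite EFinM nnfun_muleindic_ge0.
under [LHS]eq_integral.
  move=> x xD; rewrite fimfunE -fsumEFin// ge0_mule_fsumr; last first.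
    by move=> r; rewrite EFinM nnfun_muleindic_ge0.
  over.
have mWr r : measurable_fun setT (fun x => (\1_(f @^-1` [set r]) (Z x))%:E : \bar R).
  apply/measurable_EFinP; apply: measurableT_comp => //.
rewrite [LHS]ge0_integral_fsum//; last 2 first.
  - move=> r; apply: emeasurable_funM => //; first exact/measurable_EFinP.
    by under eq_fun do rewrite EFinM; exact: emeasurable_funM.
  - move=> n x _; apply: mule_ge0; first by rewrite lee_fin.
    by rewrite EFinM nnfun_muleindic_ge0.
apply: eq_fsbigr => r /[!inE]/= -[y _ fy].
have r0 : (0 <= r)%R by rewrite -fy.
under [RHS]eq_integral do rewrite EFinM.
under [LHS]eq_integral do rewrite EFinM muleCA.
rewrite !ge0_integralZl//; first last.
- exact/measurable_EFinP.
- by move=> x _; rewrite mule_ge0// lee_fin.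
- by apply: emeasurable_funM => //; exact/measurable_EFinP.
congr (_ * _); rewrite integral_indic//= setIT -WZ//.
rewrite [RHS]integral_mkcond/=; apply: eq_integral => x _.
rewrite patchE indicE; case: ifPn => [|].
  by rewrite !inE /= => h; rewrite mem_set// mule1.
by move=> /negP; rewrite inE/= => h; rewrite memNset// mule0.
Qed.

(** The transfer formula for the image under Z of the measure with
    density W: it holds for indicators by assumption, hence for simple functions, and
    passes to the limit by monotone convergence. *)
Lemma integral_density (f : U -> \bar R) :
  measurable_fun setT f -> (forall y, 0 <= f y) ->
  \int[mu]_x ((W x)%:E * f (Z x)) = \int[nu]_y f y.
Proof.
move=> mf f0; pose f_ := nnsfun_approx measurableT mf.
transitivity (limn (fun n => \int[nu]_y (f_ n y)%:E)); last first.
  rewrite -monotone_convergence//.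
  - by apply: eq_integral => y _; apply/cvg_lim => //; exact: cvg_nnsfun_approx.
  - by move=> n; exact/measurable_EFinP.
  - by move=> n y _; rewrite lee_fin.
  - by move=> y _ m n mn; rewrite lee_fin; exact/lefP/nd_nnsfun_approx.
have -> : (fun n => \int[nu]_y (f_ n y)%:E) =
    (fun n => \int[mu]_x ((W x)%:E * (f_ n (Z x))%:E)).
  by apply/funext => n; rewrite density_nnsfun.
rewrite -monotone_convergence//.
- apply: eq_integral => x _; apply/esym/cvg_lim => //.
  have fc : (f_ n (Z x))%:E @[n --> \oo] --> f (Z x) by exact: cvg_nnsfun_approx.
  exact: cvgeZl.
- by move=> n; apply: emeasurable_funM => //; apply/measurable_EFinP => //; exact/measurableT_comp.
- by move=> n x _; rewrite mule_ge0// lee_fin.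
- move=> x _ m n mn; apply: lee_wpmul2l; first by rewrite lee_fin.
  by rewrite lee_fin; exact/lefP/nd_nnsfun_approx.
Qed.
End density.

Section pi_system_independence.
Local Open Scope ereal_scope.
Context d d' (T : measurableType d) (U : measurableType d') (R : realType).
Variables (P : probability T R) (n : nat).
Variables (Z : 'I_n -> {mfun T >-> U}) (nu : 'I_n -> probability U R).
Variable G : set (set U).
Hypotheses (mG : measurable = <<s G >>) (GI : setI_closed G) (GT : G setT).
Hypothesis indG : forall C : 'I_n -> set U, (forall j, G (C j)) ->
  P (\bigcap_j (Z j @^-1` C j)) = \prod_(j < n) nu j (C j).

(** The sets C j are freed from the generating class one index at a
    time: with all other coordinates fixed, both sides are finite measures in C k that agree
    on a pi-system. *)
Lemma independent_pi_system (C : 'I_n -> set U) :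
  (forall j, measurable (C j)) ->
  P (\bigcap_j (Z j @^-1` C j)) = \prod_(j < n) nu j (C j).
Proof.
have Gm A : G A -> measurable A by rewrite mG; exact: sub_sigma_algebra.
suff H k : (k <= n)%N -> forall C : 'I_n -> set U,
    (forall j, measurable (C j)) -> (forall j : 'I_n, (k <= j)%N -> G (C j)) ->
    P (\bigcap_j (Z j @^-1` C j)) = \prod_(j < n) nu j (C j).
  by move=> mC; apply: (H n) => // j; rewrite leqNgt ltn_ord.
elim: k => [_ {}C _ GC|k IH kn {}C mC GC]; first by apply: indG => j; exact: GC.
pose K := Ordinal kn.
pose C' D j := if j == K then D else C j.
have C'K D : C' D K = D by rewrite /C' eqxx.
have C'N D j : j != K -> C' D j = C j by rewrite /C' => /negbTE ->.
pose W := \bigcap_(j in [set j | j != K]) (Z j @^-1` C j).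
have mW : measurable W.
  apply: fin_bigcap_measurable => [|j _]; first exact: finite_finset.
  exact: measurable_funPTI.
have capE D : \bigcap_j (Z j @^-1` C' D j) = (Z K @^-1` D) `&` W.
  apply/seteqP; split=> [x h|x [h1 h2] j _].
    split; first by have := h K I; rewrite /= C'K.
    by move=> j /= jK; have := h j I; rewrite /= C'N.
  have [->|jK] := eqVneq j K; first by rewrite /= C'K.
  by rewrite /= C'N//; exact: h2.
pose c := (\prod_(j < n | j != K) fine (nu j (C j)))%R.
(* The product of the other factors, kept real so that it can scale a measure. *)
have c0 : (0 <= c)%R by apply: prodr_ge0 => j _; exact: fine_ge0.
have prodE D : measurable D ->
    \prod_(j < n) nu j (C' D j) = c%:E * nu K D.
  move=> mD; rewrite (bigD1 K)//= C'K muleC; congr (_ * _).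
  rewrite /c -prodEFin; apply: eq_bigr => j jK.
  by rewrite C'N// fineK// fin_num_measure.
have CE : C = C' (C K).
  by apply/funext => j; rewrite /C'; case: eqVneq => [->|].
rewrite CE capE prodE//.
pose m1 : {measure set U -> \bar R} := pushforward (mrestr P mW) (Z K).
pose m2 : {measure set U -> \bar R} := mscale (NngNum c0) (nu K).
have G1 D : G D -> mrestr P mW (Z K @^-1` D) = c%:E * nu K D.
  move=> GD; have mD := Gm _ GD; rewrite /mrestr -capE -prodE//.
  apply: IH => [|j|j kj]; first exact: ltnW.
    by rewrite /C'; case: ifP => // _; exact: Gm.
  rewrite /C'; case: eqVneq => // jK; apply: GC.
  by rewrite ltn_neqAle kj andbT eq_sym -[k]/(val K) val_eqE.
have mZK : measurable_fun setT (Z K) by [].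
change (m1 mZK (C K) = m2 (C K)).
apply: (@measure_unique _ _ U G (fun=> setT) mG GI (fun=> GT) _ (m1 mZK) m2) => //.
- by rewrite bigcup_const//; exists 0%N.
- move=> _; rewrite /m1 /pushforward/= /mrestr -ge0_fin_numE//.
  by rewrite /pushforward preimage_setT setTI; exact: fin_num_measure.
Qed.
End pi_system_independence.

Section product_expectation.
Local Open Scope ereal_scope.
Context d d' (T : measurableType d) (U : measurableType d') (R : realType).
Variables (P : probability T R) (n : nat).
Variables (Z : 'I_n -> {mfun T >-> U}) (nu : 'I_n -> probability U R).
Hypothesis indep : forall C : 'I_n -> set U, (forall j, measurable (C j)) ->
  P (\bigcap_j (Z j @^-1` C j)) = \prod_(j < n) nu j (C j).

(** Induction on the number k of indices where phi is a general function,
    the others being indicators. In the step, the identity for indicators at index k says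
    that the law of Z k under the measure with density the product of the other factors is
    a multiple of nu k, and integral_density concludes. *)
Lemma expectation_prod (phi : 'I_n -> U -> R) :
  (forall j, measurable_fun setT (phi j)) -> (forall j u, (0 <= phi j u)%R) ->
  (forall j, \int[nu j]_u (phi j u)%:E < +oo) ->
  \int[P]_w (\prod_(j < n) phi j (Z j w))%:E =
  \prod_(j < n) \int[nu j]_u (phi j u)%:E.
Proof.
suff H k : (k <= n)%N -> forall phi : 'I_n -> U -> R,
    (forall j, measurable_fun setT (phi j)) -> (forall j u, (0 <= phi j u)%R) ->
    (forall j, \int[nu j]_u (phi j u)%:E < +oo) ->
    (forall j : 'I_n, (k <= j)%N ->
       exists2 D, measurable D & phi j = (\1_D : U -> R)) ->
    \int[P]_w (\prod_(j < n) phi j (Z j w))%:E =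
    \prod_(j < n) \int[nu j]_u (phi j u)%:E.
  by move=> mphi phi0 phioo; apply: (H n) => // j; rewrite leqNgt ltn_ord.
elim: k => [_ {}phi _ _ _ phi1|k IH kn {}phi mphi phi0 phioo phi1].
  pose C j := projT1 (cid2 (phi1 j isT)).
  have [mC phiE] : (forall j, measurable (C j)) /\
      (forall j, phi j = (\1_(C j) : U -> R)).
    by split=> j; rewrite /C; case: cid2.
  transitivity (P (\bigcap_j (Z j @^-1` C j))); last first.
    rewrite indep//; apply: eq_bigr => j _.
    by rewrite phiE integral_indic// setIT.
  rewrite -[in RHS](setIT (\bigcap_j _)) -integral_indic//; last first.
    by apply: fin_bigcap_measurable => // j _; exact: measurable_funPTI.
  apply: eq_integral => w _; congr EFin; rewrite indicE.
  have [wC|wC] := pselect ((\bigcap_j (Z j @^-1` C j)) w).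
    rewrite mem_set// big1// => j _; rewrite phiE indicE mem_set//.
    exact: (wC j I).
  rewrite memNset//; move/existsNP : wC => [j /not_implyP[_ wj]].
  by rewrite (bigD1 j)//= phiE indicE memNset// mul0r.
pose K := Ordinal kn.
pose psi (f : U -> R) j := if j == K then f else phi j.
have psiK f : psi f K = f by rewrite /psi eqxx.
have psiN f j : j != K -> psi f j = phi j by rewrite /psi => /negbTE ->.
pose W w := (\prod_(j < n | j != K) phi j (Z j w))%R.
pose c := (\prod_(j < n | j != K) fine (\int[nu j]_u (phi j u)%:E))%R.
have int0 j : 0 <= \int[nu j]_u (phi j u)%:E.
  by apply: integral_ge0 => u _; rewrite lee_fin.
have c0 : (0 <= c)%R by apply: prodr_ge0 => j _; exact: fine_ge0.
have W0 w : (0 <= W w)%R by apply: prodr_ge0.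
have prodE f : \prod_(j < n) \int[nu j]_u (psi f j u)%:E =
    c%:E * \int[nu K]_u (f u)%:E.
  rewrite (bigD1 K)//= psiK muleC; congr (_ * _).
  rewrite /c -prodEFin; apply: eq_bigr => j jK.
  by rewrite psiN// fineK// ge0_fin_numE.
have WE f w : (\prod_(j < n) psi f j (Z j w) = W w * f (Z K w))%R.
  rewrite (bigD1 K)//= psiK mulrC; congr (_ * _)%R.
  by apply: eq_bigr => j jK; rewrite psiN.
have phiE : phi = psi (phi K).
  by apply/funext => j; rewrite /psi; case: eqVneq => [->|].
have mW : measurable_fun setT W.
  rewrite /W; under eq_fun do rewrite big_mkcond/=.
  apply: measurable_prod => j _; case: (j != K) => //.
  exact: measurableT_comp.
rewrite [in RHS]phiE prodE [in LHS]phiE.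
have -> : \int[P]_w (\prod_(j < n) psi (phi K) j (Z j w))%:E =
    \int[P]_w ((W w)%:E * (EFin \o phi K) (Z K w)).
  by apply: eq_integral => w _; rewrite WE EFinM.
rewrite (@integral_density _ _ _ _ _ P (mscale (NngNum c0) (nu K)) (Z K) W _ mW W0 _ (EFin \o phi K))//.
- rewrite ge0_integral_mscale//=; first exact/measurable_EFinP.
  by move=> u _; rewrite lee_fin.
- move=> D mD; rewrite /mscale/=.
  have := prodE (\1_D : U -> R); rewrite integral_indic// setIT => cD.
  change (\int[P]_(x in Z K @^-1` D) (W x)%:E = c%:E * nu K D); rewrite -{}cD.
  rewrite -IH; first last.
  - move=> j kj; rewrite /psi; case: eqVneq => [_|jK]; first by exists D.
    by apply: phi1; rewrite ltn_neqAle kj andbT eq_sym -[k]/(val K) val_eqE.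
  - move=> j; rewrite /psi; case: eqVneq => [->|//].
    rewrite integral_indic// setIT -ge0_fin_numE//; exact: fin_num_measure.
  - by move=> j u; rewrite /psi; case: eqVneq.
  - by move=> j; rewrite /psi; case: eqVneq.
  - exact: ltnW.
  rewrite integral_mkcond/=; apply: eq_integral => w _.
  rewrite WE patchE indicE; case: ifPn => [|].
    by rewrite !inE/= => ZD; rewrite mem_set// mulr1.
  by move=> /negP; rewrite inE/= => ZD; rewrite memNset// mulr0.
- exact/measurable_EFinP.
- by move=> y; rewrite lee_fin.
Qed.
End product_expectation.

(** * Exponential moments of squares of subgaussian variables *)

Section exp_bounds.
Context {R : realType}.
Implicit Types x y z : R.

(** The square of exp(z/2) >= 1 + z/2. *)
Lemma expR_ge1DxDsqr z : 0 <= z -> 1 + z + z ^+ 2 / 4 <= expR z.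
Proof.
move=> z0; have -> : z = z / 2 + z / 2 by lra.
rewrite expRD; have := expR_ge1Dx (z / 2).
set e := expR _ => h; apply: (@le_trans _ _ ((1 + z / 2) * (1 + z / 2))); first lra.
by apply: ler_pM => //; lra.
Qed.

Lemma expR_le1DxDsqr z : 0 <= z -> expR z <= 1 + z + z ^+ 2 * expR z.
Proof.
move=> z0; have h := expR_ge1Dx (- z); rewrite expRN in h.
have e0 := expR_gt0 z.
have h' : (1 - z) * expR z <= 1.
  by rewrite -ler_pdivlMr// mul1r.
by nra.
Qed.

Lemma expRN_le1BxDsqr z : 0 <= z -> expR (- z) <= 1 - z + z ^+ 2.
Proof.
move=> z0; rewrite expRN -[leLHS]mul1r ler_pdivrMr ?expR_gt0//.
have h := expR_ge1DxDsqr z0.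
apply: (@le_trans _ _ ((1 - z + z ^+ 2) * (1 + z + z ^+ 2 / 4))); last first.
  by rewrite ler_pM2l//; nra.
by nra.
Qed.

Lemma sqr_le_expR th y : 0 < th -> 0 <= y ->
  y ^+ 2 <= 16 / th ^+ 2 * expR (th * y / 2).
Proof.
move=> th0 y0; rewrite mulrAC ler_pdivlMr ?exprn_gt0//.
have u0 : 0 <= th * y / 2 by rewrite divr_ge0// mulr_ge0// ltW.
by have := expR_ge1DxDsqr u0; nra.
Qed.

(** A second-order expansion in la with the random factor y^2 traded for
    the exponential whose expectation is controlled. *)
Lemma expR_le_taylor2 th la y : 0 < th -> 0 <= la -> la <= th / 2 -> 0 <= y ->
  expR (la * y) <= 1 + la * y + la ^+ 2 * (16 / th ^+ 2) * expR (th * y).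
Proof.
move=> th0 la0 lath y0; have z0 : 0 <= la * y by rewrite mulr_ge0.
apply: (le_trans (expR_le1DxDsqr z0)); rewrite lerD2l exprMn.
rewrite -[leLHS]mulrA -[leRHS]mulrA ler_wpM2l ?exprn_ge0//.
have -> : expR (th * y) = expR (th * y / 2) * expR (th * y / 2).
  by rewrite -expRD; congr expR; lra.
rewrite mulrA; apply: ler_pM; rewrite ?sqr_ge0 ?expR_ge0//.
  exact: sqr_le_expR.
by rewrite ler_expR; have := ler_wpM2r y0 lath; lra.
Qed.

Lemma expRN_le_taylor2 th la y : 0 < th -> 0 <= la -> 0 <= y ->
  expR (- (la * y)) + la * y <= 1 + la ^+ 2 * (16 / th ^+ 2) * expR (th * y).
Proof.
move=> th0 la0 y0; have z0 : 0 <= la * y by rewrite mulr_ge0.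
have := expRN_le1BxDsqr z0.
suff : (la * y) ^+ 2 <= la ^+ 2 * (16 / th ^+ 2) * expR (th * y) by lra.
rewrite exprMn -[leRHS]mulrA ler_wpM2l ?exprn_ge0//.
apply: (le_trans (sqr_le_expR th0 y0)).
apply: ler_wpM2l; first by rewrite divr_ge0// exprn_ge0// ltW.
by rewrite ler_expR; have := mulr_ge0 (ltW th0) y0; lra.
Qed.

(** A discrete substitute for Gaussian linearization: exp(y^2/8) is bounded
    by one summand of a series of exponentials of linear functions of y, so its expectation
    only involves the moment generating function. With k the integer part of y,
    y^2/8 <= 2 - k - k^2/2 + k y, and exp(-k) <= 2^-k makes the series summable. *)
Lemma expR_sqr_le_expR_truncn y : 0 <= y ->
  expR (y ^+ 2 / 8) <= expR 2 * (2^-1 ^+ Num.truncn y *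
     (expR (- ((Num.truncn y)%:R ^+ 2 / 2)) * expR ((Num.truncn y)%:R * y))).
Proof.
move=> y0; set k := Num.truncn y.
have /andP[ky yk] : (k%:R <= y < k.+1%:R) by exact: truncn_itv.
have e2 : expR (- (k%:R : R)) <= 2^-1 ^+ k.
  have -> : - (k%:R : R) = k%:R * - 1 by rewrite mulrN1.
  rewrite expRM_natl lerXn2r ?nnegrE ?expR_ge0 ?invr_ge0//.
  by rewrite expRN lef_pV2 ?posrE ?expR_gt0//; have := @expR_ge1Dx R 1; lra.
apply: (@le_trans _ _ (expR 2 * (expR (- (k%:R : R)) *
     (expR (- (k%:R ^+ 2 / 2)) * expR (k%:R * y))))); last first.
  rewrite ler_pM2l ?expR_gt0// ler_pM2r// mulr_gt0// expR_gt0//.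
rewrite -!expRD ler_expR.
rewrite -natr1 in yk; have k0 : 0 <= k%:R :> R by [].
move: (k%:R : R) k0 ky yk => j j0 jy yj.
have [u u0 [u1 ->]] : exists2 u, 0 <= u & u < 1 /\ y = j + u.
  by exists (y - j); rewrite ?subr_ge0//; split; [lra|ring].
(* As j u >= 0, the difference is at least 2 - j + 3 j^2 / 8 - u^2 / 8, which is least at j = 4/3. *)
by have := sqr_ge0 (j - 4 / 3); nra.
Qed.
End exp_bounds.

Section subgaussian_square.
Local Open Scope ereal_scope.
Context d (T : measurableType d) (R : realType) (P : probability T R).

Lemma sum_half n : (\sum_(0 <= k < n) 2^-1 ^+ k <= 2 :> R)%R.
Proof.
suff -> : (\sum_(0 <= k < n) 2^-1 ^+ k = 2 - 2 * 2^-1 ^+ n :> R)%R.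
  by rewrite gerBl mulr_ge0// exprn_ge0// invr_ge0.
elim: n => [|n IH]; first by rewrite big_nil expr0 mulr1 subrr.
by rewrite big_nat_recr//= IH exprS; lra.
Qed.

(** The square of a subgaussian variable has an exponential moment. The
    bound of expR_sqr_le_expR_truncn is summed over all k and both signs of f; the
    moment generating function at k/b cancels the factor exp(-k^2/2). *)
Lemma subgaussian_exp_sqr (f : T -> R) (b : R) : (0 < b)%R ->
  measurable_fun setT f ->
  (forall la, \int[P]_x (expR (la * f x))%:E <= (expR (la ^+ 2 * b ^+ 2 / 2))%:E) ->
  \int[P]_x (expR ((f x / b) ^+ 2 / 8))%:E <= (4 * expR 2)%:E.
Proof.
move=> b0 mf sgf.
pose a k : R := (expR 2 * (2^-1 ^+ k * expR (- (k%:R ^+ 2 / 2))))%R.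
have a0 k : (0 <= a k)%R.
  by rewrite !mulr_ge0 ?expR_ge0// exprn_ge0// invr_ge0.
pose F k x := (a k * expR (k%:R / b * f x) + a k * expR (- (k%:R / b) * f x))%:E.
have F0 k x : 0 <= F k x by rewrite lee_fin addr_ge0// mulr_ge0 ?expR_ge0.
have me (c : R) : measurable_fun setT (fun x => expR (c * f x)).
  by apply: measurableT_comp => //; exact: measurable_funM.
have mF k : measurable_fun setT (F k).
  by apply/measurable_EFinP; apply: measurable_funD; apply: measurable_funM.
apply: (@le_trans _ _ (\int[P]_x \sum_(k <oo) F k x)).
  apply: ge0_le_integral => //.
  - apply/measurable_EFinP; apply: measurableT_comp => //.
    apply: measurable_funM => //; apply: measurable_funX.
    exact: measurable_funM.
  - by apply: ge0_emeasurable_sum.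
  - move=> x _; set y := (`|f x / b|)%R; pose k := Num.truncn y.
    have y0 : (0 <= y)%R by exact: normr_ge0.
    apply: (@le_trans _ _ (F k x)); last first.
      apply: le_trans (nneseries_lim_ge k.+1 _) => //.
      rewrite big_nat_recr//= leeDr//.
      by apply: sume_ge0.
    rewrite lee_fin -real_normK ?num_real// -/y.
    apply: (le_trans (expR_sqr_le_expR_truncn y0)); rewrite -/k mulrA mulrA -[(expR 2 * _ * _)%R]mulrA -/(a k) -mulrDr.
    rewrite ler_wpM2l// /y.
    case: (leP 0%R (f x / b)%R) => [h|h].
      by rewrite ger0_norm// mulrCA -mulrA mulrC -mulrA [(_ * f x)%R]mulrC mulrA lerDl expR_ge0.
    rewrite ltr0_norm// addrC.
    have -> : (k%:R * - (f x / b) = - (k%:R / b) * f x)%R by field; rewrite gt_eqF.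
    by rewrite lerDl expR_ge0.
rewrite integral_nneseries//.
have hF k : \int[P]_x F k x <= (2 * expR 2 * 2^-1 ^+ k)%:E.
  rewrite /F; under eq_integral do rewrite EFinD.
  rewrite ge0_integralD//=; first last.
  - exact/measurable_EFinP/measurable_funM.
  - by move=> x _; rewrite lee_fin mulr_ge0 ?expR_ge0.
  - exact/measurable_EFinP/measurable_funM.
  - by move=> x _; rewrite lee_fin mulr_ge0 ?expR_ge0.
  have hc c : (c ^+ 2 = k%:R ^+ 2 / b ^+ 2)%R ->
      \int[P]_x (a k * expR (c * f x))%:E <= (expR 2 * 2^-1 ^+ k)%:E.
    move=> c2; under eq_integral do rewrite EFinM.
    rewrite ge0_integralZl_EFin//; last exact/measurable_EFinP.
    apply: (@le_trans _ _ ((a k)%:E * (expR (k%:R ^+ 2 / 2))%:E)).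
      rewrite lee_wpmul2l ?lee_fin//; apply: le_trans (sgf _) _.
      rewrite c2 lee_fin ler_expR divfK//.
      by rewrite expf_neq0// gt_eqF.
    rewrite -EFinM lee_fin /a -!mulrA -expRD addNr expR0 mulr1//.
  have -> : (2 * expR 2 * 2^-1 ^+ k = expR 2 * 2^-1 ^+ k + expR 2 * 2^-1 ^+ k :> R)%R by ring.
  rewrite EFinD leeD// hc ?sqrrN// exprMn exprVn//.
apply: lime_le; first by apply: is_cvg_nneseries => k _ _; exact: integral_ge0.
apply: nearW => n.
apply: (@le_trans _ _ (\sum_(0 <= k < n) (2 * expR 2 * 2^-1 ^+ k)%:E)).
  exact: lee_sum.
rewrite sumEFin lee_fin -mulr_sumr.
have := sum_half n; have := expR_gt0 (2 : R); nra.
Qed.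
End subgaussian_square.

Section square_mgf.
Local Open Scope ereal_scope.
Context d (T : measurableType d) (R : realType) (P : probability T R).
Variables (g : T -> R) (th K : R).
Hypotheses (mg : measurable_fun setT g) (th0 : (0 < th)%R).
Hypothesis g2 : \int[P]_x (g x ^+ 2)%:E = 1.
Hypothesis ge : \int[P]_x (expR (th * g x ^+ 2))%:E <= K%:E.
Let B : R := (16 / th ^+ 2 * K)%R.

Let mg2 : measurable_fun setT (fun x => g x ^+ 2)%R.
Proof. exact: measurable_funX. Qed.

Let me (c : R) : measurable_fun setT (fun x => (expR (c * g x ^+ 2))%:E).
Proof.
by apply/measurable_EFinP; apply: measurableT_comp => //; exact: measurable_funM.
Qed.

Let remainder (la : R) : (0 <= la)%R ->
  \int[P]_x (la ^+ 2 * (16 / th ^+ 2) * expR (th * g x ^+ 2))%:E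
    <= (B * la ^+ 2)%:E.
Proof.
move=> la0; have c0 : (0 <= la ^+ 2 * (16 / th ^+ 2))%R.
  by rewrite mulr_ge0 ?sqr_ge0// divr_ge0// sqr_ge0.
under eq_integral do rewrite EFinM.
rewrite ge0_integralZl_EFin//.
apply: (@le_trans _ _ ((la ^+ 2 * (16 / th ^+ 2))%:E * K%:E)).
  by rewrite lee_wpmul2l// lee_fin.
by rewrite -EFinM lee_fin /B; lra.
Qed.

Let mcst_sqr (la : R) : measurable_fun setT (fun x => (la * g x ^+ 2)%:E).
Proof. by apply/measurable_EFinP; exact: measurable_funM. Qed.

Let int_sqr (la : R) : (0 <= la)%R -> \int[P]_x (la * g x ^+ 2)%:E = la%:E.
Proof.
move=> la0; under eq_integral do rewrite EFinM.
rewrite ge0_integralZl_EFin//; first by rewrite g2 mule1.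
  by move=> x _; rewrite lee_fin sqr_ge0.
exact/measurable_EFinP.
Qed.

Let int1 : \int[P]_x 1 = 1.
Proof. by rewrite integral_cst// mul1e; exact: probability_setT. Qed.

(** A Bernstein estimate: the quadratic term of the exponent is controlled by
    the exponential moment K of the square. *)
Lemma mgf_sqr_le (la : R) : (0 <= la)%R -> (la <= th / 2)%R ->
  \int[P]_x (expR (la * g x ^+ 2))%:E <= (expR (la + B * la ^+ 2))%:E.
Proof.
move=> la0 lath.
have m2 : measurable_fun setT
    (fun x => (la ^+ 2 * (16 / th ^+ 2) * expR (th * g x ^+ 2))%:E).
  by apply/measurable_EFinP; apply: measurable_funM => //; exact/measurable_EFinP/me.
apply: (@le_trans _ _ (\int[P]_x (1 + ((la * g x ^+ 2)%:E +
    (la ^+ 2 * (16 / th ^+ 2) * expR (th * g x ^+ 2))%:E)))).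
  apply: ge0_le_integral => //.
  - by apply: emeasurable_funD => //; exact: emeasurable_funD.
  - move=> x _; rewrite lee_fin addrA.
    by have := expR_le_taylor2 th0 la0 lath (sqr_ge0 (g x)).
have p1 x : 0 <= (la * g x ^+ 2)%:E by rewrite lee_fin mulr_ge0// sqr_ge0.
have p2 x : 0 <= (la ^+ 2 * (16 / th ^+ 2) * expR (th * g x ^+ 2))%:E.
  by rewrite lee_fin mulr_ge0 ?expR_ge0// mulr_ge0 ?sqr_ge0// divr_ge0// sqr_ge0.
rewrite ge0_integralD//; last 2 first.
- by move=> x _; rewrite adde_ge0.
- exact: emeasurable_funD.
rewrite ge0_integralD// int1 int_sqr//.
apply: le_trans (leeD (lexx _) (leeD (lexx _) (remainder la0))) _.
by rewrite -!EFinD lee_fin expR_ge1Dx.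
Qed.

Lemma mgfN_sqr_le (la : R) : (0 <= la)%R ->
  \int[P]_x (expR (- (la * g x ^+ 2)))%:E <= (expR (- la + B * la ^+ 2))%:E.
Proof.
move=> la0.
have p1 x : 0 <= (la * g x ^+ 2)%:E by rewrite lee_fin mulr_ge0// sqr_ge0.
have p2 x : 0 <= (la ^+ 2 * (16 / th ^+ 2) * expR (th * g x ^+ 2))%:E.
  by rewrite lee_fin mulr_ge0 ?expR_ge0// mulr_ge0 ?sqr_ge0// divr_ge0// sqr_ge0.
have m2 : measurable_fun setT
    (fun x => (la ^+ 2 * (16 / th ^+ 2) * expR (th * g x ^+ 2))%:E).
  by apply/measurable_EFinP; apply: measurable_funM => //; exact/measurable_EFinP/me.
have mN : measurable_fun setT (fun x => (expR (- (la * g x ^+ 2)))%:E).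
  by under eq_fun do rewrite -mulNr; exact: me.
have : \int[P]_x ((expR (- (la * g x ^+ 2)))%:E + (la * g x ^+ 2)%:E) <=
    \int[P]_x (1 + (la ^+ 2 * (16 / th ^+ 2) * expR (th * g x ^+ 2))%:E).
  apply: ge0_le_integral => //.
  - by move=> x _; rewrite adde_ge0// lee_fin expR_ge0.
  - exact: emeasurable_funD.
  - exact: emeasurable_funD.
  - by move=> x _; rewrite lee_fin expRN_le_taylor2// sqr_ge0.
rewrite !ge0_integralD// int1 int_sqr//.
rewrite -leeBrDr// => h; apply: (le_trans h).
apply: (@le_trans _ _ (1 + (B * la ^+ 2)%:E - la%:E)).
  by rewrite leeB// leeD2l// remainder.
rewrite lee_fin.
by have := expR_ge1Dx (- la + B * la ^+ 2); lra.
Qed.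
End square_mgf.

Section chernoff_union.
Local Open Scope ereal_scope.
Context d d' (T : measurableType d) (U : measurableType d') (R : realType).
Variables (P : probability T R) (n : nat).
Variables (Z : 'I_n -> {mfun T >-> U}) (nu : 'I_n -> probability U R).
Hypothesis indep : forall C : 'I_n -> set U, (forall j, measurable (C j)) ->
  P (\bigcap_j (Z j @^-1` C j)) = \prod_(j < n) nu j (C j).

Lemma measurable_sum_rv (phi : U -> R) : measurable_fun setT phi ->
  measurable_fun setT (fun w => \sum_(j < n) phi (Z j w))%R.
Proof.
by move=> mphi; apply: measurable_sum => j; exact: measurableT_comp.
Qed.

(** Markov's inequality for the exponential of the sum, whose expectation
    factorizes. *)
Lemma chernoff_sum (phi : U -> R) (ka : R) : measurable_fun setT phi ->
  (forall j, \int[nu j]_u (expR (phi u))%:E <= (expR (- ka))%:E) ->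
  P [set w | 0 <= \sum_(j < n) phi (Z j w)]%R <= (expR (- (n%:R * ka)))%:E.
Proof.
move=> mphi hphi.
have mS := measurable_sum_rv mphi.
set A := [set w | _].
have mA : measurable A.
  have -> : A = (fun w => \sum_(j < n) phi (Z j w))%R @^-1` `[0%R, +oo[%classic.
    by apply/seteqP; split => w /=; rewrite in_itv/= andbT.
  by rewrite -[X in measurable X]setTI; exact: mS.
have mprod : measurable_fun setT (fun w => (\prod_(j < n) expR (phi (Z j w)))%:E).
  apply/measurable_EFinP; under eq_fun do rewrite -expR_sum.
  exact: measurableT_comp.
apply: (@le_trans _ _ (\int[P]_w (\prod_(j < n) expR (phi (Z j w)))%:E)).
  rewrite -[A in P A]setIT -integral_indic//.
  apply: ge0_le_integral => //.
  - by apply/measurable_EFinP; exact: measurable_indic.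
  - move=> w _; rewrite lee_fin indicE -expR_sum.
    case: (boolP (w \in A)) => [|_]; last exact: expR_ge0.
    rewrite inE /A/= => h; apply: le_trans (expR_ge1Dx _).
    by rewrite lerDl.
rewrite (expectation_prod indep (phi := fun=> expR \o phi)).
- pose r j := fine (\int[nu j]_u (expR (phi u))%:E).
  have int0 j : 0 <= \int[nu j]_u (expR (phi u))%:E.
    by apply: integral_ge0 => u _; rewrite lee_fin expR_ge0.
  have rE j : \int[nu j]_u (expR (phi u))%:E = (r j)%:E.
    by rewrite fineK// ge0_fin_numE// (le_lt_trans (hphi j))// ltry.
  rewrite (eq_bigr (fun j => (r j)%:E)) => [|j _]; last exact: rE.
  rewrite prodEFin lee_fin.
  apply: (@le_trans _ _ (\prod_(j < n) expR (- ka))%R).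
    by apply: ler_prod => j _; rewrite -2!lee_fin -rE int0 hphi.
  by rewrite prodr_const card_ord -expRM_natl mulrN.
- by move=> j; exact: measurableT_comp.
- by move=> j u; exact: expR_ge0.
- by move=> j; rewrite (le_lt_trans (hphi j))// ltry.
Qed.

Lemma union_bound (I : finType) (bad : I -> set T) (p : R) :
  (forall i, measurable (bad i)) -> (forall i, P (bad i) <= p%:E) ->
  measurable (\bigcap_i ~` bad i) /\
  (1 - #|I|%:R * p)%:E <= P (\bigcap_i ~` bad i).
Proof.
move=> mbad hbad; have mcap : measurable (\bigcap_i ~` bad i).
  apply: fin_bigcap_measurable => [|i _]; first exact: finite_finset.
  exact: measurableC.
split=> //; rewrite -setC_bigcup probability_setC//; last first.
  by rewrite -(setCK (\bigcup_i _)) setC_bigcup; exact: measurableC.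
rewrite EFinB leeB//.
have -> : \bigcup_i bad i = \big[setU/set0]_(i <- enum I) bad i.
  rewrite -bigcup_seq; apply/seteqP; split=> w [i _ bi]; exists i => //=.
  by rewrite mem_enum.
rewrite cardE; elim: (enum I) => [|i s IH].
  by rewrite big_nil measure0 mul0r.
rewrite big_cons /= -natr1 mulrDl mul1r addrC EFinD.
apply: le_trans (measureU2 _ _ _) (leeD (hbad i) IH) => //.
exact: bigsetU_measurable.
Qed.
End chernoff_union.

(** * The real Hilbert-Schmidt inner product *)

Section real_inner_product.
Context {R : realType} {m : nat}.
Implicit Types A B C : 'M[R[i]]_m.
Implicit Types z w : R[i].

Lemma Re_mulC z w : complex.Re (z * Num.conj w) =
  complex.Re z * complex.Re w + complex.Im z * complex.Im w.
Proof. by case: z => a b; case: w => c d /=; ring. Qed.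

Lemma Re_sum I (r : seq I) (Q : pred I) (F : I -> R[i]) :
  complex.Re (\sum_(i <- r | Q i) F i) = \sum_(i <- r | Q i) complex.Re (F i).
Proof. by apply: (big_morph (@complex.Re R)) => // -[a b] [c e]. Qed.

(** The Hilbert-Schmidt product as a real bilinear form on complex matrices; on
    Hermitian matrices it is the complex one. *)
Definition ip A B : R := complex.Re (mxinner A B).

Lemma ipE A B : ip A B = \sum_i \sum_j
  (complex.Re (A i j) * complex.Re (B i j) +
   complex.Im (A i j) * complex.Im (B i j)).
Proof.
rewrite /ip /mxinner /mxtrace Re_sum; apply: eq_bigr => i _.
by rewrite mxE Re_sum; apply: eq_bigr => j _; rewrite !mxE Re_mulC.
Qed.

Lemma ipC A B : ip A B = ip B A.
Proof.
rewrite !ipE; apply: eq_bigr => i _; apply: eq_bigr => j _.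
by rewrite mulrC [X in _ + X]mulrC.
Qed.

Lemma ipDl A B C : ip (A + B) C = ip A C + ip B C.
Proof.
rewrite /ip /mxinner mulmxDl linearD /=.
by case: (\tr _) => a b; case: (\tr _).
Qed.

Lemma ipZl (r : R) A C : ip (r%:C%C *: A) C = r * ip A C.
Proof.
rewrite /ip /mxinner -scalemxAl mxtraceZ.
by case: (\tr _) => a b /=; rewrite mul0r subr0.
Qed.

Lemma ipNl A C : ip (- A) C = - ip A C.
Proof. by rewrite -scaleN1r -[-1](rmorphN1 (real_complex R)) ipZl mulN1r. Qed.

Lemma ipDr A B C : ip A (B + C) = ip A B + ip A C.
Proof. by rewrite ipC ipDl !(ipC _ A). Qed.
Lemma ipNr A C : ip A (- C) = - ip A C.
Proof. by rewrite ipC ipNl ipC. Qed.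
Lemma ipBl A B C : ip (A - B) C = ip A C - ip B C.
Proof. by rewrite ipDl ipNl. Qed.
Lemma ipBr A B C : ip A (B - C) = ip A B - ip A C.
Proof. by rewrite ipDr ipNr. Qed.
Lemma ipZr (r : R) A C : ip A (r%:C%C *: C) = r * ip A C.
Proof. by rewrite ipC ipZl ipC. Qed.
Lemma ip0l A : ip 0 A = 0.
Proof. by have := ipBl 0 0 A; rewrite !subrr. Qed.

Lemma ip_ge0 A : 0 <= ip A A.
Proof.
rewrite ipE; apply: sumr_ge0 => i _; apply: sumr_ge0 => j _.
by rewrite -!expr2 addr_ge0 ?sqr_ge0.
Qed.

Lemma ip_suml I (r : seq I) (Q : pred I) (F : I -> 'M[R[i]]_m) C :
  ip (\sum_(i <- r | Q i) F i) C = \sum_(i <- r | Q i) ip (F i) C.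
Proof.
apply: (big_morph (fun A => ip A C)) => [A B|]; [exact: ipDl|exact: ip0l].
Qed.

Lemma hsnormE A : hsnorm A = Num.sqrt (ip A A). Proof. by []. Qed.

Lemma hsnorm_sqr A : hsnorm A ^+ 2 = ip A A.
Proof. by rewrite hsnormE sqr_sqrtr// ip_ge0. Qed.

Lemma hsnorm_ge0 A : 0 <= hsnorm A. Proof. exact: sqrtr_ge0. Qed.

End real_inner_product.

(** * Isotropic subgaussian design *)

Lemma hermsymmxP (R : realType) (m : nat) (A : 'M[R[i]]_m) :
  reflect (A = A^t*) (A \is hermsymmx).
Proof.
apply: (iffP (is_hermitianmxP _ _ _)); by rewrite expr0 scale1r.
Qed.

Section design.
Context {R : realType} {m : nat}.
Implicit Types A B : 'M[R[i]]_m.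

(** Traces of products of two Hermitian matrices are real, so the modulus is
    that of the real part. *)
Lemma ip_normc A B : A \is hermsymmx -> B \is hermsymmx ->
  Normc.normc (mxinner A B) ^+ 2 = ip A B ^+ 2.
Proof.
move=> /hermsymmxP hA /hermsymmxP hB.
have hAB : (A *m B)^t* = B *m A by rewrite trmx_mul map_mxM -hA -hB.
have hz : Num.conj (mxinner A B) = mxinner A B.
  rewrite /mxinner -hB -[RHS]mxtrace_mulC -hAB -[LHS]trace_map_mx.
  by rewrite -mxtrace_tr map_trmx.
rewrite /ip; move: (mxinner A B) hz => [a b] /= [] hb.
have -> : b = 0 by lra.
by rewrite expr0n addr0 sqr_sqrtr// sqr_ge0.
Qed.

(** Reduces the measurability of the modulus to that of the real linear functionals
    ip, as multiplication by - i turns imaginary parts into real ones. *)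
Lemma normc_ip A B :
  Normc.normc (mxinner A B) ^+ 2 = ip A B ^+ 2 + ip (- 'i *: A) B ^+ 2.
Proof.
rewrite /ip; have -> : mxinner (- 'i *: A) B = - 'i * mxinner A B.
  by rewrite /mxinner -scalemxAl mxtraceZ.
case: (mxinner A B) => a b /=.
rewrite sqr_sqrtr ?addr_ge0 ?sqr_ge0//.
by congr (_ + _ ^+ 2); ring.
Qed.

Lemma measurable_ip A : measurable_fun [set: borelmx R m] (fun x => ip A x).
Proof.
under eq_fun do rewrite ipE.
apply: measurable_sum => i; apply: measurable_sum => j.
apply: measurable_funD; apply: measurable_funM => //.
- move=> _ U mU; rewrite setTI; apply: sub_sigma_algebra.
  by exists i, j, U; split=> //; left.
- move=> _ U mU; rewrite setTI; apply: sub_sigma_algebra.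
  by exists i, j, U; split=> //; right.
Qed.

Context (b0 : R) (Pi : probability (borelmx R m) R).
Hypothesis herm_ae : {ae Pi, forall x : borelmx R m, (x : 'M[R[i]]_m) \is hermsymmx}.
Hypothesis iso : isotropic_subgaussian b0 Pi.

Lemma ip_second_moment A : A \is hermsymmx ->
  (\int[Pi]_x (ip A x ^+ 2)%:E = (hsnorm A ^+ 2)%:E)%E.
Proof.
move=> hA; rewrite -(iso.2 A) /L2sq unlock.
apply: ae_eq_integral => //.
- by apply/measurable_EFinP/measurable_funX; exact: measurable_ip.
- apply/measurable_EFinP; under eq_fun do rewrite normc_ip.
  by apply: measurable_funD; apply: measurable_funX; exact: measurable_ip.
- by apply: filterS herm_ae => x hx _; rewrite ip_normc.
Qed.

Lemma ip_subgaussian A : A \is hermsymmx -> 0 < hsnorm A -> forall la : R,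
  (\int[Pi]_x (expR (la * (ip A x / hsnorm A)))%:E <=
   (expR (la ^+ 2 * b0 ^+ 2 / 2))%:E)%E.
Proof.
move=> hA A0 la; have := iso.1 A hA (la / hsnorm A).
rewrite unlock /L2norm iso.2/= sqrtr_sqr ger0_norm ?hsnorm_ge0//.
have -> : (la / hsnorm A) ^+ 2 * (b0 * hsnorm A) ^+ 2 / 2 = la ^+ 2 * b0 ^+ 2 / 2.
  by field; rewrite gt_eqF.
by under eq_integral do rewrite -mulrA [_^-1 * _]mulrC.
Qed.

End design.

(** * Gaussian noise and independent pairs *)

Section gaussian_noise.
Local Open Scope ereal_scope.
Context {R : realType}.

(** Completing the square turns the tilted Gaussian density into the density
    with mean la sigma^2. *)
Lemma normal_mgf (sigma la : R) : sigma != 0%R ->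
  \int[lebesgue_measure]_z ((normal_pdf 0 sigma z)%:E * (expR (la * z))%:E) =
  (expR (la ^+ 2 * sigma ^+ 2 / 2))%:E.
Proof.
move=> s0.
transitivity (\int[lebesgue_measure]_z
   ((expR (la ^+ 2 * sigma ^+ 2 / 2))%:E * (normal_pdf (la * sigma ^+ 2) sigma z)%:E)).
  apply: eq_integral => z _; rewrite -!EFinM; congr EFin.
  rewrite !normal_pdfE// -[LHS]mulrA [RHS]mulrCA; congr (_ * _)%R.
  rewrite /normal_fun -!expRD; congr expR.
  by rewrite -mulr_natr; field.
rewrite ge0_integralZl_EFin//.
- by rewrite integral_normal_pdf mule1.
- by move=> z _; rewrite lee_fin normal_pdf_ge0.
- by apply/measurable_EFinP; exact: measurable_normal_pdf.
Qed.

(** Stated with any s above sigma, as the deviation bounds below need a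
    positive scale even for a degenerate noise. *)
Lemma noise_subgaussian d (T : measurableType d) (P : probability T R)
    (xi : {RV P >-> R}) (sigma s la : R) : (0 <= sigma)%R -> (sigma <= s)%R ->
  has_law xi (centered_normal sigma) ->
  \int[distribution P xi]_z (expR (la * z))%:E <=
  (expR (la ^+ 2 * s ^+ 2 / 2))%:E.
Proof.
move=> s0 ss hlaw.
apply: (@le_trans _ _ (expR (la ^+ 2 * sigma ^+ 2 / 2))%:E); last first.
  rewrite lee_fin ler_expR ler_pM2r// ler_wpM2l ?sqr_ge0//.
  by rewrite lerXn2r ?nnegrE// (le_trans s0).
have mexp : measurable_fun setT (fun z : R => (expR (la * z))%:E).
  by apply/measurable_EFinP; apply: (measurableT_comp (@measurable_expR R)).
have [sE|sN] := eqVneq sigma 0%R.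
  rewrite (eq_measure_integral (dirac (0 : R)%R)); last first.
    by move=> A mA _; rewrite -[LHS]/(distribution P xi A) hlaw// /centered_normal sE eqxx.
  rewrite integral_dirac// diracT mul1e.
  by rewrite mulr0 expR0 lee_fin -[leLHS]expR0 ler_expR sE expr0n mulr0 mul0r.
rewrite -(@integral_density _ _ _ _ _ lebesgue_measure (distribution P xi)
   id (normal_pdf 0 sigma) _ (measurable_normal_pdf _ _) (normal_pdf_ge0 _ _) _
   (fun z => (expR (la * z))%:E))//; first by rewrite normal_mgf.
by move=> A mA; rewrite [RHS](hlaw A mA) /centered_normal (negbTE sN).
Qed.
End gaussian_noise.

Section pairs.
Local Open Scope ereal_scope.
Context d d1 d2 (T : measurableType d) (T1 : measurableType d1)
  (T2 : measurableType d2) (R : realType) (P : probability T R).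

Definition rv_pair (X : {RV P >-> T1}) (xi : {RV P >-> T2}) : T -> T1 * T2 :=
  fun w => (X w, xi w).

Lemma measurable_rv_pair X xi : measurable_fun setT (rv_pair X xi).
Proof. exact: measurable_fun_pair. Qed.

HB.instance Definition _ X xi :=
  isMeasurableFun.Build _ _ _ _ (rv_pair X xi) (measurable_rv_pair X xi).

(** Rectangles form a pi-system that generates the product
    sigma-algebra, and on rectangles the claim is the product rule. *)
Lemma mutually_independent_pairs n (X : 'I_n -> {RV P >-> T1})
    (xi : 'I_n -> {RV P >-> T2}) (Pi : probability T1 R) :
  (forall j, has_law (X j) Pi) -> mutually_independent X xi ->
  forall C : 'I_n -> set (T1 * T2), (forall j, measurable (C j)) ->
  P (\bigcap_j (rv_pair (X j) (xi j) @^-1` C j)) =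
  \prod_(j < n) (Pi \x distribution P (xi j)) (C j).
Proof.
move=> lawX indep.
apply: (@independent_pi_system _ _ T (T1 * T2)%type R P n
  (fun j => rv_pair (X j) (xi j) : {mfun T >-> (T1 * T2)%type})
  (fun j => (Pi \x distribution P (xi j)) : probability _ _)
  [set A `*` B | A in measurable & B in measurable]).
- exact: measurable_prod_measurableType.
- move=> _ _ [A1 mA1 [A2 mA2 <-]] [B1 mB1 [B2 mB2 <-]].
  exists (A1 `&` B1); first exact: measurableI.
  by exists (A2 `&` B2); [exact: measurableI|rewrite setXI].
- by exists setT => //; exists setT => //; rewrite setXTT.
move=> C GC.
pose A j := projT1 (cid2 (GC j)).
have mA j : measurable (A j) by rewrite /A; case: cid2.
have hB j : exists2 B, measurable B & A j `*` B = C j by rewrite /A; case: cid2.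
pose B j := projT1 (cid2 (hB j)).
have mB j : measurable (B j) by rewrite /B; case: cid2.
have CE j : C j = A j `*` B j by rewrite /B; case: cid2.
have -> : \bigcap_j (rv_pair (X j) (xi j) @^-1` C j) =
    (\bigcap_j (X j @^-1` A j)) `&` (\bigcap_j (xi j @^-1` B j)).
  apply/seteqP; split => [w h|w [h1 h2] j _].
    by split=> j _; have := h j I; rewrite /= CE => -[].
  by rewrite /= CE; split; [exact: h1|exact: h2].
rewrite indep// -big_split/=; apply: eq_bigr => j _.
rewrite CE product_measure1E//; congr (_ * _).
exact: (lawX j _ (mA j)).
Qed.
End pairs.

(** * Deviations along a fixed matrix *)

Section marginal.
Local Open Scope ereal_scope.
Context d1 d2 (T1 : measurableType d1) (T2 : measurableType d2) (R : realType).
Variables (Pi : probability T1 R) (Q : probability T2 R).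

Lemma integral_marginal1 (h : T1 -> R) : measurable_fun setT h ->
  (forall x, (0 <= h x)%R) ->
  \int[Pi \x Q]_u (h u.1)%:E = \int[Pi]_x (h x)%:E.
Proof.
move=> mh h0; rewrite fubini_tonelli1//=; last 2 first.
- by apply/measurable_EFinP; exact: measurableT_comp.
- by move=> u; rewrite lee_fin.
apply: eq_integral => x _; rewrite /fubini_F/= integral_cst//.
by rewrite [X in _ * X](_ : _ = 1) ?mule1//; exact: probability_setT.
Qed.
End marginal.

(** The rate for which subgaussian_exp_sqr bounds the exponential moment of the
    square. *)
Definition sqr_exp_rate (R : realType) (b : R) : R := (8 * b ^+ 2)^-1.
Definition sqr_mgf_const (R : realType) (b : R) : R := 16 / sqr_exp_rate b ^+ 2 * (4 * expR 2).

Section tails.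
Context {R : realType} {m n : nat} (b0 s : R) (b0_gt0 : 0 < b0).
Context d (T : measurableType d) (P : probability T R)
  (Pi : probability (borelmx R m) R)
  (X : 'I_n -> {RV P >-> borelmx R m}) (xi : 'I_n -> {RV P >-> R}).
Hypothesis herm_ae : {ae Pi, forall x : borelmx R m, (x : 'M[R[i]]_m) \is hermsymmx}.
Hypothesis lawX : forall j, has_law (X j) Pi.
Hypothesis iso : isotropic_subgaussian b0 Pi.
Hypothesis noise : forall j la,
  (\int[distribution P (xi j)]_z (expR (la * z))%:E <=
   (expR (la ^+ 2 * s ^+ 2 / 2))%:E)%E.
Hypothesis indep : mutually_independent X xi.

Let th := sqr_exp_rate b0.
Let B := sqr_mgf_const b0.

Lemma sqr_exp_rate_gt0 : 0 < th.
Proof. by rewrite invr_gt0 mulr_gt0// exprn_gt0. Qed.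

Lemma hsnorm_eq0 (A : 'M[R[i]]_m) : hsnorm A = 0 -> A = 0.
Proof.
move=> A0; have := hsnorm_sqr A; rewrite A0 expr0n/= => /esym; rewrite ipE.
have pos i j : 0 <= complex.Re (A i j) * complex.Re (A i j) +
    complex.Im (A i j) * complex.Im (A i j) by rewrite -!expr2 addr_ge0 ?sqr_ge0.
move/psumr_eq0P => h; apply/matrixP => i j; rewrite mxE.
have {h}/psumr_eq0P h := h (fun i _ => sumr_ge0 _ (fun j _ => pos i j)) i isT.
have {h} := h (fun j _ => pos i j) j isT.
case: (A i j) => a b /= /eqP; rewrite -!expr2 paddr_eq0 ?sqr_ge0// !sqrf_eq0.
by move=> /andP[/eqP-> /eqP->].
Qed.

Section fixed_matrix.
Variable A : 'M[R[i]]_m.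
Hypotheses (hA : A \is hermsymmx) (A0 : 0 < hsnorm A).
Let g (x : borelmx R m) : R := ip A x / hsnorm A.

Let mg : measurable_fun setT g.
Proof. by apply: measurable_funM => //; exact: measurable_ip. Qed.

Let g2 : (\int[Pi]_x (g x ^+ 2)%:E = 1)%E.
Proof.
rewrite /g; under eq_integral do rewrite exprMn mulrC EFinM.
rewrite ge0_integralZl_EFin//.
- by rewrite (ip_second_moment herm_ae iso)// -EFinM exprVn mulVf// sqrf_eq0 gt_eqF.
- by move=> x _; rewrite lee_fin sqr_ge0.
- by apply/measurable_EFinP/measurable_funX; exact: measurable_ip.
- by rewrite sqr_ge0.
Qed.

Let ge : (\int[Pi]_x (expR (th * g x ^+ 2))%:E <= (4 * expR 2)%:E)%E.
Proof.
have := subgaussian_exp_sqr b0_gt0 mg (ip_subgaussian iso hA A0).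
suff E x : (g x / b0) ^+ 2 / 8 = th * g x ^+ 2.
  by under eq_integral do rewrite E.
by rewrite /th /sqr_exp_rate; field; rewrite gt_eqF.
Qed.

Lemma mgf_design (la : R) : 0 <= la -> la <= th / 2 ->
  (\int[Pi]_x (expR (la * g x ^+ 2))%:E <= (expR (la + B * la ^+ 2))%:E)%E.
Proof. exact: mgf_sqr_le mg sqr_exp_rate_gt0 g2 ge la. Qed.

Lemma mgfN_design (la : R) : 0 <= la ->
  (\int[Pi]_x (expR (- (la * g x ^+ 2)))%:E <= (expR (- la + B * la ^+ 2))%:E)%E.
Proof. exact: mgfN_sqr_le mg sqr_exp_rate_gt0 g2 ge la. Qed.

(** Integrating the noise first leaves the exponential of
    (la s)^2 / 2 times the square of the design variable, to which mgf_design applies. *)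
Lemma mgf_noise j (la : R) : la ^+ 2 * s ^+ 2 / 2 <= th / 2 ->
  (\int[Pi \x distribution P (xi j)]_u (expR (la * (u.2 * g u.1)))%:E <=
   (expR (la ^+ 2 * s ^+ 2 / 2 + B * (la ^+ 2 * s ^+ 2 / 2) ^+ 2))%:E)%E.
Proof.
move=> hla.
have mphi : measurable_fun setT (fun u : borelmx R m * R => (expR (la * (u.2 * g u.1)))%:E).
  apply/measurable_EFinP; apply: (measurableT_comp (@measurable_expR R)).
  apply: measurable_funM => //; apply: measurable_funM => //.
  exact: measurableT_comp.
rewrite fubini_tonelli1//.
apply: le_trans (mgf_design (la := la ^+ 2 * s ^+ 2 / 2) _ hla); last first.
  by rewrite divr_ge0// mulr_ge0// sqr_ge0.
apply: ge0_le_integral => //.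
- by move=> x _; apply: integral_ge0 => z _; rewrite lee_fin expR_ge0.
- apply: measurable_fun_fubini_tonelli_F => //.
- apply/measurable_EFinP; apply: (measurableT_comp (@measurable_expR R)).
  by apply: measurable_funM => //; exact: measurable_funX.
move=> x _; rewrite /fubini_F/=.
under eq_integral do rewrite [_ * g x]mulrC mulrA.
by apply: le_trans (noise j _) _; rewrite lee_fin ler_expR exprMn le_eqVlt; apply/orP; left; apply/eqP; ring.
Qed.
End fixed_matrix.

Let pair j : {mfun T >-> (borelmx R m * R)%type} := rv_pair (X j) (xi j).
Let nu j : probability (borelmx R m * R)%type R := (Pi \x distribution P (xi j))%E.

Let chernoff_pair (phi : borelmx R m * R -> R) (ka : R) :
  measurable_fun setT phi ->
  (forall j, (\int[Pi \x distribution P (xi j)]_u (expR (phi u))%:E <= (expR (- ka))%:E)%E) ->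
  (P [set w | (0 <= \sum_(j < n) phi (X j w, xi j w))%R] <= (expR (- (n%:R * ka)))%:E)%E.
Proof.
move=> mphi hphi; have indep' := mutually_independent_pairs lawX indep.
exact: (@chernoff_sum _ _ _ _ _ _ _ pair nu indep' phi ka mphi hphi).
Qed.

Let measurable_nonneg (f : T -> R) : measurable_fun setT f ->
  measurable [set w | 0 <= f w].
Proof.
move=> mf; have -> : [set w | 0 <= f w] = f @^-1` `[0%R, +oo[%classic.
  by apply/seteqP; split => w /=; rewrite in_itv/= andbT.
by rewrite -[X in measurable X]setTI; exact: mf.
Qed.

Let measurable_gt (f : T -> R) (a : R) : measurable_fun setT f ->
  measurable [set w | a < f w].
Proof.
move=> mf; have -> : [set w | a < f w] = f @^-1` `]a, +oo[%classic.
  by apply/seteqP; split => w /=; rewrite in_itv/= andbT.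
by rewrite -[X in measurable X]setTI; exact: mf.
Qed.

Let measurable_pair_sum (phi : borelmx R m * R -> R) : measurable_fun setT phi ->
  measurable_fun setT (fun w => \sum_(j < n) phi (X j w, xi j w)).
Proof. by move=> mphi; exact: (measurable_sum_rv pair mphi). Qed.

Let two_sided (bad : set T) (phi psi : borelmx R m * R -> R) (ka : R) :
  measurable bad -> measurable_fun setT phi -> measurable_fun setT psi ->
  (forall j, (\int[Pi \x distribution P (xi j)]_u (expR (phi u))%:E <= (expR (- ka))%:E)%E) ->
  (forall j, (\int[Pi \x distribution P (xi j)]_u (expR (psi u))%:E <= (expR (- ka))%:E)%E) ->
  (forall w, bad w -> 0 <= \sum_(j < n) phi (X j w, xi j w) \/
                      0 <= \sum_(j < n) psi (X j w, xi j w)) ->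
  (P bad <= (2 * expR (- (n%:R * ka)))%:E)%E.
Proof.
move=> mbad mphi mpsi hphi hpsi sub.
have m1 := measurable_nonneg (measurable_pair_sum mphi).
have m2 := measurable_nonneg (measurable_pair_sum mpsi).
apply: (@le_trans _ _ (P ([set w | 0 <= \sum_(j < n) phi (X j w, xi j w)] `|`
    [set w | 0 <= \sum_(j < n) psi (X j w, xi j w)]))).
  by apply: le_measure; rewrite ?inE//; exact: measurableU.
apply: le_trans (measureU2 _ m1 m2) _.
rewrite mulr_natl mulr2n EFinD; apply: leeD.
- exact: chernoff_pair mphi hphi.
- exact: chernoff_pair mpsi hpsi.
Qed.

Lemma measurable_sqr_deviation (A : 'M[R[i]]_m) (c a : R) :
  measurable [set w | a < `|\sum_(j < n) ip A (X j w) ^+ 2 - c| ].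
Proof.
apply: measurable_gt; apply: measurableT_comp => //; apply: measurable_funB => //.
apply: (@measurable_pair_sum (fun u => ip A u.1 ^+ 2)); apply: measurable_funX.
by apply: (measurableT_comp (@measurable_ip R m A)).
Qed.

Lemma measurable_noise_deviation (A : 'M[R[i]]_m) (a : R) :
  measurable [set w | a < `|\sum_(j < n) xi j w * ip A (X j w)| ].
Proof.
apply: measurable_gt; apply: measurableT_comp => //.
apply: (@measurable_pair_sum (fun u => u.2 * ip A u.1)); apply: measurable_funM => //.
by apply: (measurableT_comp (@measurable_ip R m A)).
Qed.

Let hsnorm0_or (A : 'M[R[i]]_m) : A = 0 \/ 0 < hsnorm A.
Proof.
have [/hsnorm_eq0|A0] := eqVneq (hsnorm A) 0; first by left.
by right; rewrite lt_neqAle eq_sym A0 hsnorm_ge0.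
Qed.

(** The two-sided Chernoff bound with the estimates mgf_design and
    mgfN_design for the normalized variable <A, X> / |A|. *)
Lemma sqr_deviation (A : 'M[R[i]]_m) (de la : R) : A \is hermsymmx ->
  0 <= la -> la <= th / 2 ->
  (P [set w | (de * (n%:R * hsnorm A ^+ 2) <
       `|\sum_(j < n) ip A (X j w) ^+ 2 - n%:R * hsnorm A ^+ 2|)%R ] <=
   (2 * expR (- (n%:R * (la * de - B * la ^+ 2))))%:E)%E.
Proof.
move=> hA la0 lath; have [->|A0] := hsnorm0_or A.
  rewrite (_ : [set _ | _] = set0) ?measure0 ?lee_fin ?mulr_ge0 ?expR_ge0//.
  apply/seteqP; split=> // w /=; rewrite big1 => [|j _]; last by rewrite ip0l expr0n.
  by rewrite hsnormE ip0l sqrtr0 expr0n/= !mulr0 subrr normr0 ltxx.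
pose g (x : borelmx R m) : R := ip A x / hsnorm A.
have mg : measurable_fun setT g.
  by apply: measurable_funM => //; exact: measurable_ip.
have mg2 : measurable_fun setT (fun x => g x ^+ 2) by exact: measurable_funX.
have split_exp (h : R) (f : borelmx R m -> R) j : measurable_fun setT f ->
   (\int[Pi \x distribution P (xi j)]_u (expR (f u.1 + h))%:E =
    (expR h)%:E * \int[Pi]_x (expR (f x))%:E)%E.
  move=> mf; rewrite (@integral_marginal1 _ _ _ _ _ Pi (distribution P (xi j)) (fun x => expR (f x + h))).
  - under eq_integral do rewrite expRD mulrC EFinM.
    rewrite ge0_integralZl_EFin ?expR_ge0//.
    by apply/measurable_EFinP; exact: measurableT_comp.
  - apply: (measurableT_comp (@measurable_expR R)); exact: measurable_funD.
  - by move=> x; exact: expR_ge0.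
apply: (@two_sided _ (fun u => la * g u.1 ^+ 2 + - (la * (1 + de)))
                     (fun u => - (la * g u.1 ^+ 2) + la * (1 - de))).
- exact: measurable_sqr_deviation.
- apply: measurable_funD => //; apply: measurable_funM => //.
  exact: (measurableT_comp mg2).
- apply: measurable_funD => //; apply: measurableT_comp => //.
  by apply: measurable_funM => //; exact: (measurableT_comp mg2).
- move=> j; rewrite (split_exp _ (fun x => la * g x ^+ 2)); last exact: measurable_funM.
  apply: le_trans (lee_wpmul2l _ (mgf_design hA A0 la0 lath)) _.
    by rewrite lee_fin expR_ge0.
  by rewrite -EFinM lee_fin -expRD ler_expR le_eqVlt; apply/orP; left; apply/eqP; ring.
- move=> j; rewrite (split_exp _ (fun x => - (la * g x ^+ 2))); last first.
    by apply: measurableT_comp => //; exact: measurable_funM.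
  apply: le_trans (lee_wpmul2l _ (mgfN_design hA A0 la0)) _.
    by rewrite lee_fin expR_ge0.
  by rewrite -EFinM lee_fin -expRD ler_expR le_eqVlt; apply/orP; left; apply/eqP; ring.
move=> w /=; set S := \sum_(j < n) _ => hw.
have gE j : g (X j w) ^+ 2 = ip A (X j w) ^+ 2 / hsnorm A ^+ 2.
  by rewrite /g exprMn exprVn.
rewrite !big_split/= !sumrN -!mulr_sumr !sumr_const card_ord.
rewrite (eq_bigr _ (fun j _ => gE j)) -mulr_suml -/S.
have h0 : 0 < hsnorm A ^+ 2 by rewrite exprn_gt0.
set r := S / _; have Sr : S = r * hsnorm A ^+ 2 by rewrite /r divfK// gt_eqF.
move: hw; rewrite Sr -mulrBl normrM [`|hsnorm A ^+ 2|]gtr0_norm// mulrA ltr_pM2r//.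
rewrite -[(1 + de) *+ n]mulr_natr -[(1 - de) *+ n]mulr_natr.
case: (leP 0 (r - n%:R)) => hr.
  rewrite ger0_norm// -subr_gt0 => h; left.
  rewrite [leRHS](_ : _ = la * (r - n%:R - de * n%:R)); last by ring.
  by rewrite mulr_ge0// ltW.
rewrite ltr0_norm// -subr_gt0 => h; right.
rewrite [leRHS](_ : _ = la * (- (r - n%:R) - de * n%:R)); last by ring.
by rewrite mulr_ge0// ltW.
Qed.

Lemma noise_deviation (A : 'M[R[i]]_m) (u la : R) : A \is hermsymmx ->
  0 <= la -> la ^+ 2 * s ^+ 2 / 2 <= th / 2 ->
  (P [set w | (u * (n%:R * hsnorm A) <
       `|\sum_(j < n) xi j w * ip A (X j w)|)%R ] <=
   (2 * expR (- (n%:R * (la * u - (la ^+ 2 * s ^+ 2 / 2 +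
      B * (la ^+ 2 * s ^+ 2 / 2) ^+ 2)))))%:E)%E.
Proof.
move=> hA la0 lath; have [->|A0] := hsnorm0_or A.
  rewrite (_ : [set _ | _] = set0) ?measure0 ?lee_fin ?mulr_ge0 ?expR_ge0//.
  apply/seteqP; split=> // w /=; rewrite big1 => [|j _]; last by rewrite ip0l mulr0.
  by rewrite hsnormE ip0l sqrtr0 !mulr0 normr0 ltxx.
pose g (x : borelmx R m) : R := ip A x / hsnorm A.
have mg : measurable_fun setT g.
  by apply: measurable_funM => //; exact: measurable_ip.
have mzg : measurable_fun setT (fun v : borelmx R m * R => v.2 * g v.1).
  by apply: measurable_funM => //; exact: (measurableT_comp mg).
have split_exp (h : R) (f : borelmx R m * R -> R) j : measurable_fun setT f ->
   (\int[Pi \x distribution P (xi j)]_v (expR (f v + h))%:E =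
    (expR h)%:E * \int[Pi \x distribution P (xi j)]_v (expR (f v))%:E)%E.
  move=> mf; under eq_integral do rewrite expRD mulrC EFinM.
  rewrite ge0_integralZl_EFin ?expR_ge0//.
  by apply/measurable_EFinP; exact: measurableT_comp.
have lathN : (- la) ^+ 2 * s ^+ 2 / 2 <= th / 2 by rewrite sqrrN.
apply: (@two_sided _ (fun v => la * (v.2 * g v.1) + - (la * u))
                     (fun v => - la * (v.2 * g v.1) + - (la * u))).
- exact: measurable_noise_deviation.
- by apply: measurable_funD => //; exact: measurable_funM.
- by apply: measurable_funD => //; exact: measurable_funM.
- move=> j; rewrite (split_exp _ (fun v => la * (v.2 * g v.1))); last exact: measurable_funM.
  apply: le_trans (lee_wpmul2l _ (mgf_noise hA A0 j lath)) _.
    by rewrite lee_fin expR_ge0.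
  by rewrite -EFinM lee_fin -expRD ler_expR le_eqVlt; apply/orP; left; apply/eqP; ring.
- move=> j; rewrite (split_exp _ (fun v => - la * (v.2 * g v.1))); last exact: measurable_funM.
  apply: le_trans (lee_wpmul2l _ (mgf_noise hA A0 j lathN)) _.
    by rewrite lee_fin expR_ge0.
  by rewrite sqrrN -EFinM lee_fin -expRD ler_expR le_eqVlt; apply/orP; left; apply/eqP; ring.
move=> w /=; set S := \sum_(j < n) _ => hw.
have gE j : xi j w * g (X j w) = (xi j w * ip A (X j w)) / hsnorm A.
  by rewrite /g mulrA.
rewrite !big_split/= -!mulr_sumr !sumr_const card_ord.
rewrite (eq_bigr _ (fun j _ => gE j)) -mulr_suml -/S.
set r := S / _; have Sr : S = r * hsnorm A by rewrite /r divfK// gt_eqF.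
move: hw; rewrite Sr normrM [`|hsnorm A|]gtr0_norm// mulrA ltr_pM2r//.
rewrite -[- (la * u) *+ n]mulr_natr.
case: (leP 0 r) => hr.
  rewrite ger0_norm// -subr_gt0 => h; left.
  rewrite [leRHS](_ : _ = la * (r - u * n%:R)); last by ring.
  by rewrite mulr_ge0// ltW.
rewrite ltr0_norm// -subr_gt0 => h; right.
rewrite [leRHS](_ : _ = la * (- r - u * n%:R)); last by ring.
by rewrite mulr_ge0// ltW.
Qed.

End tails.

(** * Seminorms, positive forms and approximate Caratheodory *)

Section forms.
Context {R : realType} {m : nat}.
Local Notation M := 'M[R[i]]_m.
Implicit Types A B C : M.

Definition seminorm (p : M -> R) : Prop :=
  (forall A B, p (A + B) <= p A + p B) /\
  (forall (r : R) A, p (r%:C%C *: A) = `|r| * p A).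

Definition psdform (q : M -> M -> R) : Prop :=
  [/\ forall A B C, q (A + B) C = q A C + q B C,
      forall (r : R) A C, q (r%:C%C *: A) C = r * q A C,
      forall A B, q A B = q B A &
      forall A, 0 <= q A A].

Section seminorm_theory.
Variable p : M -> R.
Hypothesis hp : seminorm p.

Lemma seminorm0 : p 0 = 0.
Proof. by rewrite -(scaler0 _ (0%:C%C)) hp.2 normr0 mul0r. Qed.

Lemma seminormN A : p (- A) = p A.
Proof. by rewrite -scaleN1r -[-1](rmorphN1 (real_complex R)) hp.2 normrN1 mul1r. Qed.

Lemma seminorm_ge0 A : 0 <= p A.
Proof. by have := hp.1 A (- A); rewrite subrr seminorm0 seminormN; lra. Qed.

Lemma seminormB A B : p (A - B) <= p A + p B.
Proof. by apply: le_trans (hp.1 _ _) _; rewrite seminormN. Qed.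

Lemma seminorm_sum I (r : seq I) (Q : pred I) (F : I -> M) :
  p (\sum_(i <- r | Q i) F i) <= \sum_(i <- r | Q i) p (F i).
Proof.
elim/big_rec2: _ => [|i y x _ h]; first by rewrite seminorm0.
by apply: le_trans (hp.1 _ _) _; rewrite lerD2l.
Qed.

Lemma seminormMn A k : p (A *+ k) = k%:R * p A.
Proof.
rewrite -scaler_nat -[(k%:R : R[i])](rmorph_nat (real_complex R)) hp.2.
by rewrite normr_nat.
Qed.
End seminorm_theory.

Section form_theory.
Variable q : M -> M -> R.
Hypothesis hq : psdform q.

Lemma formDl A B C : q (A + B) C = q A C + q B C. Proof. by case: hq. Qed.
Lemma formZl (r : R) A C : q (r%:C%C *: A) C = r * q A C. Proof. by case: hq. Qed.
Lemma formC A B : q A B = q B A. Proof. by case: hq. Qed.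
Lemma form_ge0 A : 0 <= q A A. Proof. by case: hq. Qed.
Lemma formDr A B C : q A (B + C) = q A B + q A C.
Proof. by rewrite formC formDl !(formC _ A). Qed.
Lemma formZr (r : R) A C : q A (r%:C%C *: C) = r * q A C.
Proof. by rewrite formC formZl formC. Qed.
Lemma formNl A C : q (- A) C = - q A C.
Proof. by rewrite -scaleN1r -[-1](rmorphN1 (real_complex R)) formZl mulN1r. Qed.
Lemma formNr A C : q A (- C) = - q A C.
Proof. by rewrite formC formNl formC. Qed.
Lemma form0r A : q A 0 = 0.
Proof. by have := formZr 0 A 0; rewrite scaler0 mul0r. Qed.

Lemma form_sumr I (r : seq I) (Q : pred I) (F : I -> M) C :
  q C (\sum_(i <- r | Q i) F i) = \sum_(i <- r | Q i) q C (F i).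
Proof.
by apply: (big_morph (q C)) => [A B|]; [exact: formDr|exact: form0r].
Qed.

(** Nonnegativity of q on the line A + t B; if q B B = 0, the form is
    affine in t and the linear coefficient vanishes. *)
Lemma form_cauchy_schwarz A B : q A B ^+ 2 <= q A A * q B B.
Proof.
have H t : 0 <= q A A + 2 * t * q A B + t ^+ 2 * q B B.
  have := form_ge0 (A + t%:C%C *: B).
  by rewrite formDl !formDr !formZl !formZr (formC B A); lra.
have [B0|B0] := eqVneq (q B B) 0.
  rewrite B0 mulr0; have [->|h] := eqVneq (q A B) 0; first by rewrite expr0n.
  have := H (- (q A A + 1) / (2 * q A B)); rewrite B0 mulr0 addr0.
  have -> : 2 * (- (q A A + 1) / (2 * q A B)) * q A B = - (q A A + 1) by field.
  lra.
have Bp : 0 < q B B by rewrite lt_neqAle eq_sym B0 form_ge0.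
have := H (- (q A B / q B B)); rewrite -ler_pdivrMr//.
have -> : q A A + 2 * - (q A B / q B B) * q A B + (- (q A B / q B B)) ^+ 2 * q B B
  = q A A - q A B ^+ 2 / q B B by field.
lra.
Qed.

Lemma form_seminorm : seminorm (fun A => Num.sqrt (q A A)).
Proof.
split=> [A B|r A]; last first.
  by rewrite formZl formZr mulrA -expr2 sqrtrM ?sqr_ge0// sqrtr_sqr.
rewrite -(@ler_pXn2r _ 2)// ?nnegrE ?addr_ge0 ?sqrtr_ge0//.
rewrite sqr_sqrtr ?form_ge0// sqrrD !sqr_sqrtr ?form_ge0//.
rewrite formDl !formDr (formC B A).
suff : q A B <= Num.sqrt (q A A) * Num.sqrt (q B B) by lra.
rewrite -sqrtrM ?form_ge0//; apply: le_trans (ler_norm _) _.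
by rewrite -sqrtr_sqr ler_sqrt ?form_cauchy_schwarz// mulr_ge0// form_ge0.
Qed.

(** Approximate Caratheodory: a convex combination S of points of norm at most
    sqrt M0 is within sqrt (M0 / N) of the average of N of these points. Each new point is
    chosen greedily. If D is the current defect, averaging q (D + a i - S) over i with the
    weights c kills the cross term, because the mean of a i - S is zero, so some i increases
    q D D by at most M0. *)
Lemma maurey (I : finType) (c : I -> R) (a : I -> M) (M0 : R) (N : nat) :
  (forall i, 0 <= c i) -> \sum_i c i = 1 -> (forall i, q (a i) (a i) <= M0) ->
  let S := \sum_i (c i)%:C%C *: a i in
  exists s : nat -> I, let D := \sum_(k < N) a (s k) - S *+ N in
    q D D <= N%:R * M0.
Proof.
move=> c0 c1 aM S.
have [i0 _] : exists i0 : I, true.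
  apply/existsP; apply: contraT; rewrite negb_exists => /forallP h.
  by move: c1; rewrite big1 => [/eqP|i _]; [rewrite eq_sym oner_eq0|have := h i].
elim: N => [|N [s IH]].
  exists (fun=> i0); rewrite /= big_ord0 mulr0n subrr form0r mul0r//.
set D := \sum_(k < N) a (s k) - S *+ N in IH.
have qS B : q B S = \sum_i c i * q B (a i).
  by rewrite form_sumr; apply: eq_bigr => i _; rewrite formZr.
have [i hi] : exists i, q (D + (a i - S)) (D + (a i - S)) <= q D D + M0.
  apply/existsP; apply: contraT; rewrite negb_exists => /forallP h.
  have lt1 : \sum_i c i * (q D D + M0) < \sum_i c i * q (D + (a i - S)) (D + (a i - S)).
    have [j cj] : exists j, 0 < c j.
      apply/existsP; apply: contraT; rewrite negb_exists => /forallP h'.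
      move: c1; rewrite big1 => [/eqP|i _]; first by rewrite eq_sym oner_eq0.
      by apply/eqP; rewrite eq_le c0 andbT leNgt h'.
    rewrite (bigD1 j)//= [ltRHS](bigD1 j)//=; apply: ltr_leD.
      by rewrite ltr_pM2l// ltNge h.
    by apply: ler_sum => i _; rewrite ler_wpM2l// ltW// ltNge h.
  suff : \sum_i c i * q (D + (a i - S)) (D + (a i - S)) <= \sum_i c i * (q D D + M0).
    by rewrite leNgt lt1.
  rewrite -[leRHS]mulr_suml c1 mul1r.
  have expand D' S' i : c i * q (D' + (a i - S')) (D' + (a i - S')) =
     c i * (q D' D' - 2 * q D' S' + q S' S') + 2 * (c i * q D' (a i))
      + c i * q (a i) (a i) - 2 * (c i * q S' (a i)).
    rewrite !formDl !formDr !formNl !formNr (formC (a i) D') (formC S' D') (formC (a i) S').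
    ring.
  rewrite (eq_bigr _ (fun i _ => expand D S i)) sumrB !big_split/= -!mulr_sumr -mulr_suml -!qS c1.
  have : \sum_i c i * q (a i) (a i) <= \sum_i c i * M0.
    by apply: ler_sum => i _; rewrite ler_wpM2l.
  rewrite -mulr_suml c1 mul1r; have := form_ge0 S; lra.
exists (fun k => if k == N then i else s k).
rewrite big_ord_recr /= eqxx.
have -> : \sum_(k < N) a (if k == N :> nat then i else s k) + a i - S *+ N.+1 =
    D + (a i - S).
  rewrite mulrSr /D (eq_bigr (fun k : 'I_N => a (s k))) => [|k _].
    by rewrite opprD addrACA.
  by rewrite ltn_eqF.
by apply: le_trans hi _; rewrite -natr1 mulrDl mul1r lerD2r.
Qed.
End form_theory.

Lemma ip_psdform : psdform (@ip R m).
Proof. split; [exact: ipDl|exact: ipZl|exact: ipC|exact: ip_ge0]. Qed.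

Lemma psdformD q1 q2 : psdform q1 -> psdform q2 ->
  psdform (fun A B => q1 A B + q2 A B).
Proof.
move=> [a1 b1 c1 d1] [a2 b2 c2 d2]; split=> [A B C|r A C|A B|A].
- by rewrite a1 a2; ring.
- by rewrite b1 b2; ring.
- by rewrite c1 c2.
- by rewrite addr_ge0.
Qed.

(** The bilinear form of the squared empirical norm of the design x. *)
Definition empform n (x : 'I_n -> M) A B : R :=
  n%:R^-1 * \sum_(j < n) ip A (x j) * ip B (x j).

Lemma empform_psdform n (x : 'I_n -> M) : psdform (empform x).
Proof.
split=> [A B C|r A C|A B|A]; rewrite /empform.
- rewrite -mulrDr -big_split/=; congr (_ * _); apply: eq_bigr => j _.
  by rewrite ipDl mulrDl.
- rewrite mulrCA; congr (_ * _); rewrite mulr_sumr; apply: eq_bigr => j _.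
  by rewrite ipZl mulrA.
- by congr (_ * _); apply: eq_bigr => j _; rewrite mulrC.
- by rewrite mulr_ge0 ?invr_ge0// sumr_ge0// => j _; rewrite -expr2 sqr_ge0.
Qed.

Lemma normip_seminorm C : seminorm (fun A => `|ip A C|).
Proof.
split=> [A B|r A]; first by rewrite ipDl ler_normD.
by rewrite ipZl normrM.
Qed.
End forms.

(** * Rank-one matrices and their grid *)

Section rank_one.
Context {R : realType} {m : nat}.
Local Notation M := 'M[R[i]]_m.
Implicit Types (A B C : M) (v w : 'rV[R[i]]_m).

Definition rk1 w : M := w^t* *m w.

Lemma rk1E w k l : rk1 w k l = Num.conj (w 0 k) * w 0 l.
Proof. by rewrite /rk1 mxE big_ord1 !mxE. Qed.

Lemma rk1_herm w : rk1 w \is hermsymmx.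
Proof.
by apply/hermsymmxP; rewrite /rk1 trmx_mul map_mxM trmxCK.
Qed.

Lemma mxinner_rk1 w A : A \is hermsymmx -> mxinner (rk1 w) A = (w *m A *m w^t*) 0 0.
Proof.
move=> /hermsymmxP hA; rewrite /mxinner /rk1 -hA -[_ *m w *m A]mulmxA mxtrace_mulC.
by rewrite /mxtrace big_ord1.
Qed.

Lemma hsnorm_rk1 w : hsnorm (rk1 w) = complex.Re ((w *m w^t*) 0 0).
Proof.
have h : (w *m w^t*) 0 0 =
    (\sum_j (complex.Re (w 0 j) ^+ 2 + complex.Im (w 0 j) ^+ 2))%:C%C.
  rewrite mxE rmorph_sum/=; apply: eq_bigr => j _; rewrite !mxE.
  by case: (w 0 j) => a b /=; apply/eqP; rewrite eq_complex/=; apply/andP; split; apply/eqP; ring.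
rewrite /hsnorm mxinner_rk1 ?rk1_herm// /rk1 !mulmxA -mulmxA.
rewrite [X in _ *m X](mx11_scalar (w *m w^t*)) mul_mx_scalar mxE {1}h.
rewrite [X in _ * X]h -rmorphM/= -expr2 sqrtr_sqr ger0_norm ?h//.
by apply: sumr_ge0 => j _; rewrite addr_ge0 ?sqr_ge0.
Qed.

Definition symunit (k l : 'I_m) : M := delta_mx k l + delta_mx l k.
Definition skewunit (k l : 'I_m) : M := 'i%C *: (delta_mx k l - delta_mx l k).

Lemma conj_delta (k l : 'I_m) : (delta_mx k l : M)^t* = delta_mx l k.
Proof. by rewrite trmx_delta map_delta_mx. Qed.

Lemma symunit_herm k l : symunit k l \is hermsymmx.
Proof.
by apply/hermsymmxP; rewrite /symunit linearD map_mxD !conj_delta addrC.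
Qed.

Lemma skewunit_herm k l : skewunit k l \is hermsymmx.
Proof.
apply/hermsymmxP/matrixP => a b; rewrite !mxE rmorphM rmorphB !rmorph_nat.
transitivity (- 'i%C * (((b == k) && (a == l))%:R - ((b == l) && (a == k))%:R) : R[i]).
  by rewrite mulNr -mulrN opprB [(b == l) && _]andbC [(b == k) && _]andbC.
by congr (_ * _); apply/eqP; rewrite eq_complex/= oppr0 !eqxx.
Qed.

(** The real span of these 2 m^2 matrices contains the Hermitian ones; each entry
    is counted twice, once for (k, l) and once for (l, k). *)
Lemma herm_units A : A \is hermsymmx ->
  A *+ 2 = \sum_k \sum_l ((complex.Re (A k l))%:C%C *: symunit k l +
                          (complex.Im (A k l))%:C%C *: skewunit k l).
Proof.
move=> /hermsymmxP hA.
have ReIm z : (complex.Re z)%:C%C + (complex.Im z)%:C%C * 'i%C = z :> R[i].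
  by case: z => a b; apply/eqP; rewrite eq_complex/=; apply/andP; split; apply/eqP; ring.
have ReImN z : (complex.Re z)%:C%C - (complex.Im z)%:C%C * 'i%C = Num.conj z :> R[i].
  by case: z => a b; apply/eqP; rewrite eq_complex/=; apply/andP; split; apply/eqP; ring.
transitivity (\sum_k \sum_l (A k l *: delta_mx k l + Num.conj (A k l) *: delta_mx l k)).
  under eq_bigr do rewrite big_split/=.
  rewrite big_split/= -matrix_sum_delta mulr2n; congr (_ + _).
  rewrite exchange_big/= {1}hA [LHS]matrix_sum_delta.
  by apply: eq_bigr => k _; apply: eq_bigr => l _; rewrite !mxE.
apply: eq_bigr => k _; apply: eq_bigr => l _.
rewrite -{1}(ReIm (A k l)) -(ReImN (A k l)) /symunit /skewunit.
by rewrite scalerA scalerBr scalerDr scalerDl scalerBl addrACA.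
Qed.

(** Rounding errors are bounded entrywise; this converts them, with
    a loss polynomial in m, into bounds for the random seminorms. *)
Lemma seminorm_le_entries (p : M -> R) (b e : R) A : seminorm p -> A \is hermsymmx ->
  (forall k l, p (symunit k l) <= b) -> (forall k l, p (skewunit k l) <= b) ->
  (forall k l, `|complex.Re (A k l)| <= e /\ `|complex.Im (A k l)| <= e) ->
  p A <= m%:R ^+ 2 * e * b.
Proof.
move=> hp hA hs hk he.
suff : p (A *+ 2) <= m%:R ^+ 2 * (2 * e * b) by rewrite seminormMn//; lra.
rewrite herm_units//.
have -> : m%:R ^+ 2 * (2 * e * b) = \sum_(k < m) \sum_(l < m) (2 * e * b) :> R.
  by rewrite !sumr_const !card_ord -mulrnA -[RHS]mulr_natl natrM expr2.
apply: le_trans (seminorm_sum hp _ _ _) _; apply: ler_sum => k _.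
apply: le_trans (seminorm_sum hp _ _ _) _; apply: ler_sum => l _.
apply: le_trans (hp.1 _ _) _; rewrite !hp.2.
have [h1 h2] := he k l.
have -> : 2 * e * b = e * b + e * b by ring.
by apply: lerD; apply: ler_pM => //; exact: seminorm_ge0.
Qed.

End rank_one.

Section grid.
Context {R : realType} {m : nat} (G : nat).
Hypothesis G0 : (0 < G)%N.

Definition gridpt (k : 'I_(2 * G).+1) : R := (k%:R - G%:R) / G%:R.

Lemma grid_round (x : R) : `|x| <= 1 -> exists k, `|x - gridpt k| <= G%:R^-1.
Proof.
rewrite ler_norml => /andP[x1 x2].
have g0 : 0 < G%:R :> R by rewrite ltr0n.
have y0 : 0 <= (x + 1) * G%:R by apply: mulr_ge0; [lra|exact: ltW].
have /andP[h1 h2] := truncn_itv y0.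
have kG : (Num.truncn ((x + 1) * G%:R) < (2 * G).+1)%N.
  rewrite ltnS -(ler_nat R) (le_trans h1)// natrM ler_pM2r//; lra.
exists (Ordinal kG); rewrite /gridpt/=; move: h1 h2 => {kG}.
move: (Num.truncn _) => k h1; rewrite -natr1 => h2.
have -> : x - (k%:R - G%:R) / G%:R = ((x + 1) * G%:R - k%:R) / G%:R.
  by field; rewrite gt_eqF.
rewrite normrM [`|_^-1|]ger0_norm; last by rewrite invr_ge0 ltW.
apply: ler_piMl; first by rewrite invr_ge0 ltW.
by rewrite ger0_norm; lra.
Qed.

Lemma gridpt_le1 k : `|gridpt k| <= 1.
Proof.
have g0 : 0 < G%:R :> R by rewrite ltr0n.
rewrite /gridpt normrM [`|_^-1|]gtr0_norm ?invr_gt0// ler_pdivrMr// mul1r.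
have : (k <= 2 * G)%N by rewrite -ltnS ltn_ord.
rewrite -(ler_nat R) natrM ler_norml => h.
by have := ler0n R k; lra.
Qed.

Definition gridT : finType := {ffun 'I_m -> 'I_(2 * G).+1 * 'I_(2 * G).+1}.

Definition gridvec (g : gridT) : 'rV[R[i]]_m :=
  \row_j (gridpt (g j).1 +i* gridpt (g j).2)%C.

Lemma card_gridT : #|gridT| = ((2 * G).+1 ^ (2 * m))%N.
Proof. by rewrite card_ffun card_prod !card_ord mulnn -expnM. Qed.

(** Each product of coordinates is a bilinear function of numbers in
    [-1, 1] known up to 1/G, and an entry has two such products in each part. *)
Lemma gridvec_round (v : 'rV[R[i]]_m) :
  (forall j, `|complex.Re (v 0 j)| <= 1 /\ `|complex.Im (v 0 j)| <= 1) ->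
  exists g, forall k l,
   `|complex.Re ((rk1 v - rk1 (gridvec g)) k l)| <= 4 / G%:R /\
   `|complex.Im ((rk1 v - rk1 (gridvec g)) k l)| <= 4 / G%:R.
Proof.
move=> hv.
have H j : exists k : 'I_(2 * G).+1 * 'I_(2 * G).+1,
    `|complex.Re (v 0 j) - gridpt k.1| <= G%:R^-1 /\
    `|complex.Im (v 0 j) - gridpt k.2| <= G%:R^-1.
  have [h1 h2] := hv j; have [k1 e1] := grid_round h1; have [k2 e2] := grid_round h2.
  by exists (k1, k2).
have [f hf] := choice H.
exists [ffun j => f j] => k l.
have aux (a b a' b' : R) : `|a| <= 1 -> `|b'| <= 1 ->
    `|a - a'| <= G%:R^-1 -> `|b - b'| <= G%:R^-1 ->
    `|a * b - a' * b'| <= 2 / G%:R.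
  move=> ha hb h1 h2; have -> : a * b - a' * b' = a * (b - b') + (a - a') * b' by ring.
  apply: le_trans (ler_normD _ _) _; rewrite !normrM mulr_natl mulr2n; apply: lerD.
    by rewrite -[leRHS]mul1r; apply: ler_pM.
  by rewrite -[leRHS]mulr1; apply: ler_pM.
have -> (A B : 'M[R[i]]_m) : (A - B) k l = A k l - B k l by rewrite !mxE.
rewrite !rk1E !mxE !ffunE.
move: (hf k) (hf l) (hv k) (hv l).
case: (v 0 k) => a b; case: (v 0 l) => c e /= [h1 h2] [h3 h4] [a1 b1] [c1 e1].
have p1 := gridpt_le1 (f l).1; have p2 := gridpt_le1 (f l).2.
have -> : 4 / G%:R = 2 / G%:R + 2 / G%:R :> R by lra.
split.
  have -> : forall x y z t : R, a * c - - b * e + - (x * z - - y * t) = (a * c - x * z) + (b * e - y * t).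
    by move=> *; ring.
  by apply: le_trans (ler_normD _ _) _; apply: lerD; apply: aux.
have -> : forall x y z t : R, a * e + - b * c + - (x * t + - y * z) = (a * e - x * t) - (b * c - y * z).
  by move=> *; ring.
by apply: le_trans (ler_normB _ _) _; apply: lerD; apply: aux.
Qed.
End grid.
Arguments gridT : clear implicits.
Arguments gridvec R {m G} g.

(** * Spectral calculus and the Klein inequality *)

Section spectral_calculus.
Context {R : realType} {m : nat}.
Local Notation M := 'M[R[i]]_m.
Implicit Types (A B S : M) (v w : 'rV[R[i]]_m).

Definition specval S (i : 'I_m) : R := complex.Re (spectral_diag S 0 i).
Definition specvec S (i : 'I_m) : 'rV[R[i]]_m := row i (spectralmx S).
(** Functional calculus written as a sum of rank-one matrices, which suits
    quadratic forms better than the conjugated diagonal matrix. *)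
Definition spectral_fun S (f : R -> R) : M :=
  \sum_i (f (specval S i))%:C%C *: rk1 (specvec S i).

Lemma spectral_funE S f : invmx (spectralmx S)
    *m diag_mx (\row_i (f (specval S i))%:C%C) *m spectralmx S = spectral_fun S f.
Proof.
rewrite invmx_unitary ?spectral_unitarymx//; apply/matrixP => k l.
rewrite mxE /spectral_fun summxE; apply: eq_bigr => i _.
rewrite mul_mx_diag !mxE big_ord1 !mxE -mulrA [RHS]mulrCA; congr (_ * _).
Qed.

Lemma spectral_fun_id S : S \is hermsymmx -> spectral_fun S id = S.
Proof.
move=> hS; have /hermitian_normalmx/orthomx_spectralP SE := hS.
rewrite -spectral_funE [RHS]SE; congr (_ *m diag_mx _ *m _).
apply/rowP => i; rewrite mxE /specval.
have /mxOverP/(_ 0 i) := hermitian_spectral_diag_real hS.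
by move: (spectral_diag S 0 i) => [a b]; rewrite complex_real/= => /eqP->.
Qed.

Lemma mxlogE S : mxlog S = spectral_fun S (@ln R).
Proof. by rewrite -spectral_funE; congr (_ *m diag_mx _ *m _); apply/rowP => i; rewrite !mxE. Qed.

Lemma specvec_ortho S i j : (specvec S i *m (specvec S j)^t*) 0 0 = (i == j)%:R.
Proof.
have /unitarymxP/matrixP/(_ i j) := spectral_unitarymx S.
rewrite [RHS]mxE => <-; rewrite !mxE; apply: eq_bigr => k _.
by rewrite !mxE.
Qed.

Lemma rk1_specvec_sum S : \sum_i rk1 (specvec S i) = 1%:M.
Proof.
have := mulVmx (spectral_unit S); rewrite invmx_unitary ?spectral_unitarymx// => <-.
apply/matrixP => k l; rewrite summxE [RHS]mxE; apply: eq_bigr => i _.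
by rewrite rk1E !mxE.
Qed.

Lemma ip1 A : ip A 1%:M = complex.Re (\tr A).
Proof. by rewrite /ip /mxinner trmx1 map_mx1 mulmx1. Qed.

Lemma ip_rk1 w A : A \is hermsymmx -> ip (rk1 w) A = complex.Re ((w *m A *m w^t*) 0 0).
Proof. by move=> hA; rewrite /ip mxinner_rk1. Qed.

Lemma ip_rk1_rk1 v w : ip (rk1 v) (rk1 w) =
  complex.Re ((v *m w^t*) 0 0) ^+ 2 + complex.Im ((v *m w^t*) 0 0) ^+ 2.
Proof.
rewrite ip_rk1 ?rk1_herm// /rk1 mulmxA -[_ *m w *m v^t*]mulmxA.
rewrite mxE big_ord1.
have -> : (w *m v^t*) 0 0 = Num.conj ((v *m w^t*) 0 0).
  rewrite !mxE rmorph_sum; apply: eq_bigr => k _.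
  by rewrite !mxE rmorphM /= conjCK mulrC.
by rewrite Re_mulC !expr2.
Qed.

(** The squared moduli of the scalar products between two eigenbases. They form a
    doubly stochastic matrix, which reduces trace inequalities for pairs of matrices to
    scalar ones. *)
Definition overlap S S' i j : R := ip (rk1 (specvec S i)) (rk1 (specvec S' j)).

Lemma overlap_ge0 S S' i j : 0 <= overlap S S' i j.
Proof. by rewrite /overlap ip_rk1_rk1 addr_ge0 ?sqr_ge0. Qed.

Lemma overlap_diag S i j : overlap S S i j = (i == j)%:R.
Proof.
by rewrite /overlap ip_rk1_rk1 specvec_ortho; case: eqP => _ /=; rewrite ?expr0n ?expr1n ?addr0.
Qed.

Lemma ip_rk1_specvec_id S i : ip (rk1 (specvec S i)) 1%:M = 1.
Proof.
rewrite ip1 /rk1 mxtrace_mulC /mxtrace big_ord1 specvec_ortho eqxx //.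
Qed.

Lemma overlap_sumr S S' i : \sum_j overlap S S' i j = 1.
Proof.
by rewrite -(form_sumr ip_psdform) rk1_specvec_sum ip_rk1_specvec_id.
Qed.

Lemma overlap_suml S S' j : \sum_i overlap S S' i j = 1.
Proof.
by rewrite -ip_suml rk1_specvec_sum ipC ip_rk1_specvec_id.
Qed.

Lemma ip_spectral_fun S S' f g : ip (spectral_fun S f) (spectral_fun S' g) =
  \sum_i \sum_j f (specval S i) * g (specval S' j) * overlap S S' i j.
Proof.
rewrite /spectral_fun ip_suml; apply: eq_bigr => i _.
rewrite (form_sumr ip_psdform); apply: eq_bigr => j _.
by rewrite ipZl ipZr mulrA.
Qed.

Lemma ip_spectral_fun_self S f g : ip (spectral_fun S f) (spectral_fun S g) =
  \sum_i f (specval S i) * g (specval S i).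
Proof.
rewrite ip_spectral_fun; apply: eq_bigr => i _.
rewrite (bigD1 i)//= overlap_diag eqxx mulr1 big1 ?addr0// => j ji.
by rewrite overlap_diag eq_sym (negbTE ji) mulr0.
Qed.

Lemma hermD A B : A \is hermsymmx -> B \is hermsymmx -> A + B \is hermsymmx.
Proof.
move=> /hermsymmxP hA /hermsymmxP hB; apply/hermsymmxP.
by rewrite linearD map_mxD -hA -hB.
Qed.

Lemma hermZ (r : R) A : A \is hermsymmx -> r%:C%C *: A \is hermsymmx.
Proof.
move=> /hermsymmxP hA; apply/hermsymmxP; rewrite linearZ map_mxZ -hA.
by congr (_ *: _); apply/eqP; rewrite eq_complex/= oppr0 !eqxx.
Qed.

Lemma hermN A : A \is hermsymmx -> - A \is hermsymmx.
Proof. by move=> /(hermZ (-1)); rewrite rmorphN1 scaleN1r. Qed.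

Lemma hermB A B : A \is hermsymmx -> B \is hermsymmx -> A - B \is hermsymmx.
Proof. by move=> hA hB; apply: hermD => //; exact: hermN. Qed.

Lemma herm0 : (0 : M) \is hermsymmx.
Proof. by apply/hermsymmxP; rewrite trmx0 map_mx0. Qed.

Lemma herm1 : (1%:M : M) \is hermsymmx.
Proof. by apply/hermsymmxP; rewrite trmx1 map_mx1. Qed.

Lemma herm_sum I (r : seq I) (Q : pred I) (F : I -> M) :
  (forall i, F i \is hermsymmx) -> \sum_(i <- r | Q i) F i \is hermsymmx.
Proof.
by move=> h; elim/big_rec: _ => [|i x _ hx]; [exact: herm0|exact: hermD].
Qed.

Lemma spectral_fun_herm S f : spectral_fun S f \is hermsymmx.
Proof. by apply: herm_sum => i; apply: hermZ; exact: rk1_herm. Qed.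

Lemma neg_entropyE S : S \is hermsymmx ->
  neg_entropy S = \sum_i specval S i * ln (specval S i).
Proof.
move=> hS; rewrite /neg_entropy mxlogE -{1}(spectral_fun_id hS).
rewrite -(ip_spectral_fun_self S id (@ln R)) /ip /mxinner.
by rewrite -(hermsymmxP _ (spectral_fun_herm S (@ln R))).
Qed.

Lemma density_herm S : density S -> S \is hermsymmx. Proof. by case. Qed.

Lemma specvalE S i : S \is hermsymmx -> specval S i = ip (rk1 (specvec S i)) S.
Proof.
move=> hS; rewrite -{3}(spectral_fun_id hS) (form_sumr ip_psdform) (bigD1 i)//=.
rewrite ipZr -/(overlap S S i i) overlap_diag eqxx mulr1 big1 ?addr0// => j ji.
by rewrite ipZr -/(overlap S S i j) overlap_diag eq_sym (negbTE ji) mulr0.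
Qed.

Lemma specval_ge0 S i : density S -> 0 <= specval S i.
Proof.
move=> [hS pS _]; rewrite specvalE// ip_rk1//.
by have := pS (specvec S i); move: (_ 0 0) => [a b]; rewrite lecE/= => /andP[].
Qed.

Lemma specval_sum S : density S -> \sum_i specval S i = 1.
Proof.
move=> [hS _ tS]; transitivity (ip S 1%:M); last by rewrite ip1 tS.
rewrite -[in RHS](spectral_fun_id hS) ip_suml; apply: eq_bigr => i _.
by rewrite ipZl ip_rk1_specvec_id mulr1.
Qed.

Lemma specval_le1 S i : density S -> specval S i <= 1.
Proof.
move=> dS; rewrite -(specval_sum dS) (bigD1 i)//= lerDl sumr_ge0// => j _.
exact: specval_ge0.
Qed.

(** Selecting the nonzero eigenvalues by rectangular matrices E and F
    turns the diagonal matrix D into an identity matrix E D F. *)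
Lemma card_spectral_fun_rank S f :
  (#|[pred i | f (specval S i) != 0%R]| <= \rank (spectral_fun S f))%N.
Proof.
set J := [pred i | _].
pose E : 'M[R[i]]_(#|J|, m) := \matrix_(a, k) (k == enum_val a)%:R.
pose F : 'M[R[i]]_(m, #|J|) :=
  \matrix_(k, a) ((k == enum_val a)%:R * ((f (specval S k))^-1)%:C%C).
pose D : M := diag_mx (\row_i (f (specval S i))%:C%C).
have EDF : E *m D *m F = 1%:M.
  apply/matrixP => a b; rewrite mxE (bigD1 (enum_val a))//= big1 => [|k ka].
    rewrite mul_mx_diag !mxE eqxx mul1r addr0 (inj_eq enum_val_inj).
    case: eqVneq => [_|]; last by rewrite mul0r mulr0.
    rewrite mul1r -rmorphM/= divff//.
    exact: (enum_valP a).
  by rewrite mul_mx_diag !mxE (negbTE ka) !mul0r.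
have -> : \rank (spectral_fun S f) = \rank D.
  rewrite -spectral_funE mxrankMfree; last first.
    by rewrite row_free_unit spectral_unit.
  by rewrite eqmxMfull// row_full_unit unitmx_inv spectral_unit.
rewrite -(mxrank1 (R[i]) #|J|) -EDF.
by apply: leq_trans (mxrankM_maxl _ _) (mxrankM_maxr _ _).
Qed.

Lemma spectral_funM S f g :
  spectral_fun S f *m spectral_fun S g = spectral_fun S (fun x => f x * g x).
Proof.
rewrite -!spectral_funE !mulmxA mulmxK ?spectral_unit//.
rewrite -[_ *m diag_mx _ *m diag_mx _]mulmxA mulmx_diag.
by congr (_ *m diag_mx _ *m _); apply/rowP => i; rewrite !mxE rmorphM.
Qed.

(** Concavity of the logarithm, in the form of the pointwise Gibbs inequality; with
    ln 0 = 0 it includes a = 0. *)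
Lemma ln_gibbs (a b : R) : 0 <= a -> 0 < b -> a * ln b <= a * ln a + b - a.
Proof.
move=> a0 b0; have [->|aN] := eqVneq a 0; first by rewrite !mul0r; lra.
have ap : 0 < a by rewrite lt_neqAle eq_sym aN.
have h : -1 < b / a - 1 by have := divr_gt0 b0 ap; lra.
have := le_ln1Dx h; rewrite addrC subrK ln_div ?posrE// => h'.
have := ler_wpM2l a0 h'; rewrite mulrBr [a * (b / a - 1)]mulrBr mulrCA divff// !mulr1.
lra.
Qed.

(** Summing ln_gibbs against the doubly stochastic overlaps gives
    tr S log S' <= tr S log S, up to the difference of the traces, which vanishes; this is
    convexity of the negative entropy, with slope log S' at S'. *)
Lemma klein S S' : density S -> density S' -> (forall i, 0 < specval S' i) ->
  neg_entropy S' - neg_entropy S <= ip (S' - S) (mxlog S').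
Proof.
move=> dS dS' pS'; have hS := density_herm dS; have hS' := density_herm dS'.
rewrite ipBl -{2}(spectral_fun_id hS') -{2}(spectral_fun_id hS) mxlogE.
rewrite ip_spectral_fun_self -neg_entropyE// ip_spectral_fun.
rewrite lerD2l lerN2 neg_entropyE//.
apply: (@le_trans _ _ (\sum_i \sum_j (specval S i * ln (specval S i) +
   specval S' j - specval S i) * overlap S S' i j)).
  apply: ler_sum => i _; apply: ler_sum => j _.
  by rewrite ler_wpM2r ?overlap_ge0// ln_gibbs// specval_ge0.
rewrite (eq_bigr (fun i => specval S i * ln (specval S i) +
  \sum_j specval S' j * overlap S S' i j - specval S i)); last first.
  move=> i _; under eq_bigr do rewrite mulrBl mulrDl.
  by rewrite sumrB big_split/= -!mulr_sumr overlap_sumr !mulr1.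
rewrite sumrB big_split/= exchange_big/= specval_sum//.
under [X in _ + X - _]eq_bigr do rewrite -mulr_sumr overlap_suml mulr1.
by rewrite specval_sum// addrK.
Qed.
End spectral_calculus.

(** * Noise and entropy in terms of the rank *)

Lemma norm_sum4_le (R : realType) (a b c d k : R) :
  `|a| <= k -> `|b| <= k -> `|c| <= k -> `|d| <= k ->
  `|a + (b + (c - d))| <= 4 * k.
Proof.
move=> ha hb hc hd; have -> : 4 * k = k + (k + (k + k)) by ring.
apply: le_trans (ler_normD _ _) (lerD ha _).
apply: le_trans (ler_normD _ _) (lerD hb _).
exact: le_trans (ler_normB _ _) (lerD hc hd).
Qed.

Section low_rank.
Context {R : realType} {m : nat}.
Local Notation M := 'M[R[i]]_m.
Implicit Types (A B S : M) (v w : 'rV[R[i]]_m).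

Lemma ip_le_hsnorm A B : ip A B <= hsnorm A * hsnorm B.
Proof.
apply: le_trans (ler_norm _) _; rewrite -sqrtr_sqr /hsnorm -sqrtrM ?ip_ge0//.
by rewrite ler_sqrt ?mulr_ge0 ?ip_ge0//; exact: (form_cauchy_schwarz ip_psdform).
Qed.

Lemma hsnorm_seminorm : seminorm (@hsnorm R m).
Proof. exact: (form_seminorm ip_psdform). Qed.

Lemma hsnormN A : hsnorm (- A) = hsnorm A.
Proof. exact: (seminormN hsnorm_seminorm). Qed.

Lemma norm_ip_le_hsnorm A B : `|ip A B| <= hsnorm A * hsnorm B.
Proof. by rewrite ler_norml ip_le_hsnorm andbT lerNl -ipNl -(hsnormN A) ip_le_hsnorm. Qed.

Lemma ip_mulmxl A B C : B \is hermsymmx -> ip (B *m A) C = ip A (B *m C).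
Proof.
move=> /hermsymmxP hB; rewrite /ip /mxinner trmx_mul map_mxM -hB.
by rewrite -mulmxA mxtrace_mulC mulmxA.
Qed.

Lemma ip_adj A B : ip (A^t* ) (B^t* ) = ip A B.
Proof.
by rewrite ipC /ip /mxinner trmxCK mxtrace_mulC.
Qed.

Lemma hsnorm_adj A : hsnorm (A^t* ) = hsnorm A.
Proof. by rewrite !hsnormE ip_adj. Qed.

Lemma ip_mulmxr A B C : B \is hermsymmx -> ip (A *m B) C = ip A (C *m B).
Proof.
move=> hB; have /hermsymmxP eB := hB.
by rewrite -ip_adj trmx_mul map_mxM -eB ip_mulmxl// -ip_adj trmx_mul map_mxM !trmxCK -eB.
Qed.

Lemma hsnorm_proj_le A B : B \is hermsymmx -> B *m B = B -> hsnorm (B *m A) <= hsnorm A.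
Proof.
move=> hB BB; have [->|n0] := eqVneq (hsnorm (B *m A)) 0; first exact: hsnorm_ge0.
have pos : 0 < hsnorm (B *m A) by rewrite lt_neqAle eq_sym n0 hsnorm_ge0.
rewrite -(ler_pM2l pos) -expr2 hsnorm_sqr.
have -> : ip (B *m A) (B *m A) = ip (B *m A) A.
  by rewrite -ip_mulmxl// mulmxA BB.
exact: ip_le_hsnorm.
Qed.

Section support.
Variables (S : M) (Xi : M) (ka : R).
Hypotheses (dS : density S) (hXi : Xi \is hermsymmx) (ka0 : 0 <= ka).
Hypothesis Xi_le : forall w, `|ip (rk1 w) Xi| <= ka * hsnorm (rk1 w).

Let P := spectral_fun S (fun x => (x != 0)%:R).
Let Q := 1%:M - P.
Let r : R := (\rank S)%:R.

Let hP : P \is hermsymmx. Proof. exact: spectral_fun_herm. Qed.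
Let PP : P *m P = P.
Proof.
rewrite /P spectral_funM; congr spectral_fun; apply/funext => x.
by rewrite -natrM mulnb andbb.
Qed.
Let hQ : Q \is hermsymmx. Proof. exact: hermB herm1 hP. Qed.
Let QQ : Q *m Q = Q.
Proof. by rewrite /Q mulmxBl mul1mx mulmxBr mulmx1 PP subrr subr0. Qed.

Let card_support : (\sum_i (specval S i != 0)%:R <= r :> R).
Proof.
have := card_spectral_fun_rank S id; rewrite spectral_fun_id ?density_herm//.
rewrite -natr_sum ler_nat; apply: leq_trans.
rewrite -sum1_card [leqRHS]big_mkcond/=; apply: eq_leq.
by apply: eq_bigr => i _; rewrite inE; case: (_ != _).
Qed.

Lemma hsnorm_rk1E w : hsnorm (rk1 w) = ip (rk1 w) 1%:M.
Proof. by rewrite hsnorm_rk1 ip1 /rk1 mxtrace_mulC /mxtrace big_ord1. Qed.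

Let compress_rk1 w : Q *m rk1 w *m Q = rk1 (w *m Q).
Proof.
by rewrite /rk1 trmx_mul map_mxM -(hermsymmxP _ hQ) !mulmxA.
Qed.

Let off_support_le C : density C -> `|ip (Q *m Xi *m Q) C| <= ka * ip C Q.
Proof.
move=> dC; rewrite -{1 2}(spectral_fun_id (density_herm dC)).
rewrite (form_sumr ip_psdform) ip_suml mulr_sumr.
apply: le_trans (ler_norm_sum _ _ _) _; apply: ler_sum => k _.
rewrite ipZr ipZl normrM ger0_norm ?specval_ge0// mulrCA ler_wpM2l ?specval_ge0//.
set w := specvec C k.
have -> : ip (Q *m Xi *m Q) (rk1 w) = ip (rk1 (w *m Q)) Xi.
  by rewrite ip_mulmxr// -compress_rk1 -mulmxA ip_mulmxl// ipC.
apply: le_trans (Xi_le _) _; rewrite hsnorm_rk1E -compress_rk1.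
by rewrite ip_mulmxr// ip_mulmxl// mul1mx QQ.
Qed.

Let ipSQ : ip S Q = 0.
Proof.
have hS := density_herm dS.
rewrite /Q ipBr -{2}(spectral_fun_id hS) ip_spectral_fun_self ip1.
case: (dS) => _ _ ->; rewrite /= -[X in X - _](specval_sum dS) -sumrB big1// => i _.
by case: eqVneq => [->|_]; rewrite ?mulr1 ?subrr// mul0r subrr.
Qed.

Let hsnorm_supp : hsnorm P <= Num.sqrt r.
Proof.
rewrite ler_sqrt ?ler0n// -/(ip P P) ip_spectral_fun_self.
apply: le_trans card_support; apply: ler_sum => i _.
by rewrite -natrM mulnb andbb.
Qed.

Let spec_Xi_le k : `|specval Xi k| <= ka.
Proof.
rewrite specvalE//; apply: le_trans (Xi_le _) _.
by rewrite hsnorm_rk1E ip_rk1_specvec_id mulr1.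
Qed.

Let hsnorm_supp_noise : hsnorm (P *m Xi) <= ka * Num.sqrt r.
Proof.
rewrite -[ka]ger0_norm// -sqrtr_sqr -sqrtrM ?sqr_ge0//.
rewrite ler_sqrt ?mulr_ge0 ?sqr_ge0 ?ler0n// -/(ip (P *m Xi) (P *m Xi)).
rewrite -ip_mulmxl// mulmxA PP ip_mulmxr//.
rewrite -{1 2}(spectral_fun_id hXi) spectral_funM ip_spectral_fun.
apply: (@le_trans _ _ (\sum_i (specval S i != 0)%:R * ka ^+ 2)); last first.
  by rewrite -mulr_suml mulrC ler_wpM2l ?sqr_ge0.
apply: ler_sum => i _; rewrite -[leRHS]mulr1 -[X in _ <= _ * X](overlap_sumr S Xi i) mulr_sumr.
apply: ler_sum => k _; rewrite ler_wpM2r ?overlap_ge0// ler_wpM2l//.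
by rewrite /= -expr2 -real_normK ?num_real// lerXn2r ?nnegrE.
Qed.

(** With P the projection onto the range of S and Q its complement, Xi is split
    into Q Xi Q and three terms with a factor P. The latter have Hilbert-Schmidt norm at
    most ka sqrt r. For the former, Q S Q = 0, so it only sees the mass of rho off the range
    of S; this mass is - <rho - S, P> because the traces agree, hence at most
    sqrt r |rho - S|. *)
Lemma ip_noise_le_rank rho : density rho ->
  `|ip (rho - S) Xi| <= 4 * ka * Num.sqrt r * hsnorm (rho - S).
Proof.
move=> drho; set B := rho - S.
have XiE : Xi = Q *m Xi *m Q + (P *m Xi + (Xi *m P - P *m Xi *m P)).
  by rewrite /Q mulmxBr mulmx1 mulmxBl mul1mx mulmxBl addrACA subrK addNr addr0.
have ipBQ : ip B Q = - ip B P.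
  rewrite /Q ipBr ip1 /B linearB/=; case: drho dS => _ _ -> [_ _ ->].
  by rewrite subrr sub0r.
rewrite ipC XiE !ipDl ipNl.
have t1 : `|ip (Q *m Xi *m Q) B| <= ka * (Num.sqrt r * hsnorm B).
  rewrite /B ipBr; apply: le_trans (ler_normB _ _) _.
  apply: le_trans (lerD (off_support_le drho) (off_support_le dS)) _.
  rewrite ipSQ mulr0 addr0 ler_wpM2l//.
  have -> : ip rho Q = ip B Q by rewrite /B ipBl ipSQ subr0.
  rewrite ipBQ -ipNl; apply: le_trans (ip_le_hsnorm _ _) _.
  by rewrite hsnormN mulrC ler_wpM2r ?hsnorm_ge0.
have XiP : hsnorm (Xi *m P) <= ka * Num.sqrt r.
  rewrite -hsnorm_adj trmx_mul map_mxM.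
  by rewrite -(hermsymmxP _ hP) -(hermsymmxP _ hXi).
have t A : hsnorm A <= ka * Num.sqrt r -> `|ip A B| <= ka * (Num.sqrt r * hsnorm B).
  move=> hA; apply: le_trans (norm_ip_le_hsnorm _ _) _; rewrite mulrA.
  by rewrite ler_wpM2r ?hsnorm_ge0.
have t2 := t _ hsnorm_supp_noise; have t3 := t _ XiP.
have t4 : `|ip (P *m Xi *m P) B| <= ka * (Num.sqrt r * hsnorm B).
  apply: t; rewrite -mulmxA; apply: le_trans (hsnorm_proj_le _ hP PP) XiP.
apply: le_trans (norm_sum4_le t1 t2 t3 t4) _.
by rewrite le_eqVlt; apply/orP; left; apply/eqP; ring.
Qed.
End support.

Section entropy.
Variables (S : M) (n : nat).
Hypotheses (dS : density S) (m0 : (0 < m)%N) (n0 : (0 < n)%N).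

(** The oracle mixed with a proportion 1/n of the maximally mixed state: its
    eigenvalues are at least 1/(mn), so that its logarithm is of size log(mn). *)
Definition smoothed : M :=
  (1 - n%:R^-1)%:C%C *: S + ((m%:R * n%:R)^-1)%:C%C *: 1%:M.

Let c : R := (m%:R * n%:R)^-1.
Let c_gt0 : 0 < c. Proof. by rewrite invr_gt0 mulr_gt0 ?ltr0n. Qed.

Lemma density_conv A B (t : R) : 0 <= t <= 1 -> density A -> density B ->
  density (t%:C%C *: A + (1 - t)%:C%C *: B).
Proof.
move=> /andP[t0 t1] [hA pA tA] [hB pB tB]; split.
- by apply: hermD; exact: hermZ.
- move=> v; rewrite mulmxDr mulmxDl -!scalemxAr -!scalemxAl !mxE.
  have pt : 0 <= t%:C%C :> R[i] by rewrite lecR.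
  have pt' : 0 <= (1 - t)%:C%C :> R[i] by rewrite lecR subr_ge0.
  by have := pA v; have := pB v; rewrite !mxE => h1 h2; rewrite addr_ge0// mulr_ge0.
- by rewrite linearD !linearZ/= tA tB !mulr1 -rmorphD addrC subrK.
Qed.

Lemma density_uniform : density ((m%:R^-1)%:C%C *: 1%:M : M).
Proof.
split.
- by apply: hermZ; exact: herm1.
- move=> v; rewrite -scalemxAr mulmx1 -scalemxAl mxE.
  apply: mulr_ge0; first by rewrite lecR invr_ge0.
  rewrite mxE; apply: sumr_ge0 => k _; rewrite !mxE.
  exact: mul_conjC_ge0.
- have mE : m%:R = (m%:R : R)%:C%C :> R[i] by rewrite rmorph_nat.
  rewrite linearZ/= mxtrace1 mE -rmorphM/=.
  by rewrite mulVf// pnatr_eq0 -lt0n.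
Qed.

Lemma smoothedE : smoothed = (1 - n%:R^-1)%:C%C *: S +
  (1 - (1 - n%:R^-1))%:C%C *: ((m%:R^-1)%:C%C *: 1%:M).
Proof.
rewrite /smoothed scalerA -rmorphM; do 4 f_equal; field.
by rewrite !pnatr_eq0 -!lt0n m0 n0.
Qed.

Lemma smoothed_density : density smoothed.
Proof.
rewrite smoothedE; apply: density_conv density_uniform => //.
by rewrite subr_ge0 invf_le1 ?ltr0n// ler1n n0 gerBl invr_ge0 ler0n.
Qed.

Lemma specval_smoothed_ge i : c <= specval smoothed i.
Proof.
rewrite specvalE ?(density_herm smoothed_density)// /smoothed ipDr !ipZr ip_rk1_specvec_id mulr1.
rewrite lerDr mulr_ge0//; first by rewrite subr_ge0 invf_le1 ?ltr0n// ler1n.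
case: dS => hS pS _; rewrite ip_rk1//.
by have := pS (specvec smoothed i); move: (_ 0 0) => [a b]; rewrite lecE/= => /andP[].
Qed.

(** By Klein, the difference is at most <S' - rho, log S'>. The matrix log S' is
    ln c times the identity, which is orthogonal to S' - rho, plus a matrix L that vanishes
    on the kernel of S, where the eigenvalue of S' is c = 1/(mn); hence L has rank at most
    that of S and its eigenvalues lie between 0 and - ln c. *)
Lemma entropy_increment_le rho : density rho ->
  neg_entropy smoothed - neg_entropy rho <=
  hsnorm (smoothed - rho) * (Num.sqrt (\rank S)%:R * ln (m%:R * n%:R)).
Proof.
move=> drho; have dS' := smoothed_density.
have pos i : 0 < specval smoothed i := lt_le_trans c_gt0 (specval_smoothed_ge i).
apply: le_trans (klein drho dS' pos) _.
pose L := spectral_fun smoothed (fun x => ln x - ln c).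
have LE : mxlog smoothed = L + (ln c)%:C%C *: 1%:M.
  rewrite mxlogE /L /spectral_fun -(rk1_specvec_sum smoothed) scaler_sumr -big_split/=.
  by apply: eq_bigr => i _; rewrite -scalerDl -rmorphD subrK.
have -> : ip (smoothed - rho) (mxlog smoothed) = ip (smoothed - rho) L.
  rewrite LE ipDr ipZr ip1 linearB/=; case: (dS') drho => _ _ -> [_ _ ->].
  by rewrite subrr mulr0 addr0.
apply: le_trans (ip_le_hsnorm _ _) _; rewrite ler_wpM2l ?hsnorm_ge0//.
have lnc : ln (m%:R * n%:R) = - ln c by rewrite /c lnV ?opprK// posrE mulr_gt0 ?ltr0n.
have c1 : c <= 1.
  by rewrite /c invf_le1 ?mulr_gt0 ?ltr0n// -natrM ler1n muln_gt0 m0.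
have lnc0 : 0 <= - ln c by rewrite oppr_ge0 ln_le0.
rewrite lnc -[- ln c]ger0_norm// -sqrtr_sqr -sqrtrM ?ler0n//.
rewrite ler_sqrt ?mulr_ge0 ?sqr_ge0 ?ler0n// -/(ip L L) ip_spectral_fun_self.
apply: (@le_trans _ _ (\sum_i (specval smoothed i - c != 0)%:R * (- ln c) ^+ 2)).
  apply: ler_sum => i _; have [->|_] := eqVneq (specval smoothed i) c.
    by rewrite !subrr mulr0 mulr_ge0// sqr_ge0.
  rewrite subr_eq0; case: eqVneq => [->|_]; first by rewrite !subrr !mul0r.
  have h1 : ln (specval smoothed i) <= 0 by rewrite ln_le0// specval_le1.
  have h2 : ln c <= ln (specval smoothed i).
    by rewrite ler_ln ?posrE// specval_smoothed_ge.
  by rewrite mul1r -expr2 lerXn2r ?nnegrE//; lra.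
rewrite -mulr_suml ler_wpM2r ?sqr_ge0//.
rewrite -natr_sum ler_nat.
apply: (@leq_trans #|[pred i | specval smoothed i - c != 0%R]|).
  by rewrite -sum1_card [leqRHS]big_mkcond/=; apply: eq_leq; apply: eq_bigr => i _; rewrite inE; case: (_ != _).
apply: leq_trans (card_spectral_fun_rank smoothed (fun x => x - c)) _.
have -> : spectral_fun smoothed (fun x => x - c) = (1 - n%:R^-1)%:C%C *: S.
  have -> : spectral_fun smoothed (fun x => x - c) = smoothed - c%:C%C *: 1%:M.
    rewrite -{2}(spectral_fun_id (density_herm dS')) /spectral_fun.
    rewrite -(rk1_specvec_sum smoothed) scaler_sumr -sumrB.
    by apply: eq_bigr => i _; rewrite -scalerBl -rmorphB.
  by rewrite /smoothed addrK.
exact: mxrank_scale.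
Qed.
End entropy.
End low_rank.

(** * Near-isometry on differences of densities *)

(** A is a sum over the grid that approximates N times B, so the
    near-isometry at A passes to B after division by N = s^2. *)
Lemma near_isometry_transfer (R : realType) (de N s pA hA pB hB : R) :
  0 <= de -> de <= 1 / 4 -> 0 < s -> N = s ^+ 2 ->
  0 <= pA -> 0 <= hA -> 0 <= hB ->
  `|pA ^+ 2 - hA ^+ 2| <= de * hA ^+ 2 ->
  pA <= N * pB + 12 * s -> N * pB <= pA + 12 * s ->
  hA <= N * hB + 12 * s -> N * hB <= hA + 12 * s ->
  `|pB - hB| <= de * hB + 36 / s.
Proof.
move=> de0 de1 s0 NE pA0 hA0 hB0; rewrite ler_norml => /andP[j1 j2] p1 p2 h1 h2.
have A2 := sqr_ge0 (hA).
have i1 : (1 - de) * hA <= pA.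
  rewrite -(@ler_pXn2r _ 2) ?nnegrE// ?exprMn; first by nra.
  by apply: mulr_ge0 => //; lra.
have i2 : pA <= (1 + de) * hA.
  rewrite -(@ler_pXn2r _ 2) ?nnegrE// ?exprMn; first by nra.
  by apply: mulr_ge0 => //; lra.
have Np : 0 < N by rewrite NE exprn_gt0.
have E : 36 / s = 36 * s / N by rewrite NE; field; rewrite gt_eqF.
have k0 : 0 <= de * s by rewrite mulr_ge0// ltW.
have k1 : de * s <= 1 / 4 * s by rewrite ler_wpM2r// ltW.
rewrite E ler_norml; apply/andP; split; rewrite -(ler_pM2l Np).
- have -> : N * - (de * hB + 36 * s / N) = - (de * (N * hB)) - 36 * s.
    by field; rewrite gt_eqF.
  have k2 : (1 - de) * (N * hB) <= (1 - de) * (hA + 12 * s).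
    by rewrite ler_wpM2l//; lra.
  by lra.
- have -> : N * (de * hB + 36 * s / N) = de * (N * hB) + 36 * s.
    by field; rewrite gt_eqF.
  have k2 : (1 + de) * hA <= (1 + de) * (N * hB + 12 * s).
    by rewrite ler_wpM2l//; lra.
  by lra.
Qed.

Lemma ler_trans_D (R : realType) (a b c d : R) : a <= b + d -> d <= c -> a <= b + c.
Proof. by move=> h1 h2; apply: le_trans h1 _; rewrite lerD2l. Qed.

Section uniform.
Context {R : realType} {m n : nat}.
Local Notation M := 'M[R[i]]_m.
Implicit Types (A B S : M) (v w : 'rV[R[i]]_m).

Lemma density_hsnorm_le1 S : density S -> hsnorm S <= 1.
Proof.
move=> dS; rewrite -[1]sqrtr1 /hsnorm ler_sqrt// -/(ip S S).
rewrite -(spectral_fun_id (density_herm dS)) ip_spectral_fun_self -(specval_sum dS).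
apply: ler_sum => i _; rewrite -[leRHS]mulr1 ler_wpM2l ?specval_ge0 ?specval_le1//.
Qed.

Lemma hsnormB_density S1 S2 : density S1 -> density S2 -> hsnorm (S1 - S2) <= 2.
Proof.
move=> d1 d2; apply: le_trans (seminormB hsnorm_seminorm _ _) _.
by have := density_hsnorm_le1 d1; have := density_hsnorm_le1 d2; lra.
Qed.

Lemma hsnorm_delta (k l : 'I_m) : hsnorm (delta_mx k l : M) = 1.
Proof.
rewrite hsnormE ipE (bigD1 k)//= [X in _ + X]big1 => [|i ik]; last first.
  by rewrite big1// => j _; rewrite !mxE (negbTE ik)/= !mulr0 addr0.
rewrite addr0 (bigD1 l)//= [X in _ + X]big1 => [|j jl]; last first.
  by rewrite !mxE (negbTE jl) andbF /= !mulr0 addr0.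
by rewrite !mxE !eqxx /= !mulr0 mulr1 !addr0 sqrtr1.
Qed.

Lemma hsnorm_symunit k l : hsnorm (symunit k l : M) <= 2.
Proof.
apply: le_trans (hsnorm_seminorm.1 _ _) _; rewrite !hsnorm_delta; lra.
Qed.

Lemma hsnorm_skewunit k l : hsnorm (skewunit k l : M) <= 2.
Proof.
have -> : hsnorm (skewunit k l : M) = hsnorm (delta_mx k l - delta_mx l k : M).
  rewrite !hsnormE !ipE; congr Num.sqrt; apply: eq_bigr => i _; apply: eq_bigr => j _.
  by rewrite !mxE; case: (_ - _) => a b /=; ring.
apply: le_trans (seminormB hsnorm_seminorm _ _) _; rewrite !hsnorm_delta; lra.
Qed.

(** Unit vectors stay in the box covered by the grid. *)
Lemma unit_entries v : hsnorm (rk1 v) = 1 ->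
  forall j, `|complex.Re (v 0 j)| <= 1 /\ `|complex.Im (v 0 j)| <= 1.
Proof.
move=> hv j.
have h : complex.Re (v 0 j) ^+ 2 + complex.Im (v 0 j) ^+ 2 <= 1.
  rewrite -hv hsnorm_rk1 mxE Re_sum (bigD1 j)//= !mxE Re_mulC !expr2 lerDl.
  by apply: sumr_ge0 => k _; rewrite !mxE Re_mulC -!expr2 addr_ge0 ?sqr_ge0.
have h1 := sqr_ge0 (complex.Re (v 0 j)); have h2 := sqr_ge0 (complex.Im (v 0 j)).
by split; rewrite -(@ler_pXn2r _ 2)// ?nnegrE// real_normK ?num_real// expr1n; lra.
Qed.

Section grid_approximation.
Variable (G : nat).
Hypothesis G0 : (0 < G)%N.

Lemma rk1_near_grid (p : M -> R) (b : R) v : seminorm p ->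
  (forall k l, p (symunit k l) <= b) -> (forall k l, p (skewunit k l) <= b) ->
  hsnorm (rk1 v) = 1 ->
  exists g : gridT m G, hsnorm (rk1 v - rk1 (gridvec R g)) <= m%:R ^+ 2 * (4 / G%:R) * 2 /\
     p (rk1 v - rk1 (gridvec R g)) <= m%:R ^+ 2 * (4 / G%:R) * b.
Proof.
move=> hp h1 h2 hv; have [g hg] := gridvec_round G0 (unit_entries hv).
exists g; have hh : rk1 v - rk1 (gridvec R g) \is hermsymmx by apply: hermB; exact: rk1_herm.
split; apply: seminorm_le_entries => //; first exact: hsnorm_seminorm.
  exact: hsnorm_symunit.
exact: hsnorm_skewunit.
Qed.
End grid_approximation.

Lemma grid_mesh (G : nat) (b : R) : (0 < n)%N -> (0 < G)%N -> (12 * m ^ 2 * n <= G)%N ->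
  0 <= b -> m%:R ^+ 2 * (4 / G%:R) * b <= b / (3 * n%:R).
Proof.
move=> n0 G0 Gn b0.
have g0 : 0 < G%:R :> R by rewrite ltr0n.
have n0' : 0 < n%:R :> R by rewrite ltr0n.
have h : 12 * m%:R ^+ 2 * n%:R <= G%:R :> R.
  by move: Gn; rewrite -(ler_nat R) 2!natrM natrX.
have -> : m%:R ^+ 2 * (4 / G%:R) * b = b * (4 * m%:R ^+ 2) / G%:R :> R by ring.
rewrite ler_pdivrMr// mulrAC ler_pdivlMr ?mulr_gt0// -!mulrA ler_wpM2l//.
by lra.
Qed.

Section isometry.
Variables (x : 'I_n -> M) (G N : nat) (de : R).
Hypotheses (G0 : (0 < G)%N) (N0 : (0 < N)%N) (Nn : (N <= n)%N).
Hypotheses (m0 : (0 < m)%N) (Gn : (12 * m ^ 2 * n <= G)%N).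
Hypotheses (de0 : 0 <= de) (de1 : de <= 1 / 4).

Definition near_isometry A : Prop :=
  `|empform x A A - hsnorm A ^+ 2| <= de * hsnorm A ^+ 2.

Definition grid_sum (f h : {ffun 'I_N -> gridT m G}) : M :=
  \sum_k (rk1 (gridvec R (f k)) - rk1 (gridvec R (h k))).

Hypothesis near_iso_sym : forall k l, near_isometry (symunit k l).
Hypothesis near_iso_skew : forall k l, near_isometry (skewunit k l).
Hypothesis near_iso_grid : forall g : gridT m G, near_isometry (rk1 (gridvec R g)).
Hypothesis near_iso_sum : forall f h, near_isometry (grid_sum f h).

Let pn A := Num.sqrt (empform x A A).
Let q A B := ip A B + empform x A B.
Let qn A := Num.sqrt (q A A).

Let hq : psdform q. Proof. exact: psdformD ip_psdform (empform_psdform x). Qed.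
Let hqn : seminorm qn. Proof. exact: form_seminorm. Qed.
Let hpn : seminorm pn. Proof. exact: (form_seminorm (empform_psdform x)). Qed.

Let qn_le A (a : R) : 0 <= a -> near_isometry A -> hsnorm A <= a -> qn A <= 3 / 2 * a.
Proof.
rewrite /near_isometry ler_norml => a0 /andP[_ h] ha.
have h0 := hsnorm_ge0 A.
have hs : hsnorm A ^+ 2 <= a ^+ 2 by rewrite lerXn2r ?nnegrE.
rewrite -(@ler_pXn2r _ 2) ?nnegrE ?sqrtr_ge0//; last by lra.
rewrite sqr_sqrtr ?(form_ge0 hq)// /q -hsnorm_sqr.
by have := ler_wpM2r (sqr_ge0 (hsnorm A)) de1; lra.
Qed.

Let hsnorm_le_qn A : hsnorm A <= qn A.
Proof. by rewrite /hsnorm ler_sqrt ?(form_ge0 hq)// /q lerDl (form_ge0 (empform_psdform x)). Qed.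

Let pn_le_qn A : pn A <= qn A.
Proof. by rewrite /pn ler_sqrt ?(form_ge0 hq)// /q lerDr ip_ge0. Qed.

Let n0 : (0 < n)%N. Proof. exact: leq_trans N0 Nn. Qed.

Let mesh1 (b : R) : 0 <= b -> b <= 3 -> m%:R ^+ 2 * (4 / G%:R) * b <= n%:R^-1.
Proof.
move=> b0 b3; apply: le_trans (grid_mesh n0 G0 Gn b0) _.
have n0' : 0 < n%:R :> R by rewrite ltr0n.
by rewrite invfM mulrA; apply: ler_piMl; [rewrite invr_ge0 ltW|lra].
Qed.

Let ler0n2 : 0 <= 2 :> R. Proof. by []. Qed.

Let ninv1 : n%:R^-1 <= 1 :> R.
Proof. by rewrite invf_le1 ?ler1n ?ltr0n. Qed.

Let round v : hsnorm (rk1 v) = 1 -> exists g : gridT m G,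
  hsnorm (rk1 (gridvec R g)) <= 2 /\ qn (rk1 v - rk1 (gridvec R g)) <= n%:R^-1.
Proof.
move=> hv.
have hs k l : qn (symunit k l) <= 3.
  by apply: le_trans (qn_le ler0n2 (near_iso_sym k l) (hsnorm_symunit k l)) _; rewrite divfK.
have hk k l : qn (skewunit k l) <= 3.
  by apply: le_trans (qn_le ler0n2 (near_iso_skew k l) (hsnorm_skewunit k l)) _; rewrite divfK.
have [g [h1 h2]] := rk1_near_grid G0 hqn hs hk hv; exists g; split.
  have e2 : m%:R ^+ 2 * (4 / G%:R) * 2 <= n%:R^-1 :> R.
    by apply: mesh1; rewrite ?ler_nat.
  have := hsnorm_seminorm.1 (rk1 v) (rk1 (gridvec R g) - rk1 v).
  rewrite addrC subrK -opprB (seminormN hsnorm_seminorm) hv.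
  move=> tri; have := ler_trans_D tri (le_trans h1 (le_trans e2 ninv1)).
  by rewrite -[1 + 1]/2%:R.
by apply: le_trans h2 (mesh1 _ _).
Qed.

Let qn_rk1 v : hsnorm (rk1 v) = 1 -> q (rk1 v) (rk1 v) <= 25.
Proof.
move=> hv; have [g [h1 h2]] := round hv.
have h3 := qn_le ler0n2 (near_iso_grid g) h1.
have h : qn (rk1 v) <= 5.
  have := hqn.1 (rk1 v - rk1 (gridvec R g)) (rk1 (gridvec R g)); rewrite subrK.
  rewrite divfK // in h3; rewrite addrC => tri.
  apply: le_trans (ler_trans_D tri (le_trans h2 ninv1)) _.
  by apply: le_trans (lerD h3 (lexx 1)) _; rewrite natr1 ler_nat.
rewrite -[q _ _]sqr_sqrtr ?(form_ge0 hq)// -/(qn (rk1 v)).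
have -> : 25 = 5 ^+ 2 :> R by rewrite -natrX.
by rewrite lerXn2r ?nnegrE ?sqrtr_ge0.
Qed.

Let sN : R := Num.sqrt N%:R.
Let sN2 : sN ^+ 2 = N%:R. Proof. by rewrite sqr_sqrtr ?ler0n. Qed.
Let sN1 : 1 <= sN. Proof. by rewrite -[1]sqrtr1 ler_sqrt ?ler0n// ler1n. Qed.

Let specvec_unit S k : hsnorm (rk1 (specvec S k)) = 1.
Proof. by rewrite hsnorm_rk1 specvec_ortho eqxx. Qed.

Let density_net S : density S -> exists f : {ffun 'I_N -> gridT m G},
  qn (\sum_k rk1 (gridvec R (f k)) - S *+ N) <= 6 * sN.
Proof.
move=> dS.
have [s /= hs] := @maurey _ _ _ hq _ (specval S) (fun i => rk1 (specvec S i)) 25 N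
  (fun i => specval_ge0 i dS) (specval_sum dS) (fun i => qn_rk1 (specvec_unit S i)).
rewrite -/(spectral_fun S id) spectral_fun_id ?density_herm// in hs.
have [f hf] := choice (fun k : 'I_N => round (specvec_unit S (s k))).
exists [ffun k => f k].
have -> : \sum_k rk1 (gridvec R ([ffun k => f k] k)) - S *+ N =
  (\sum_(k < N) rk1 (specvec S (s k)) - S *+ N) -
  \sum_(k < N) (rk1 (specvec S (s k)) - rk1 (gridvec R (f k))).
  rewrite sumrB opprB [RHS]addrC addrA subrK; congr (_ + _).
  by apply: eq_bigr => k _; rewrite ffunE.
apply: le_trans (seminormB hqn _ _) _.
have -> : 6 * sN = 5 * sN + sN by ring.
apply: lerD.
  rewrite -(@ler_pXn2r _ 2) ?nnegrE ?sqrtr_ge0//; last by rewrite mulr_ge0// sqrtr_ge0.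
  rewrite sqr_sqrtr ?(form_ge0 hq)// exprMn sN2; apply: le_trans hs _.
  by rewrite mulrC ler_wpM2r ?ler0n// -natrX ler_nat.
apply: le_trans (seminorm_sum hqn _ _ _) _.
apply: (@le_trans _ _ (\sum_(k < N) n%:R^-1)).
  by apply: ler_sum => k _; have [] := hf k.
rewrite sumr_const card_ord -[_ *+ N]mulr_natl; apply: le_trans sN1.
by rewrite ler_pdivrMr ?ltr0n// mul1r ler_nat.
Qed.

(** A net argument in the norm qn, the square root of the sum of the
    Hilbert-Schmidt and empirical forms. It is bounded on rank-one projections thanks to the
    grid, so maurey approximates densities in both norms at once by sums over the
    grid, on which the near-isometry is assumed. *)
Lemma uniform_near_isometry S1 S2 : density S1 -> density S2 ->
  `|pn (S1 - S2) - hsnorm (S1 - S2)| <= de * hsnorm (S1 - S2) + 36 / sN.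
Proof.
move=> d1 d2; have [f hf] := density_net d1; have [h hh] := density_net d2.
set B := S1 - S2; set A := grid_sum f h.
have AB : qn (A - B *+ N) <= 12 * sN.
  have -> : A - B *+ N = (\sum_k rk1 (gridvec R (f k)) - S1 *+ N) -
      (\sum_k rk1 (gridvec R (h k)) - S2 *+ N).
    rewrite /A /grid_sum /B sumrB mulrnBl !opprB [LHS]addrACA [RHS]addrACA.
    by congr (_ + _); exact: addrC.
  apply: le_trans (seminormB hqn _ _) _.
  by apply: le_trans (lerD hf hh) _; rewrite -mulrDl; apply: ler_wpM2r; rewrite ?sqrtr_ge0// -natrD ler_nat.
have tri (p : M -> R) : seminorm p -> p (A - B *+ N) <= 12 * sN ->
    p A <= N%:R * p B + 12 * sN /\ N%:R * p B <= p A + 12 * sN.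
  move=> hp hAB; have a1 := hp.1 (A - B *+ N) (B *+ N).
  have a2 := hp.1 (B *+ N - A) A.
  rewrite subrK seminormMn// in a1.
  rewrite subrK seminormMn// -opprB seminormN// in a2.
  split; first by apply: le_trans a1 _; rewrite addrC lerD2l.
  by apply: le_trans a2 _; rewrite addrC lerD2l.
have [p1 p2] := tri _ hpn (le_trans (pn_le_qn _) AB).
have [h1 h2] := tri _ hsnorm_seminorm (le_trans (hsnorm_le_qn _) AB).
apply: (near_isometry_transfer de0 de1 _ _ _ (hsnorm_ge0 A) _ _ p1 p2 h1 h2).
- exact: lt_le_trans sN1.
- by rewrite sN2.
- exact: sqrtr_ge0.
- exact: hsnorm_ge0.
- by rewrite sqr_sqrtr ?(form_ge0 (empform_psdform x))//; exact: near_iso_sum.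
Qed.
End isometry.
End uniform.

(** * The deterministic oracle inequality *)

Section noise_grid.
Context {R : realType} {m n : nat}.
Local Notation M := 'M[R[i]]_m.
Implicit Types (A B S : M) (v w : 'rV[R[i]]_m).
Variables (Xi : M) (u : R) (G : nat).
Hypotheses (u0 : 0 <= u) (G0 : (0 < G)%N) (n0 : (0 < n)%N).
Hypothesis Gn : (12 * m ^ 2 * n <= G)%N.
Hypothesis sym_le : forall k l, `|ip (symunit k l) Xi| <= u * hsnorm (symunit k l : M).
Hypothesis skew_le : forall k l, `|ip (skewunit k l) Xi| <= u * hsnorm (skewunit k l : M).
Hypothesis grid_le : forall g : gridT m G,
  `|ip (rk1 (gridvec R g)) Xi| <= u * hsnorm (rk1 (gridvec R g)).

Lemma rk1Z (r : R) w : rk1 (r%:C%C *: w) = (r ^+ 2)%:C%C *: rk1 w.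
Proof.
apply/matrixP => k l; rewrite rk1E mxE [RHS]mxE rk1E !mxE.
have -> : Num.conj (r%:C%C * w 0 k) = r%:C%C * Num.conj (w 0 k).
  by rewrite rmorphM; congr (_ * _); apply/eqP; rewrite eq_complex/= oppr0 !eqxx.
by rewrite mulrACA -rmorphM -expr2.
Qed.

(** A unit vector is rounded to the grid, and the rounding error
    is estimated on the symmetric and skew units. The general case follows by
    homogeneity. *)
Lemma noise_quadratic_form_le w : `|ip (rk1 w) Xi| <= 3 * u * hsnorm (rk1 w).
Proof.
have unit_case v : hsnorm (rk1 v) = 1 -> `|ip (rk1 v) Xi| <= 3 * u.
  move=> hv.
  have hs k l : `|ip (symunit k l) Xi| <= 2 * u.
    by apply: le_trans (sym_le k l) _; rewrite mulrC ler_wpM2r// hsnorm_symunit.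
  have hk k l : `|ip (skewunit k l) Xi| <= 2 * u.
    by apply: le_trans (skew_le k l) _; rewrite mulrC ler_wpM2r// hsnorm_skewunit.
  have [g [h1 h2]] := rk1_near_grid G0 (normip_seminorm Xi) hs hk hv.
  have c1 : m%:R ^+ 2 * (4 / G%:R) * 2 <= 1 :> R.
    apply: le_trans (grid_mesh n0 G0 Gn (ler0n R 2)) _.
    rewrite ler_pdivrMr ?mulr_gt0 ?ltr0n// mul1r -natrM ler_nat.
    by case: (n) n0 => // k _; rewrite mulnS.
  have h3 : hsnorm (rk1 (gridvec R g)) <= 2.
    have := hsnorm_seminorm.1 (rk1 v) (rk1 (gridvec R g) - rk1 v).
    rewrite addrC subrK -opprB (seminormN hsnorm_seminorm) hv => tri.
    by have := ler_trans_D tri (le_trans h1 c1).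
  have := (normip_seminorm Xi).1 (rk1 v - rk1 (gridvec R g)) (rk1 (gridvec R g)).
  rewrite subrK [leRHS]addrC => tri.
  have h2' : `|ip (rk1 v - rk1 (gridvec R g)) Xi| <= u.
    by apply: le_trans h2 _; rewrite (mulrA _ 2 u) -[leRHS]mul1r; apply: ler_wpM2r.
  apply: le_trans (ler_trans_D tri h2') _.
  have -> : 3 * u = u * 2 + u by ring.
  by rewrite lerD2r; apply: le_trans (grid_le g) (ler_wpM2l u0 h3).
have [w0|w0] := eqVneq (hsnorm (rk1 w)) 0.
  by rewrite w0 mulr0 (hsnorm_eq0 w0) ip0l normr0.
have wp : 0 < hsnorm (rk1 w) by rewrite lt_neqAle eq_sym w0 hsnorm_ge0.
pose r := (Num.sqrt (hsnorm (rk1 w)))^-1.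
have r2 : r ^+ 2 = (hsnorm (rk1 w))^-1 by rewrite exprVn sqr_sqrtr ?hsnorm_ge0.
have := unit_case (r%:C%C *: w).
rewrite rk1Z (hsnorm_seminorm.2) r2 ger0_norm ?invr_ge0 ?hsnorm_ge0// mulVf//.
rewrite ipZl normrM ger0_norm ?invr_ge0 ?hsnorm_ge0// => /(_ erefl).
by rewrite mulrC ler_pdivrMr.
Qed.
End noise_grid.

(** Young's inequality, with parameters chosen so that the coefficient of b^2
    stays below 2: near-isometry costs (20/19)^2 (21/20)^4 in that coefficient. *)
Lemma solve_basic_inequality (R : realType) (a b e T a' b' : R) :
  0 <= a -> 0 <= b -> 0 <= e -> 0 <= T -> 0 <= a' -> 0 <= b' ->
  19 / 20 * a - e <= a' -> b' <= 21 / 20 * b + 2 * e ->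
  a' ^+ 2 <= b' ^+ 2 + T * (a + b + e) ->
  a ^+ 2 <= 2 * b ^+ 2 + 130 * e ^+ 2 + 19 * T ^+ 2.
Proof.
move=> a0 b0 e0 T0 a'0 b'0 h1 h2 h3.
have h4 : (19 / 20 * a) ^+ 2 <= 21 / 20 * a' ^+ 2 + 21 * e ^+ 2.
  have : (19 / 20 * a) ^+ 2 <= (a' + e) ^+ 2 by rewrite lerXn2r ?nnegrE; lra.
  by have := sqr_ge0 (a' - 20 * e); lra.
have h5 : b' ^+ 2 <= 21 / 20 * (21 / 20 * b) ^+ 2 + 21 * (2 * e) ^+ 2.
  have : b' ^+ 2 <= (21 / 20 * b + 2 * e) ^+ 2 by rewrite lerXn2r ?nnegrE; lra.
  by have := sqr_ge0 (21 / 20 * b - 20 * (2 * e)); lra.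
have h6 : T * (a + b + e) <= 15 * T ^+ 2 + (a ^+ 2 + b ^+ 2 + e ^+ 2) / 20.
  have := sqr_ge0 (30 * T - (a + b + e)); have := sqr_ge0 (a - b).
  have := sqr_ge0 (a - e); have := sqr_ge0 (b - e); lra.
have := sqr_ge0 b; have := sqr_ge0 e; have := sqr_ge0 T; lra.
Qed.

(** The minimality of the estimator (A) against the smoothed oracle (S), with
    both linear terms bounded. The rank enters through s = sqrt r >= 1, which also absorbs
    the noise error u i due to the smoothing. *)
Lemma basic_inequality (R : realType)
    (eA eS xA xS x1 x2 c eps hA hS a b i g1 g2 u s l e : R) :
  0 <= a -> 0 <= b -> 0 <= i -> 0 <= u -> 0 <= eps -> 0 <= l -> 1 <= s -> 2 * i <= e ->
  eA - 2 * xA + c + eps * hA <= eS - 2 * xS + c + eps * hS ->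
  xA - xS = x1 - x2 -> hS - hA <= g2 * (s * l) ->
  g2 <= a + b + 2 * i -> g1 <= a + b ->
  x1 <= 4 * (3 * u) * s * g1 -> - (6 * u * i) <= x2 ->
  eA <= eS + s * (30 * u + eps * l) * (a + b + e).
Proof.
move=> a0 b0 i0 u0 eps0 l0 s1 ie hm E hent hg2 hg1 hx1 hx2.
have s0 : 0 <= s by lra.
have T0 : 0 <= s * (30 * u + eps * l).
  by rewrite mulr_ge0// addr_ge0 ?mulr_ge0.
have k1 : 4 * (3 * u) * s * g1 <= 12 * (u * s * (a + b)).
  have -> : 4 * (3 * u) * s * g1 = 12 * (u * s * g1) by ring.
  by rewrite ler_pM2l// ler_wpM2l// mulr_ge0.
have k2 : u * i <= u * s * i.
  by rewrite ler_wpM2r// -[leLHS]mulr1 ler_wpM2l.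
have k3 : eps * (hS - hA) <= eps * ((a + b + 2 * i) * (s * l)).
  rewrite ler_wpM2l//; apply: le_trans hent _.
  by rewrite ler_wpM2r// mulr_ge0.
have k4 : s * (30 * u + eps * l) * (a + b + 2 * i) <= s * (30 * u + eps * l) * (a + b + e).
  by rewrite ler_wpM2l// lerD2l.
apply: le_trans (_ : eS + s * (30 * u + eps * l) * (a + b + 2 * i) <= _); last by rewrite lerD2l.
have k5 : s * (30 * u + eps * l) * (a + b + 2 * i) =
  30 * (u * s * (a + b)) + 60 * (u * s * i) + eps * ((a + b + 2 * i) * (s * l)).
  by ring.
have k6 : 0 <= u * s * i by rewrite !mulr_ge0.
have k7 : 0 <= u * s * (a + b) by apply: mulr_ge0; [exact: mulr_ge0|exact: addr_ge0].
by rewrite k5; lra.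
Qed.

Lemma near_lower (R : realType) (a p e : R) :
  - (1 / 20 * a + e) <= p - a -> 19 / 20 * a - e <= p.
Proof. by move=> h; lra. Qed.

Lemma near_upper (R : realType) (b p e h : R) (n : nat) : (0 < n)%N ->
  3 / n%:R <= e -> h <= b + 2 * n%:R^-1 ->
  p - h <= 1 / 20 * h + e -> p <= 21 / 20 * b + 2 * e.
Proof.
by move=> n0 he hh hp; have : 0 <= n%:R^-1 :> R by []; lra.
Qed.

Section deterministic_oracle.
Context {R : realType} {m n : nat}.
Local Notation M := 'M[R[i]]_m.
Variables (x : 'I_n -> M) (z : 'I_n -> R) (rho rhohat S : M) (eps u e : R).
Hypotheses (hx : forall j, x j \is hermsymmx) (n0 : (0 < n)%N) (m0 : (0 < m)%N).
Hypotheses (drho : density rho) (dS : density S).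
Hypotheses (u0 : 0 <= u) (eps0 : 0 <= eps).
Hypothesis hargmin : argmin_risk x (fun j => response rho (x j) (z j)) eps rhohat.

Definition noise_mx : M := (n%:R^-1)%:C%C *: \sum_j (z j)%:C%C *: x j.
Let Xi := noise_mx.
Let pn (A : M) := Num.sqrt (empform x A A).

Hypothesis near : forall S1 S2, density S1 -> density S2 ->
  `|pn (S1 - S2) - hsnorm (S1 - S2)| <= 1 / 20 * hsnorm (S1 - S2) + e.
Hypothesis noise_le : forall w, `|ip (rk1 w) Xi| <= 3 * u * hsnorm (rk1 w).
Hypothesis e_ge : 3 / n%:R <= e.

Lemma noise_mx_herm : Xi \is hermsymmx.
Proof. by apply: hermZ; apply: herm_sum => j; apply: hermZ. Qed.

Lemma ip_noise_mx A : ip A Xi = n%:R^-1 * \sum_j z j * ip A (x j).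
Proof.
rewrite /Xi /noise_mx ipZr (form_sumr ip_psdform); congr (_ * _).
by apply: eq_bigr => j _; rewrite ipZr.
Qed.

Lemma Re_tr_ip A j : complex.Re (\tr (A *m x j)) = ip A (x j).
Proof. by rewrite /ip /mxinner -(hermsymmxP _ (hx j)). Qed.

(** Substituting Y_j = <rho, X_j> + xi_j and expanding the squares; the sum
    of the xi_j^2 is the same for all A. *)
Lemma penalized_riskE A :
  penalized_risk x (fun j => response rho (x j) (z j)) eps A =
  empform x (A - rho) (A - rho) - 2 * ip (A - rho) Xi
   + n%:R^-1 * \sum_j z j ^+ 2 + eps * neg_entropy A.
Proof.
rewrite /penalized_risk; congr (_ + _).
rewrite ip_noise_mx /empform mulrCA -mulrBr -mulrDr; congr (_ * _).
rewrite mulr_sumr -sumrB -big_split/=; apply: eq_bigr => j _.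
by rewrite /response !Re_tr_ip ipBl; ring.
Qed.

Let rS : R := (\rank S)%:R.
Let T := Num.sqrt rS * (30 * u + eps * ln (m%:R * n%:R)).
Let S' := smoothed S n.

Lemma rank_density_ge1 : 1 <= rS.
Proof.
rewrite ler1n lt0n mxrank_eq0; apply/negP => /eqP S0.
by case: dS => _ _; rewrite S0 mxtrace0 => /eqP; rewrite eq_sym oner_eq0.
Qed.

Lemma ip_density_noise_le A : density A -> `|ip A Xi| <= 3 * u.
Proof.
move=> dA; rewrite -(spectral_fun_id (density_herm dA)) ip_suml.
rewrite -[leRHS]mulr1 -[X in _ <= _ * X](specval_sum dA) mulr_sumr.
apply: le_trans (ler_norm_sum _ _ _) _; apply: ler_sum => k _.
rewrite ipZl normrM ger0_norm ?specval_ge0// mulrC ler_wpM2r ?specval_ge0//.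
apply: le_trans (noise_le _) _.
by rewrite hsnorm_rk1 specvec_ortho eqxx mulr1.
Qed.

Theorem deterministic_oracle :
  hsnorm (rhohat - rho) ^+ 2 <=
  2 * hsnorm (S - rho) ^+ 2 + 130 * e ^+ 2 + 19 * T ^+ 2.
Proof.
have [drh hmin] := hargmin.
have dS' : density S' := smoothed_density dS m0 n0.
have n1 : 1 <= n%:R :> R by rewrite ler1n.
have np : 0 < n%:R :> R by rewrite ltr0n.
have ni0 : 0 <= n%:R^-1 :> R by rewrite invr_ge0 ltW.
have ni1 : n%:R^-1 <= 1 :> R by rewrite invf_le1.
set a := hsnorm (rhohat - rho); set b := hsnorm (S - rho).
have a0 : 0 <= a := hsnorm_ge0 _; have b0 : 0 <= b := hsnorm_ge0 _.
have i2e : 2 * n%:R^-1 <= e.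
  by apply: le_trans e_ge; rewrite ler_wpM2r// ler_nat.
have e0 : 0 <= e by apply: le_trans e_ge; rewrite mulr_ge0.
have ln0 : 0 <= ln (m%:R * n%:R) :> R.
  by rewrite ln_ge0// -natrM ler1n muln_gt0 m0.
have T0 : 0 <= T by rewrite mulr_ge0 ?sqrtr_ge0// addr_ge0 ?mulr_ge0.
pose U : M := (m%:R^-1)%:C%C *: 1%:M.
have dU : density U := density_uniform m0.
have SS' : S' - S = (n%:R^-1)%:C%C *: (U - S).
  rewrite /S' smoothedE// subKr rmorphB rmorph1 scalerBl scale1r scalerBr -/U.
  by rewrite addrAC [S - _]addrC addrK addrC.
have dist : hsnorm (S' - S) <= 2 * n%:R^-1.
  rewrite SS' hsnorm_seminorm.2 ger0_norm// mulrC ler_wpM2r//.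
  exact: hsnormB_density.
have g1 : hsnorm (rhohat - S) <= a + b.
  have -> : rhohat - S = (rhohat - rho) - (S - rho) by rewrite opprB addrA subrK.
  exact: seminormB hsnorm_seminorm _ _.
have g2 : hsnorm (S' - rhohat) <= a + b + 2 * n%:R^-1.
  have -> : S' - rhohat = (S' - S) - (rhohat - S) by rewrite opprB addrA subrK.
  apply: le_trans (seminormB hsnorm_seminorm _ _) _.
  by rewrite addrC; apply: lerD.
have g3 : hsnorm (S' - rho) <= b + 2 * n%:R^-1.
  have -> : S' - rho = (S' - S) + (S - rho) by rewrite addrA subrK.
  apply: le_trans (hsnorm_seminorm.1 _ _) _.
  by rewrite addrC lerD2l.
have near1 := near drh drho; have near2 := near dS' drho.
rewrite -/a ler_norml in near1; rewrite ler_norml in near2.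
have /andP[near1l _] := near1; have /andP[_ near2r] := near2.
apply: (@solve_basic_inequality R a b e T (pn (rhohat - rho)) (pn (S' - rho))) => //.
- exact: sqrtr_ge0.
- exact: sqrtr_ge0.
- exact: near_lower near1l.
- exact: near_upper n0 e_ge g3 near2r.
have hmin' := hmin S' dS'; rewrite !penalized_riskE in hmin'.
have u3 : 0 <= 3 * u by rewrite mulr_ge0.
have hn1 := ip_noise_le_rank dS noise_mx_herm u3 noise_le drh.
have hn2 : `|ip (S' - S) Xi| <= 6 * u * n%:R^-1.
  rewrite SS' ipZl normrM ger0_norm// mulrC ler_wpM2r// ipBl.
  apply: le_trans (ler_normB _ _) _.
  apply: le_trans (lerD (ip_density_noise_le dU) (ip_density_noise_le dS)) _.
  by rewrite -mulrDl -natrD.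
rewrite !sqr_sqrtr ?(form_ge0 (empform_psdform x))//.
have r1 : 1 <= Num.sqrt rS by rewrite -[1]sqrtr1 ler_sqrt ?rank_density_ge1// ler0n.
have E : ip (rhohat - rho) Xi - ip (S' - rho) Xi = ip (rhohat - S) Xi - ip (S' - S) Xi.
  by rewrite -!ipBl; congr (ip _ _); rewrite !opprB !addrA !subrK.
apply: (basic_inequality a0 b0 ni0 u0 eps0 ln0 r1 i2e hmin' E (entropy_increment_le dS m0 n0 drh) g2 g1).
- exact: le_trans (ler_norm _) hn1.
- by move: hn2; rewrite ler_norml => /andP[].
Qed.
End deterministic_oracle.

(** * The favourable event *)

Definition noise_mgf_factor (R : realType) (b : R) : R := 1 + sqr_mgf_const b * sqr_exp_rate b / 2.

(** The exponent la de - B la^2 of sqr_deviation at relative precision de = 1/20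
    for la = min (th/2, 1/(40 B)), where B la <= de/2 leaves at least la/40. The bound by 1
    keeps the number N of averaged projections below n. *)
Definition design_rate (R : realType) (b : R) : R :=
  Num.min 1 (Num.min (sqr_exp_rate b / 2) (1 / 40 / sqr_mgf_const b) / 40).

Lemma sqr_mgf_const_gt0 (R : realType) (b : R) : 0 < b -> 0 < sqr_mgf_const b.
Proof.
by move=> b0; rewrite /sqr_mgf_const !mulr_gt0 ?invr_gt0 ?exprn_gt0 ?expR_gt0 ?sqr_exp_rate_gt0.
Qed.

Lemma design_rate_gt0 (R : realType) (b : R) : 0 < b -> 0 < design_rate b.
Proof.
move=> b0; rewrite /design_rate lt_min ltr01/= divr_gt0// lt_min.
by rewrite !divr_gt0// ?sqr_exp_rate_gt0 ?sqr_mgf_const_gt0.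
Qed.

Lemma noise_mgf_factor_ge1 (R : realType) (b : R) : 0 < b -> 1 <= noise_mgf_factor b.
Proof.
by move=> b0; rewrite lerDl divr_ge0// mulr_ge0// ltW ?sqr_mgf_const_gt0 ?sqr_exp_rate_gt0.
Qed.

Section events.
Context {R : realType} {m n : nat} (b0 s : R) (b0_gt0 : 0 < b0).
Context d (T : measurableType d) (P : probability T R)
  (Pi : probability (borelmx R m) R)
  (X : 'I_n -> {RV P >-> borelmx R m}) (xi : 'I_n -> {RV P >-> R}).
Hypothesis n0 : (0 < n)%N.
Hypothesis herm_ae : {ae Pi, forall x : borelmx R m, (x : 'M[R[i]]_m) \is hermsymmx}.
Hypothesis lawX : forall j, has_law (X j) Pi.
Hypothesis iso : isotropic_subgaussian b0 Pi.
Hypothesis noise : forall j la,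
  (\int[distribution P (xi j)]_z (expR (la * z))%:E <=
   (expR (la ^+ 2 * s ^+ 2 / 2))%:E)%E.
Hypothesis indep : mutually_independent X xi.

Lemma design_event (J : finType) (A : J -> 'M[R[i]]_m) :
  (forall i, A i \is hermsymmx) ->
  exists E : set T, [/\ measurable E,
    ((1 - #|J|%:R * (2 * expR (- (n%:R * design_rate b0))))%:E <= P E)%E &
    forall w, E w -> forall i, near_isometry (fun j => X j w) (1 / 20) (A i)].
Proof.
move=> hA.
pose la := Num.min (sqr_exp_rate b0 / 2) (1 / 40 / sqr_mgf_const b0).
have B0 := sqr_mgf_const_gt0 b0_gt0; have th0 := sqr_exp_rate_gt0 b0_gt0.
have la0 : 0 < la by rewrite lt_min !divr_gt0.
have la1 : la <= sqr_exp_rate b0 / 2 by rewrite ge_min lexx.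
have la2 : la <= 1 / 40 / sqr_mgf_const b0 by rewrite ge_min lexx orbT.
pose bad i := [set w | 1 / 20 * (n%:R * hsnorm (A i) ^+ 2) <
  `|\sum_(j < n) ip (A i) (X j w) ^+ 2 - n%:R * hsnorm (A i) ^+ 2| ].
have mbad i : measurable (bad i) by exact: measurable_sqr_deviation.
have pbad i : (P (bad i) <= (2 * expR (- (n%:R * design_rate b0)))%:E)%E.
  apply: le_trans (sqr_deviation b0_gt0 herm_ae lawX iso indep (1 / 20) (hA i) (ltW la0) la1) _.
  rewrite lee_fin ler_pM2l// ler_expR lerN2 ler_wpM2l//.
  apply: (@le_trans _ _ (la / 40)); first by rewrite ge_min lexx orbT.
  have : sqr_mgf_const b0 * la <= 1 / 40 by rewrite mulrC -ler_pdivlMr.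
  move=> h; have := ler_wpM2l (ltW la0) h; lra.
have [mE pE] := union_bound mbad pbad.
exists (\bigcap_i ~` bad i); split=> // w Ew i.
have {Ew}/= := Ew i I; rewrite /bad/= => /negP; rewrite -leNgt /near_isometry.
have np : 0 < n%:R :> R by rewrite ltr0n.
have -> : \sum_(j < n) ip (A i) (X j w) ^+ 2 =
    n%:R * empform (fun j => X j w : 'M[R[i]]_m) (A i) (A i).
  by rewrite /empform mulVKf ?gt_eqF//; apply: eq_bigr => j _; rewrite expr2.
rewrite -mulrBr normrM (ger0_norm (ltW np)) mulrCA ler_pM2l//.
Qed.

(** In noise_deviation, la = u / (K s^2) with K the mgf factor: since
    la^2 s^2 <= th, the quartic term of the exponent is at most K - 1 times the quadratic
    one, and the exponent is that of a Gaussian of variance K s^2. *)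
Lemma noise_event (J : finType) (A : J -> 'M[R[i]]_m) (u : R) :
  0 < s -> 0 <= u -> u ^+ 2 <= sqr_exp_rate b0 * noise_mgf_factor b0 ^+ 2 * s ^+ 2 ->
  (forall i, A i \is hermsymmx) ->
  exists E : set T, [/\ measurable E,
    ((1 - #|J|%:R * (2 * expR (- (n%:R * (u ^+ 2 / (2 * noise_mgf_factor b0 * s ^+ 2))))))%:E
       <= P E)%E &
    forall w, E w -> forall i,
      `|ip (A i) (noise_mx (fun j => X j w) (fun j => xi j w))| <= u * hsnorm (A i)].
Proof.
move=> s0 u0 hu hA; set K := noise_mgf_factor b0 in hu *.
have K1 : 1 <= K := noise_mgf_factor_ge1 b0_gt0.
have B0 := sqr_mgf_const_gt0 b0_gt0; have th0 := sqr_exp_rate_gt0 b0_gt0.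
have Kp : 0 < K by apply: lt_le_trans K1.
pose la := u / (K * s ^+ 2).
have la0 : 0 <= la by rewrite divr_ge0// mulr_ge0 ?sqr_ge0 ?ltW.
have laE : la ^+ 2 * s ^+ 2 / 2 = u ^+ 2 / (2 * K ^+ 2 * s ^+ 2).
  by rewrite /la; field; rewrite !gt_eqF.
have la1 : la ^+ 2 * s ^+ 2 / 2 <= sqr_exp_rate b0 / 2.
  rewrite laE ler_pdivrMr ?mulr_gt0 ?exprn_gt0//.
  by apply: le_trans hu _; lra.
pose bad i := [set w | u * (n%:R * hsnorm (A i)) <
  `|\sum_(j < n) xi j w * ip (A i) (X j w)| ].
have mbad i : measurable (bad i) by exact: measurable_noise_deviation.
have pbad i : (P (bad i) <= (2 * expR (- (n%:R * (u ^+ 2 / (2 * K * s ^+ 2)))))%:E)%E.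
  apply: le_trans (noise_deviation b0_gt0 herm_ae lawX iso noise indep u (hA i) la0 la1) _.
  rewrite lee_fin ler_pM2l// ler_expR lerN2 ler_wpM2l//.
  set a := la ^+ 2 * s ^+ 2 / 2 in la1 laE *.
  have a0 : 0 <= a by rewrite divr_ge0// mulr_ge0 ?sqr_ge0.
  have h : a + sqr_mgf_const b0 * a ^+ 2 <= a * K.
    have -> : a * K = a + sqr_mgf_const b0 * a * (sqr_exp_rate b0 / 2) by rewrite /K /noise_mgf_factor; ring.
    by rewrite lerD2l expr2 mulrA ler_wpM2l// mulr_ge0// ltW.
  have -> : u ^+ 2 / (2 * K * s ^+ 2) = la * u - a * K.
    by rewrite laE /la; field; rewrite !gt_eqF.
  by rewrite lerD2l lerN2.
have [mE pE] := union_bound mbad pbad.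
exists (\bigcap_i ~` bad i); split=> // w Ew i.
have {Ew}/= := Ew i I; rewrite /bad/= => /negP; rewrite -leNgt.
have np : 0 < n%:R :> R by rewrite ltr0n.
have ni : 0 <= n%:R^-1 :> R by rewrite invr_ge0.
rewrite ip_noise_mx normrM (ger0_norm ni) ler_pdivrMl//.
by rewrite mulrCA.
Qed.

End events.

Section numeric.
Context {R : realType}.

Lemma ln2_ge_half : 1 / 2 <= ln (2 : R).
Proof.
rewrite -ler_expR lnK ?posrE//.
have h := expR_ge1Dx (- (1 / 2) : R); rewrite expRN in h.
have e0 := expR_gt0 (1 / 2 : R).
have h2 : 1 / 2 <= (expR (1 / 2))^-1 :> R by lra.
by rewrite -[X in _ <= X]mul1r ler_pdivlMr// in h2; lra.
Qed.

Lemma expRN4 : expR (- 4) <= 1 / 16 :> R.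
Proof.
have -> : - 4 = 4%:R * - 1 :> R by rewrite mulrN1.
rewrite expRM_natl expRN exprVn mul1r lef_pV2 ?posrE ?exprn_gt0 ?expR_gt0//.
have h : 2 <= expR 1 :> R by have := expR_ge1Dx (1 : R); lra.
have -> : 16 = 2 ^+ 4 :> R by rewrite -natrX.
by rewrite lerXn2r ?nnegrE ?expR_ge0.
Qed.

Lemma natrX_expR (n k : nat) : (0 < n)%N -> (n ^ k)%:R = expR (k%:R * ln n%:R) :> R.
Proof. by move=> n0; rewrite expRM_natl lnK ?posrE ?ltr0n// natrX. Qed.

Lemma design_union_le (card n ka l t : R) :
  card <= 4 * expR l -> l <= n * ka / 2 -> t + 4 <= n * ka / 2 ->
  card * (2 * expR (- (n * ka))) <= expR (- t) / 2.
Proof.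
move=> h1 h2 h3.
apply: (@le_trans _ _ (4 * expR l * (2 * expR (- (n * ka))))).
  by rewrite ler_wpM2r// mulr_ge0// expR_ge0.
have -> : 4 * expR l * (2 * expR (- (n * ka))) = 8 * (expR l * expR (- (n * ka))) by ring.
rewrite -expRD.
have h4 : expR (l - n * ka) <= expR (- t) * expR (- 4).
  by rewrite -expRD ler_expR; lra.
have h5 := ler_wpM2l (expR_ge0 (- t)) expRN4; lra.
Qed.

Lemma noise_union_le (card l t : R) :
  card <= 3 * expR l -> card * (2 * expR (- (l + t + 4))) <= expR (- t) / 2.
Proof.
move=> h1.
apply: (@le_trans _ _ (3 * expR l * (2 * expR (- (l + t + 4))))).
  by rewrite ler_wpM2r// mulr_ge0// expR_ge0.
have -> : 3 * expR l * (2 * expR (- (l + t + 4))) = 6 * (expR l * expR (- (l + t + 4))) by ring.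
rewrite -expRD.
have -> : l - (l + t + 4) = - t + - 4 by ring.
rewrite expRD.
apply: le_trans (ler_wpM2l (ler0n R 6) (ler_wpM2l (expR_ge0 (- t)) expRN4)) _.
by have := expR_ge0 (- t); lra.
Qed.
End numeric.

Section cardinals.
Variables (m n : nat).
Hypotheses (n2 : (2 <= n)%N) (m0 : (0 < m)%N) (mn : (m <= n)%N).

(** A mesh fine enough for rounding errors to be at most 1/n after the
    loss of m^2 in seminorm_le_entries, and coarse enough for the grid to have n^O(m)
    points. *)
Definition mesh_size : nat := (12 * m ^ 2 * n)%N.

Lemma mesh_size_gt0 : (0 < mesh_size)%N.
Proof. by rewrite /mesh_size !muln_gt0 !m0/= (leq_trans _ n2). Qed.

Lemma card_grid_le : (#|gridT m mesh_size| <= n ^ (16 * m))%N.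
Proof.
have -> : (16 * m = 8 * (2 * m))%N by rewrite mulnA.
rewrite card_gridT [leqRHS]expnM leq_exp2r; last by rewrite muln_gt0.
have n1 : (0 < n)%N by exact: leq_trans n2.
have h1 : (m ^ 2 * n <= n ^ 3)%N by rewrite [leqRHS]expnSr leq_mul// leq_exp2r.
have h2 : (1 <= n ^ 3)%N by rewrite expn_gt0 n1.
(* A coordinate has (24 m^2 n + 1)^2 grid points, and 24 m^2 n + 1 <= 25 n^3 <= 32 n^3 <= n^8. *)
have h3 : (32 * n ^ 3 <= n ^ 8)%N.
  rewrite (_ : 8 = 5 + 3)%N// expnD leq_mul2r; apply/orP; right.
  by rewrite (_ : 32 = 2 ^ 5)%N// leq_exp2r.
apply: leq_trans h3; rewrite /mesh_size -mulnA.
move: h1 h2; move: (m ^ 2 * n)%N (n ^ 3)%N => a b; lia.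
Qed.

Lemma card_pairs_le : (#|{: 'I_m * 'I_m * bool}| <= 2 * n ^ (16 * m))%N.
Proof.
rewrite !card_prod !card_ord card_bool mulnC leq_mul2l/=.
apply: (@leq_trans (n ^ 2)); first by rewrite -mulnn leq_mul.
by rewrite leq_pexp2l ?(leq_trans _ n2)//; case: (m) m0 => // k _; lia.
Qed.

End cardinals.

Lemma probability_setI_ge d (T : measurableType d) (R : realType)
    (P : probability T R) (E F : set T) (p q : R) :
  measurable E -> measurable F ->
  ((1 - p)%:E <= P E)%E -> ((1 - q)%:E <= P F)%E -> ((1 - (p + q))%:E <= P (E `&` F))%E.
Proof.
move=> mE mF hE hF.
have mC : measurable (~` E `|` ~` F) by apply: measurableU; exact: measurableC.
have -> : E `&` F = ~` (~` E `|` ~` F) by rewrite setCU !setCK.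
rewrite probability_setC// EFinB leeB// EFinD.
apply: le_trans (measureU2 _ (measurableC mE) (measurableC mF)) _.
have c (A : set T) (r : R) : measurable A -> ((1 - r)%:E <= P A)%E -> (P (~` A) <= r%:E)%E.
  move=> mA; rewrite probability_setC//.
  have : (P A \is a fin_num) by exact: fin_num_measure.
  case: (P A) => // x _; rewrite lee_fin -EFinB lee_fin; lra.
by apply: leeD; exact: c.
Qed.

Section favourable_event.
Context {R : realType} {m n : nat} (b0 s t u : R) (b0_gt0 : 0 < b0) (N : nat).
Context d (T : measurableType d) (P : probability T R)
  (Pi : probability (borelmx R m) R)
  (X : 'I_n -> {RV P >-> borelmx R m}) (xi : 'I_n -> {RV P >-> R}).
Hypotheses (n2 : (2 <= n)%N) (m0 : (0 < m)%N) (mn : (m <= n)%N).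
Hypothesis herm_ae : {ae Pi, forall x : borelmx R m, (x : 'M[R[i]]_m) \is hermsymmx}.
Hypothesis lawX : forall j, has_law (X j) Pi.
Hypothesis iso : isotropic_subgaussian b0 Pi.
Hypothesis noise : forall j la,
  (\int[distribution P (xi j)]_z (expR (la * z))%:E <=
   (expR (la ^+ 2 * s ^+ 2 / 2))%:E)%E.
Hypothesis indep : mutually_independent X xi.
Hypotheses (s0 : 0 < s) (u0 : 0 <= u) (N0 : (0 < N)%N) (Nn : (N <= n)%N).

Let l : R := 16 * m%:R * ln n%:R.
Hypothesis Nl : 32 * m%:R * N%:R * ln n%:R <= n%:R * design_rate b0 / 2.
Hypothesis tn : t + 4 <= n%:R * design_rate b0 / 2.
Hypothesis uE : u ^+ 2 = 2 * noise_mgf_factor b0 * s ^+ 2 * ((l + t + 4) / n%:R).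
Hypothesis u_small : u ^+ 2 <= sqr_exp_rate b0 * noise_mgf_factor b0 ^+ 2 * s ^+ 2.

Let G := mesh_size m n.
Let n1 : (0 < n)%N. Proof. exact: leq_trans n2. Qed.

Let unit_mx (k : 'I_m * 'I_m * bool) : 'M[R[i]]_m :=
  if k.2 then symunit k.1.1 k.1.2 else skewunit k.1.1 k.1.2.

Let probes (j : gridT m G + 'I_m * 'I_m * bool) : 'M[R[i]]_m :=
  match j with inl g => rk1 (gridvec R g) | inr k => unit_mx k end.

Let sums_and_probes (j : (gridT m G + 'I_m * 'I_m * bool) +
    {ffun 'I_N -> gridT m G} * {ffun 'I_N -> gridT m G}) : 'M[R[i]]_m :=
  match j with inl i => probes i | inr fh => grid_sum fh.1 fh.2 end.

Let probes_herm j : probes j \is hermsymmx.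
Proof.
case: j => [g|k]; first exact: rk1_herm.
by rewrite /= /unit_mx; case: ifP => _; [exact: symunit_herm|exact: skewunit_herm].
Qed.

Let sums_and_probes_herm j : sums_and_probes j \is hermsymmx.
Proof.
case: j => [i|fh]; first exact: probes_herm.
by apply: herm_sum => k; apply: hermB; exact: rk1_herm.
Qed.

Let card_probes_nat : (#|{: gridT m G + 'I_m * 'I_m * bool}| <= 3 * n ^ (16 * m))%N.
Proof.
rewrite card_sum.
apply: leq_trans (leq_add (card_grid_le n2 m0 mn) (card_pairs_le n2 m0 mn)) _.
by rewrite -[X in (X + _)%N]mul1n -mulnDl.
Qed.

Let card_probes : (#|{: gridT m G + 'I_m * 'I_m * bool}|%:R <= 3 * expR l :> R).
Proof.
have -> : l = (16 * m)%:R * ln n%:R by rewrite natrM.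
by rewrite -natrX_expR// -natrM ler_nat.
Qed.

Let card_sums_and_probes : (#|{: (gridT m G + 'I_m * 'I_m * bool) +
    {ffun 'I_N -> gridT m G} * {ffun 'I_N -> gridT m G}}|%:R
    <= 4 * expR (32 * m%:R * N%:R * ln n%:R) :> R).
Proof.
have -> : 32 * m%:R * N%:R * ln n%:R = (32 * m * N)%:R * ln n%:R :> R by rewrite !natrM.
rewrite -natrX_expR// -natrM ler_nat card_sum.
have h : (n ^ (16 * m) <= n ^ (32 * m * N))%N.
  rewrite leq_pexp2l//; apply: (@leq_trans (32 * m)); first by rewrite leq_mul2r orbT.
  by rewrite leq_pmulr.
apply: (@leq_trans (3 * n ^ (16 * m) + n ^ (32 * m * N))); last first.
  move: h; move: (n ^ (16 * m))%N (n ^ (32 * m * N))%N => a b; lia.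
apply: leq_add card_probes_nat _.
rewrite card_prod card_ffun card_ord -expnD addnn -mul2n.
apply: (@leq_trans ((n ^ (16 * m)) ^ (2 * N))).
  by rewrite leq_exp2r ?card_grid_le// muln_gt0.
by rewrite -expnM mulnA [(16 * m * 2)%N]mulnAC.
Qed.

(** The union bound over the sums of N differences, at most n^(32 m N) matrices, is paid
    by exp(- n design_rate) thanks to the choice of N; the one over single grid matrices,
    at most n^(16 m) of them, is paid by the choice of u. *)
Lemma favourable_event : exists E : set T, [/\ measurable E,
  ((1 - expR (- t))%:E <= P E)%E &
  forall w, E w ->
   (forall S1 S2 : 'M[R[i]]_m, density S1 -> density S2 ->
     `|Num.sqrt (empform (fun j => X j w : 'M[R[i]]_m) (S1 - S2) (S1 - S2)) - hsnorm (S1 - S2)|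
       <= 1 / 20 * hsnorm (S1 - S2) + 36 / Num.sqrt N%:R) /\
   (forall v, `|ip (rk1 v) (noise_mx (fun j => X j w) (fun j => xi j w))|
       <= 3 * u * hsnorm (rk1 v))].
Proof.
have [E1 [mE1 pE1 hE1]] := design_event b0_gt0 n1 herm_ae lawX iso indep sums_and_probes_herm.
have [E2 [mE2 pE2 hE2]] :=
  noise_event b0_gt0 n1 herm_ae lawX iso noise indep s0 u0 u_small probes_herm.
exists (E1 `&` E2); split; first exact: measurableI.
  apply: le_trans (probability_setI_ge mE1 mE2 pE1 pE2).
  rewrite lee_fin lerD2l lerN2.
  have a1 := design_union_le card_sums_and_probes Nl tn.
  have a2 := noise_union_le t card_probes.
  have K0 : 0 < noise_mgf_factor b0 by apply: lt_le_trans (noise_mgf_factor_ge1 b0_gt0).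
  have np : 0 < n%:R :> R by rewrite ltr0n.
  have -> : n%:R * (u ^+ 2 / (2 * noise_mgf_factor b0 * s ^+ 2)) = l + t + 4.
    by rewrite uE; field; rewrite !gt_eqF.
  apply: le_trans (lerD a1 a2) _.
  by rewrite -mulrDl; lra.
move=> w [/hE1 {}hE1 /hE2 {}hE2]; split=> [S1 S2 d1 d2|v].
  apply: (@uniform_near_isometry R m n (fun j => X j w : 'M[R[i]]_m) G N (1 / 20)) => //.
  - exact: mesh_size_gt0.
  - by lra.
  - by move=> k l'; exact: (hE1 (inl (inr (k, l', true)))).
  - by move=> k l'; exact: (hE1 (inl (inr (k, l', false)))).
  - by move=> g; exact: (hE1 (inl (inl g))).
  - by move=> f h; exact: (hE1 (inr (f, h))).
apply: (@noise_quadratic_form_le R m n _ u G) => //.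
- exact: mesh_size_gt0.
- by move=> k l'; exact: (hE2 (inr (k, l', true))).
- by move=> k l'; exact: (hE2 (inr (k, l', false))).
- by move=> g; exact: (hE2 (inl g)).
Qed.
End favourable_event.

(** * Rates and the oracle inequality *)

Section rates.
Context {R : realType} (m n : nat) (t : R).
Hypotheses (m0 : (0 < m)%N) (t0 : 0 < t).

Let m1 : 1 <= m%:R :> R. Proof. by rewrite ler1n. Qed.

Lemma t_m_ge : t + 1 / 2 <= t_m m t.
Proof.
rewrite lerD2l; apply: le_trans ln2_ge_half _.
by rewrite ler_ln ?posrE ?mulr_gt0 ?ltr0n// ler_peMr.
Qed.

Definition remainder : R :=
  m%:R * Num.max (tau_n n t * ln n%:R) (t_m m t) / n%:R.

Lemma t_le_remainder : (0 < n)%N -> t + 1 / 2 <= n%:R * remainder.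
Proof.
move=> n0; have np : n%:R != 0 :> R by rewrite pnatr_eq0 -lt0n.
rewrite /remainder [leRHS]mulrC divfK//; apply: le_trans t_m_ge _.
have h : t_m m t <= Num.max (tau_n n t * ln n%:R) (t_m m t) by rewrite le_max lexx orbT.
apply: le_trans (h) _; rewrite ler_peMl//; apply: le_trans (h).
by apply: le_trans t_m_ge; rewrite addr_ge0// ltW.
Qed.

Lemma ln_ge_half : (2 <= n)%N -> 1 / 2 <= ln n%:R :> R.
Proof.
move=> n2; apply: le_trans ln2_ge_half _.
by rewrite ler_ln ?posrE ?ler_nat// ltr0n (leq_trans _ n2).
Qed.

Lemma tau_n_ge_half : (2 <= n)%N -> 1 / 2 <= tau_n n t.
Proof.
move=> n2; have n0 : 0 < n%:R :> R by rewrite ltr0n (leq_trans _ n2).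
have l2 : 0 < ln 2 :> R by apply: lt_le_trans ln2_ge_half.
(* The binary logarithm of 2 n >= 4. *)
have h : 2 <= ln (2 * n%:R) / ln 2 :> R.
  rewrite ler_pdivlMr// lnM ?posrE//.
  have : ln 2 <= ln n%:R :> R by rewrite ler_ln ?posrE ?ler_nat.
  by move=> h; rewrite mulr_natl mulr2n lerD2l.
rewrite /tau_n -[leLHS]add0r; apply: lerD; first exact: ltW.
apply: le_trans ln2_ge_half _; rewrite ler_ln ?posrE//.
by apply: lt_le_trans h.
Qed.

Lemma mln_le_remainder : (2 <= n)%N -> m%:R * ln n%:R <= 2 * (n%:R * remainder).
Proof.
move=> n2; have n0 : (0 < n)%N by exact: leq_trans n2.
have np : n%:R != 0 :> R by rewrite pnatr_eq0 -lt0n.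
have -> : n%:R * remainder = m%:R * Num.max (tau_n n t * ln n%:R) (t_m m t).
  by rewrite /remainder [LHS]mulrC divfK.
rewrite mulrCA ler_wpM2l ?ler0n//.
have h : tau_n n t * ln n%:R <= Num.max (tau_n n t * ln n%:R) (t_m m t) by rewrite le_max lexx.
have l0 : 0 <= ln n%:R :> R by apply: le_trans (ln_ge_half n2); rewrite divr_ge0.
have := ler_wpM2r l0 (tau_n_ge_half n2); lra.
Qed.

Lemma mln_t_le_variance : (2 <= n)%N ->
  m%:R * ln n%:R + t <= 8 * (m%:R * t_m m t * ln (m%:R * n%:R) ^+ 2).
Proof.
move=> n2; have n0 : (0 < n)%N by exact: leq_trans n2.
set l := ln (m%:R * n%:R).
have hl : ln n%:R <= l.
  by rewrite ler_ln ?posrE ?mulr_gt0 ?ltr0n// ler_peMl.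
have l1 := le_trans (ln_ge_half n2) hl.
have t1 := t_m_ge; set tm := t_m m t in t1 *.
have l2 : 1 / 2 * l <= l ^+ 2.
  by rewrite expr2; apply: ler_wpM2r; lra.
have l3 : 1 / 4 <= l ^+ 2 by lra.
have l20 : 0 <= l ^+ 2 by rewrite sqr_ge0.
have k1 : 1 / 2 * l ^+ 2 <= tm * l ^+ 2 by apply: ler_wpM2r => //; have := t0; lra.
have k2 : tm * (1 / 4) <= tm * l ^+ 2 by apply: ler_wpM2l => //; have := t0; lra.
have mp : 0 <= m%:R :> R by [].
have k3 : m%:R * ln n%:R <= m%:R * (4 * (tm * l ^+ 2)) by apply: ler_wpM2l => //; lra.
have k4 : t <= m%:R * (4 * (tm * l ^+ 2)).
  apply: (@le_trans _ _ (4 * (tm * l ^+ 2))); first by lra.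
  by rewrite ler_peMl//; lra.
rewrite -mulrA; lra.
Qed.
End rates.

Lemma collect_remainders (R : realType) (a2 b2 e2 T2 V W pe pT D2 ml : R) :
  0 <= pe -> 0 <= pT -> 0 <= D2 -> 0 <= V -> 0 <= W ->
  a2 <= 2 * b2 + 130 * e2 + 19 * T2 ->
  e2 <= pe * ml -> ml <= 2 * W ->
  T2 <= pT * (8 * V + 3 * W) + 2 * D2 * V ->
  forall C, 260 * pe + 209 * pT + 38 * D2 <= C ->
  a2 <= 2 * b2 + C * Num.max V W.
Proof.
move=> pe0 pT0 D20 V0 W0 h1 h2 h3 h4 C hC.
set Mx := Num.max V W.
have hV : V <= Mx by rewrite le_max lexx.
have hW : W <= Mx by rewrite le_max lexx orbT.
have M0 : 0 <= Mx by apply: le_trans hV.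
apply: le_trans (_ : 2 * b2 + (260 * pe + 209 * pT + 38 * D2) * Mx <= _); last first.
  by rewrite lerD2l ler_wpM2r.
have k1 : pe * ml <= pe * (2 * Mx) by rewrite ler_wpM2l//; lra.
have k2 : pT * (8 * V + 3 * W) <= pT * (11 * Mx) by rewrite ler_wpM2l//; lra.
have k3 : D2 * V <= D2 * Mx by rewrite ler_wpM2l.
lra.
Qed.

(** The squared price of the two linear terms in the units of the
    final maximum of V and W. Since s^2 <= 2 sigma^2 + 2/m^2 and r <= m, the part of r s^2 that
    does not come from sigma is at most 2 and goes into W. *)
Lemma entropy_noise_sqr_le (R : realType) (r u eps l s2 sg2 K q V W m n tm D : R) :
  0 <= r -> r <= m -> 1 <= m -> 0 < n -> 0 <= K -> 0 <= sg2 -> 0 <= q ->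
  s2 <= 2 * sg2 + 2 * (m^-1) ^+ 2 ->
  u ^+ 2 <= 48 * K * s2 * (q / n) ->
  q <= 8 * (m * tm * l ^+ 2) -> q <= 3 * (n * W) ->
  V = sg2 * r * m * tm * l ^+ 2 / n ->
  eps ^+ 2 = D ^+ 2 * sg2 * (m * tm / n) ->
  r * (30 * u + eps * l) ^+ 2 <= 1800 * 96 * K * (8 * V + 3 * W) + 2 * D ^+ 2 * V.
Proof.
move=> r0 rm m1 n0 K0 sg0 q0 hs hu hq1 hq2 VE eE.
have qn0 : 0 <= q / n by rewrite divr_ge0// ltW.
have a1 : (30 * u + eps * l) ^+ 2 <= 1800 * u ^+ 2 + 2 * (eps * l) ^+ 2.
  by have := sqr_ge0 (30 * u - eps * l); lra.
have a2 : r * (eps * l) ^+ 2 = D ^+ 2 * V by rewrite VE exprMn eE; ring.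
have mi : m^-1 <= 1 by rewrite invf_le1// (lt_le_trans _ m1).
have mp : 0 < m by apply: lt_le_trans m1.
have a3 : r * (m^-1) ^+ 2 <= 1.
  apply: (@le_trans _ _ (m * (m^-1) ^+ 2)); first by rewrite ler_wpM2r// sqr_ge0.
  by rewrite expr2 mulrA divff ?gt_eqF// mul1r.
have a4 : r * s2 <= 2 * (sg2 * r) + 2.
  by have := ler_wpM2l r0 hs; lra.
have a5 : (q / n) <= 3 * W by rewrite ler_pdivrMr// -mulrA [W * n]mulrC.
have a6 : sg2 * r * (q / n) <= 8 * V.
  have -> : 8 * V = sg2 * r * (8 * (m * tm * l ^+ 2) / n) by rewrite VE; ring.
  by rewrite ler_wpM2l ?mulr_ge0// ler_pM2r ?invr_gt0.
have a7 : r * s2 * (q / n) <= 2 * (8 * V + 3 * W).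
  by have := ler_wpM2r qn0 a4; lra.
have a8 : r * u ^+ 2 <= 48 * K * (2 * (8 * V + 3 * W)).
  apply: le_trans (ler_wpM2l r0 hu) _.
  have -> : r * (48 * K * s2 * (q / n)) = 48 * K * (r * s2 * (q / n)) by ring.
  by rewrite ler_wpM2l// mulr_ge0.
apply: le_trans (ler_wpM2l r0 a1) _.
rewrite mulrDr.
have -> : r * (2 * (eps * l) ^+ 2) = 2 * D ^+ 2 * V by rewrite mulrCA a2 mulrA.
by rewrite lerD2r; lra.
Qed.

(** The largest N allowed by the union bound is the integer part of
    y = k n / (64 q); as y >= 1, it is at least y/2, which gives the constant
    36^2 * 128 = 1296 * 128. *)
Lemma sample_split (R : realType) (k q : R) (n : nat) :
  0 < k -> k <= 1 -> 1 / 2 <= q -> 64 * q <= k * n%:R ->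
  exists N : nat, [/\ (0 < N)%N, (N <= n)%N, 64 * q * N%:R <= k * n%:R,
    (36 / Num.sqrt N%:R) ^+ 2 <= 128 * 1296 / k * (q / n%:R) &
    3 / n%:R <= 36 / Num.sqrt N%:R :> R].
Proof.
move=> k0 k1 q1 hq.
have q0 : 0 < q by lra.
have n0 : 0 < n%:R :> R by rewrite -(pmulr_rgt0 _ k0); lra.
pose y := k * n%:R / (64 * q); pose N := Num.truncn y.
have y1 : 1 <= y by rewrite ler_pdivlMr ?mul1r// mulr_gt0.
have y0 : 0 <= y by lra.
have [Ny yN] : N%:R <= y /\ y < N.+1%:R.
  by have /andP[] := truncn_itv y0.
have N0 : (0 < N)%N by rewrite truncn_gt0.
have N1 : 1 <= N%:R :> R by rewrite ler1n.
have hN : 64 * q * N%:R <= k * n%:R.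
  by move: Ny; rewrite ler_pdivlMr 1?mulrC// mulr_gt0.
have Nn : N%:R <= n%:R :> R.
  apply: le_trans Ny _; rewrite ler_pdivrMr ?mulr_gt0//.
  rewrite mulrC ler_pM2l//; lra.
exists N; split=> //.
- by rewrite -(ler_nat R).
- rewrite expr_div_n sqr_sqrtr// ler_pdivrMr; last by lra.
  have h : k * n%:R <= 128 * q * N%:R.
    have : y <= 2 * N%:R by move: yN; rewrite -natr1; lra.
    rewrite ler_pdivrMr ?mulr_gt0//; lra.
  rewrite (_ : _ * N%:R = (128 * 1296) * (q * N%:R) / (k * n%:R)); last first.
    by field; rewrite !gt_eqF.
  by rewrite ler_pdivlMr ?mulr_gt0//; lra.
apply: (@le_trans _ _ (36 / n%:R)); first by rewrite ler_pM2r ?invr_gt0//; lra.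
have sN : 1 <= Num.sqrt N%:R :> R by rewrite -[leLHS]sqrtr1 ler_wsqrtr.
rewrite ler_pM2l// lef_pV2 ?posrE//; last by lra.
apply: le_trans Nn; rewrite -[leRHS]sqr_sqrtr// expr2.
by rewrite ler_peMl//; lra.
Qed.

(** Above this multiple of m ln n + t, the sample size satisfies all
    the conditions of favourable_event for a suitable N; the last summand ensures m <= n. *)
Definition sample_ratio (R : realType) (b : R) : R :=
  64 / design_rate b + 48 / sqr_exp_rate b + 2.

(** The factor of q / n in sample_split. *)
Definition mesh_const (R : realType) (b : R) : R := 128 * 1296 / design_rate b.
(** The factor in entropy_noise_sqr_le: u^2 <= 48 K s^2 q / n, multiplied by
    2 * 30^2 from the square of a sum and by 2 from s^2. *)
Definition noise_const (R : realType) (b : R) : R := 1800 * 96 * noise_mgf_factor b.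

Lemma mesh_const_ge0 (R : realType) (b : R) : 0 < b -> 0 <= mesh_const b.
Proof.
move=> b0; apply: mulr_ge0; last by rewrite invr_ge0 ltW// design_rate_gt0.
by apply: mulr_ge0; exact: ler0n.
Qed.

Lemma noise_const_ge0 (R : realType) (b : R) : 0 < b -> 0 <= noise_const b.
Proof.
move=> b0; apply: mulr_ge0; first by apply: mulr_ge0; exact: ler0n.
exact: le_trans ler01 (noise_mgf_factor_ge1 b0).
Qed.

Definition oracle_const (R : realType) (b D : R) : R :=
  260 * mesh_const b + 209 * noise_const b + 38 * D ^+ 2.

Lemma oracle_const_ge0 (R : realType) (b D : R) : 0 < b -> 0 <= oracle_const b D.
Proof.
move=> b0; have := sqr_ge0 D; have := mesh_const_ge0 b0.
by have := noise_const_ge0 b0; rewrite /oracle_const; lra.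
Qed.

Lemma L2sqE (R : realType) m (b : R) (Pi : probability (borelmx R m) R) A :
  isotropic_subgaussian b Pi -> fine (L2sq Pi A) = hsnorm A ^+ 2.
Proof. by move=> [_ ->]. Qed.

Lemma large_sample_bounds (R : realType) (b m l t n : R) : 0 < b ->
  1 <= m -> 1 / 2 <= l -> 0 < t -> 0 < n ->
  sample_ratio b * (m * l + t) <= n ->
  [/\ m <= n, 64 * (m * l) <= design_rate b * n, t + 4 <= n * design_rate b / 2 &
      48 * ((m * l + t) / n) <= sqr_exp_rate b].
Proof.
move=> b0 m1 l2 t0 n0; set k := design_rate b; set th := sqr_exp_rate b; set q := m * l.
have k0 : 0 < k by exact: design_rate_gt0.
have th0 : 0 < th by exact: sqr_exp_rate_gt0.
rewrite /sample_ratio -/k -/th => h.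
have q2 : m * (1 / 2) <= q by rewrite ler_wpM2l//; lra.
have k1 : 0 <= 64 / k * (q + t) by rewrite mulr_ge0//; [rewrite divr_ge0// ltW|lra].
have k2 : 0 <= 48 / th * (q + t) by rewrite mulr_ge0//; [rewrite divr_ge0// ltW|lra].
have h1 : 64 / k * (q + t) <= n by lra.
have h2 : 48 / th * (q + t) <= n by lra.
have e1 : 64 * (q + t) <= k * n.
  by move: h1; rewrite mulrAC ler_pdivrMr// [n * k]mulrC.
have e2 : 48 * (q + t) <= th * n.
  by move: h2; rewrite mulrAC ler_pdivrMr// [n * th]mulrC.
split; [lra|lra|rewrite [n * k]mulrC; lra|].
by rewrite mulrA ler_pdivrMr.
Qed.

Section large_sample.
Context {R : realType} {m n : nat} (b0 t sigma D : R) (b0_gt0 : 0 < b0).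
Context d (T : measurableType d) (P : probability T R)
  (Pi : probability (borelmx R m) R)
  (X : 'I_n -> {RV P >-> borelmx R m}) (xi : 'I_n -> {RV P >-> R})
  (rho : 'M[R[i]]_m) (rho_hat : T -> 'M[R[i]]_m).
Hypotheses (m0 : (0 < m)%N) (n2 : (2 <= n)%N) (drho : density rho).
Hypothesis herm_ae : {ae Pi, forall x : borelmx R m, (x : 'M[R[i]]_m) \is hermsymmx}.
Hypothesis herm : forall j w, (X j w : 'M[R[i]]_m) \is hermsymmx.
Hypothesis lawX : forall j, has_law (X j) Pi.
Hypothesis iso : isotropic_subgaussian b0 Pi.
Hypotheses (sigma0 : 0 <= sigma)
  (lawxi : forall j, has_law (xi j) (centered_normal sigma)).
Hypothesis indep : mutually_independent X xi.
Hypotheses (t0 : 0 < t) (D0 : 0 <= D).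
Let eps := D * sigma * Num.sqrt (m%:R * t_m m t / n%:R).
Hypothesis argmin : forall w, argmin_risk (fun j => X j w)
  (fun j => response rho (X j w) (xi j w)) eps (rho_hat w).
Let q : R := m%:R * ln n%:R.
Hypothesis large : sample_ratio b0 * (q + t) <= n%:R.

Let K := noise_mgf_factor b0.

Lemma large_sample_oracle C :
  oracle_const b0 D <= C ->
  exists E : set T,
  [/\ measurable E, ((1 - expR (- t))%:E <= P E)%E &
    forall w, E w -> forall S : 'M[R[i]]_m, density S ->
      hsnorm (rho_hat w - rho) ^+ 2 <= 2 * hsnorm (S - rho) ^+ 2 +
        C * Num.max
          (sigma ^+ 2 * (\rank S)%:R * m%:R * t_m m t * ln (m%:R * n%:R) ^+ 2 / n%:R)
          (remainder m n t)].
Proof.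
move=> hC.
have m1 : 1 <= m%:R :> R by rewrite ler1n.
have n0 : (0 < n)%N by exact: leq_trans n2.
have np : 0 < n%:R :> R by rewrite ltr0n.
have ln2 : 1 / 2 <= ln n%:R :> R := ln_ge_half n2.
have [mn kn tn thn] := large_sample_bounds b0_gt0 m1 ln2 t0 np large.
have k0 := design_rate_gt0 b0_gt0.
have k1 : design_rate b0 <= 1 by rewrite ge_min lexx.
have K1 : 1 <= K := noise_mgf_factor_ge1 b0_gt0.
have q2 : 1 / 2 <= q.
  by apply: le_trans (ln2) _; rewrite ler_peMl//; apply: le_trans (ln2); rewrite divr_ge0.
have [N [N0 Nn hN eN iN]] := sample_split k0 k1 q2 kn.
(* A positive noise scale even for sigma = 0; the excess 1/m is absorbed in entropy_noise_sqr_le. *)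
pose s := sigma + m%:R^-1.
have mi0 : 0 < m%:R^-1 :> R by rewrite invr_gt0 (lt_le_trans _ m1).
have s0 : 0 < s by rewrite /s ltr_wpDl.
have s0' : 0 <= s := ltW s0.
have s2 : s ^+ 2 <= 2 * sigma ^+ 2 + 2 * m%:R^-1 ^+ 2.
  by have := sqr_ge0 (sigma - m%:R^-1); rewrite /s; lra.
pose L := 16 * m%:R * ln n%:R + t + 4 : R.
have LE : L <= 24 * (q + t) by rewrite /L -mulrA -/q; have := t0; lra.
have L0 : 0 <= L by rewrite /L -mulrA -/q; have := t0; lra.
have K0 : 0 <= K by apply: le_trans K1.
pose u := Num.sqrt (2 * K * s ^+ 2 * (L / n%:R)).
have u2 : u ^+ 2 = 2 * K * s ^+ 2 * (L / n%:R).
  rewrite sqr_sqrtr//; apply: mulr_ge0; last by rewrite divr_ge0.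
  by rewrite !mulr_ge0 ?sqr_ge0.
have u48 : u ^+ 2 <= 48 * K * s ^+ 2 * ((q + t) / n%:R).
  rewrite u2 (_ : 48 * K * s ^+ 2 * ((q + t) / n%:R) =
    2 * K * s ^+ 2 * (24 * (q + t) / n%:R)); last by ring.
  rewrite ler_wpM2l ?ler_pM2r ?invr_gt0//.
  by rewrite !mulr_ge0 ?sqr_ge0.
have u_small : u ^+ 2 <= sqr_exp_rate b0 * K ^+ 2 * s ^+ 2.
  apply: le_trans u48 _.
  rewrite (_ : _ * ((q + t) / n%:R) = 48 * ((q + t) / n%:R) * (K * s ^+ 2)); last by ring.
  rewrite -[leRHS]mulrA; apply: ler_pM => //.
  - by rewrite mulr_ge0// divr_ge0 ?ltW//; have := t0; lra.
  - by rewrite mulr_ge0 ?sqr_ge0.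
  - by rewrite ler_wpM2r ?sqr_ge0// expr2 ler_peMl.
have Nl : 32 * m%:R * N%:R * ln n%:R <= n%:R * design_rate b0 / 2.
  rewrite (_ : _ * ln _ = 64 * q * N%:R / 2); last by rewrite /q; field.
  by rewrite ler_pM2r// [n%:R * _]mulrC.
have mn' : (m <= n)%N by rewrite -(ler_nat R).
have ss : sigma <= s by rewrite lerDl ltW.
have noise j la : (\int[distribution P (xi j)]_z (expR (la * z))%:E <=
   (expR (la ^+ 2 * s ^+ 2 / 2))%:E)%E.
  exact: (noise_subgaussian _ sigma0 ss (lawxi j)).
have [E [mE pE hE]] := favourable_event b0_gt0 n2 m0 mn' herm_ae lawX iso noise indep
  s0 (sqrtr_ge0 _) N0 Nn Nl tn u2 u_small.
exists E; split=> // w /hE[near noise_le] S dS.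
have tm0 : 0 <= t_m m t.
  by apply: le_trans (t_m_ge t m0); rewrite addr_ge0// ltW.
have eps0 : 0 <= eps by rewrite !mulr_ge0 ?sqrtr_ge0.
have H := deterministic_oracle (fun j => herm j w) n0 m0 drho dS (sqrtr_ge0 _)
  eps0 (argmin w) near noise_le iN.
have Rem0 : 0 <= remainder m n t.
  rewrite -(pmulr_rge0 _ np); apply: le_trans (t_le_remainder m0 t0 n0).
  by rewrite addr_ge0// ltW.
have tR := t_le_remainder m0 t0 n0.
have qR := mln_le_remainder m t0 n2.
apply: (collect_remainders (pe := mesh_const b0) (pT := noise_const b0) (D2 := D ^+ 2)
  _ _ _ _ Rem0 H eN _ _ hC).
- exact: mesh_const_ge0.
- exact: noise_const_ge0.
- exact: sqr_ge0.
- apply: divr_ge0 => //; apply: mulr_ge0; last exact: sqr_ge0.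
  by rewrite !mulr_ge0.
- by rewrite ler_pdivrMr// -mulrA [_ * n%:R]mulrC.
rewrite exprMn sqr_sqrtr ?ler0n//.
apply: (entropy_noise_sqr_le (m := m%:R) (n := n%:R) (tm := t_m m t)
  (sg2 := sigma ^+ 2) (s2 := s ^+ 2) (q := q + t)) => //.
- by rewrite ler_nat rank_leq_row.
- exact: sqr_ge0.
- by have := t0; lra.
- exact: mln_t_le_variance.
- by move: qR tR; rewrite -/q; lra.
- rewrite /eps !exprMn sqr_sqrtr//.
  by rewrite divr_ge0// mulr_ge0.
Qed.
End large_sample.

Lemma sample_ratio_gt0 (R : realType) (b : R) : 0 < b -> 0 < sample_ratio b.
Proof.
move=> b0; rewrite /sample_ratio !addr_gt0 ?divr_gt0//.
  exact: design_rate_gt0.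
exact: sqr_exp_rate_gt0.
Qed.

(** The squared distance of two densities is at most 4, so in this
    regime the oracle inequality holds everywhere. *)
Lemma small_sample_remainder (R : realType) (b t : R) (m n : nat) :
  0 < b -> (0 < m)%N -> (0 < n)%N -> 0 < t ->
  ~~ ((2 <= n)%N && (sample_ratio b * (m%:R * ln n%:R + t) <= n%:R)) ->
  4 <= (12 * sample_ratio b + 8) * remainder m n t.
Proof.
move=> b0 m0 n0 t0 small; have K0 := sample_ratio_gt0 b0.
have np : 0 < n%:R :> R by rewrite ltr0n.
have tR := t_le_remainder m0 t0 n0.
have Rem0 : 0 <= remainder m n t.
  by rewrite -(pmulr_rge0 _ np); apply: le_trans tR; rewrite addr_ge0// ltW.
have KR : 0 <= sample_ratio b * remainder m n t by rewrite mulr_ge0// ltW.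
have [n2|n1] := leqP 2 n; last first.
  have n1E : n%:R = 1 :> R by rewrite (_ : n = 1%N)//; apply/eqP; rewrite eqn_leq n0 -ltnS n1.
  by move: tR; rewrite n1E mul1r; have := t0; lra.
move: small; rewrite n2/= -ltNge => small.
have qR := mln_le_remainder m t0 n2.
have h : sample_ratio b * (m%:R * ln n%:R + t) <=
    n%:R * (3 * (sample_ratio b * remainder m n t)).
  rewrite (_ : n%:R * _ = sample_ratio b * (3 * (n%:R * remainder m n t))); last by ring.
  by rewrite ler_pM2l//; lra.
have : 1 < 3 * (sample_ratio b * remainder m n t).
  by rewrite -(ltr_pM2l np) mulr1; exact: lt_le_trans small h.
lra.
Qed.

Theorem theorem2 (R : realType) (b0 : R) (b0_gt0 : 0 < b0) :
  exists2 c : R, 0 < c &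
  exists2 D0 : R, 0 < D0 &
  forall D : R, D0 <= D ->
  exists2 C : R, 0 < C &
  forall (m n : nat) (d : measure_display) (T : measurableType d)
    (P : probability T R)
    (Pi : probability (borelmx R m) R)
    (X : 'I_n -> {RV P >-> borelmx R m}) (xi : 'I_n -> {RV P >-> R})
    (rho : 'M[R[i]]_m) (sigma t : R) (rho_hat : T -> 'M[R[i]]_m),
  (0 < m)%N -> (0 < n)%N ->
  density rho ->
  (* X_1, ..., X_n are random Hermitian matrices with law Pi *)
  {ae Pi, forall x : borelmx R m, (x : 'M[R[i]]_m) \is hermsymmx} ->
  (forall j w, (X j w : 'M[R[i]]_m) \is hermsymmx) ->
  (forall j, has_law (X j) Pi) ->
  isotropic_subgaussian b0 Pi ->
  0 <= sigma ->
  (forall j, has_law (xi j) (centered_normal sigma)) ->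
  mutually_independent X xi ->
  0 < t -> tau_n n t <= c * n%:R -> t_m m t <= n%:R ->
  let eps := D * sigma * Num.sqrt (m%:R * t_m m t / n%:R) in
  (forall w, argmin_risk (fun j => X j w)
               (fun j => response rho (X j w) (xi j w)) eps (rho_hat w)) ->
  exists E : set T,
  [/\ measurable E,
      (P E >= (1 - expR (- t))%:E)%E &
      forall w, E w ->
        fine (L2sq Pi (rho_hat w - rho)) <=
        inf [set 2 * fine (L2sq Pi (S - rho))
                 + C * Num.max
                         (sigma ^+ 2 * (\rank S)%:R * m%:R * t_m m t
                            * ln (m%:R * n%:R) ^+ 2 / n%:R)
                         (m%:R * Num.max (tau_n n t * ln n%:R) (t_m m t)
                            / n%:R)
            | S in density]].
Proof.
have r0 := sample_ratio_gt0 b0_gt0; have C00 D := oracle_const_ge0 D b0_gt0.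
exists 1 => //; exists 1 => // D D1.
(* The first summand serves large samples, the second one small samples. *)
exists (oracle_const b0 D + (12 * sample_ratio b0 + 8)).
  by have := C00 D; lra.
move=> m n d T P Pi X xi rho sigma t rho_hat m0 n0 drho herm_ae herm lawX iso
  sigma0 lawxi indep t0 _ _ eps argmin.
set C := oracle_const b0 D + _.
have C_ge0 : 0 <= C by have := C00 D; rewrite /C; lra.
have D0 : 0 <= D by apply: le_trans D1.
(* The event does not depend on the oracle S, so the infimum can be taken on it. *)
suff [E [mE pE hE]] : exists E : set T,
  [/\ measurable E, ((1 - expR (- t))%:E <= P E)%E &
    forall w, E w -> forall S : 'M[R[i]]_m, density S ->
      hsnorm (rho_hat w - rho) ^+ 2 <= 2 * hsnorm (S - rho) ^+ 2 +
        C * Num.max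
          (sigma ^+ 2 * (\rank S)%:R * m%:R * t_m m t * ln (m%:R * n%:R) ^+ 2 / n%:R)
          (remainder m n t)].
  exists E; split=> // w Ew; apply: lb_le_inf.
    by eexists; exists rho.
  by move=> _ [S dS <-]; rewrite !(L2sqE _ iso); exact: hE.
have [/andP[n2 large]|small] :=
    boolP ((2 <= n)%N && (sample_ratio b0 * (m%:R * ln n%:R + t) <= n%:R)).
  apply: (large_sample_oracle b0_gt0 m0 n2 drho herm_ae herm lawX iso sigma0
    lawxi indep t0 D0 argmin large).
  by rewrite /C; lra.
exists setT; split=> //.
  by rewrite probability_setT lee_fin gerBl expR_ge0.
move=> w _ S dS.
have a2 : hsnorm (rho_hat w - rho) ^+ 2 <= 4.
  have h := hsnormB_density (argmin w).1 drho.
  have := ler_pM (hsnorm_ge0 _) (hsnorm_ge0 _) h h.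
  by rewrite -expr2; lra.
have Rem4 := small_sample_remainder b0_gt0 m0 n0 t0 small.
apply: le_trans a2 _; apply: (@le_trans _ _ (C * remainder m n t)).
  have R0 : 0 <= remainder m n t.
    rewrite -(pmulr_rge0 _ (_ : 0 < 12 * sample_ratio b0 + 8)); first lra.
    lra.
  have := mulr_ge0 (C00 D) R0; rewrite /C; lra.
rewrite -[leLHS]add0r; apply: lerD; first by rewrite mulr_ge0 ?sqr_ge0.
by rewrite ler_wpM2l// le_max lexx orbT.
Qed.
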